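(* There exists a universal constant $c>0$ such that the following holds. Let $\mathbb F\in\{\mathbb R,\mathbb C\}$, let $d,n_1,\dots,n_d\ge1$, $N=n_1\cdots n_d$, let $A\in\mathbb F^{k\times N}$, let $1\le r\le k$, and let $A_r$ be a best rank-$r$ approximation of $A$ in Frobenius norm. Let $\varepsilon,\delta\in(0,1)$ and let $\Omega\in\mathbb F^{PR\times N}$ be a TTStack sketch whose parameters satisfy $$R\ \ge\ c\,r\,d\log(2/\delta),\qquad P\ \ge\ 16e^4\max(4,1/\varepsilon).$$ Let $Q$ be a matrix whose columns form an orthonormal basis of the column space of $A\Omega^*$, and let $\widehat A=Q(Q^*A)\in\mathbb F^{k\times N}$. Then with probability at least $1-\delta$, $$\|A-\widehat A\|_F\le(1+\varepsilon)\,\|A-A_r\|_F.$$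
   Context: $\mathcal N_{\mathbb R}(0,\sigma^2)$ is the real centered Gaussian law of variance $\sigma^2$; $\mathcal N_{\mathbb C}(0,\sigma^2)$ is the law of $(Z_1+\mathrm i Z_2)/\sqrt2$ with $Z_1,Z_2$ iid $\mathcal N_{\mathbb R}(0,\sigma^2)$. TTStack sketch with integer parameters $P,R\ge1$: for $j\in\{1,\dots,P\}$, $k\in\{1,\dots,d\}$ and $i\in\{1,\dots,n_k\}$ let $G^{(j,k)}[i]$ be a random matrix in $\mathbb F^{R\times R}$ if $k\le d-1$ and in $\mathbb F^{R\times 1}$ if $k=d$; all entries of all these matrices are iid $\mathcal N_{\mathbb F}(0,1/R)$. Columns of $\Omega\in\mathbb F^{PR\times N}$ are indexed by multi-indices $(i_1,\dots,i_d)$ with $1\le i_k\le n_k$, rows by pairs $(j,\beta)$ with $1\le j\le P$, $1\le\beta\le R$, and $$\Omega_{(j,\beta),(i_1,\dots,i_d)}=\frac1{\sqrt P}\Bigl(G^{(j,1)}[i_1]\,G^{(j,2)}[i_2]\cdots G^{(j,d)}[i_d]\Bigr)_\beta .$$ *)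

(* Defs.v *)
From HB Require Import structures.
From mathcomp Require Import all_boot all_order all_algebra.
From mathcomp Require Import complex.
From mathcomp Require Import all_classical all_reals all_analysis.

Set Implicit Arguments.
Unset Strict Implicit.
Unset Printing Implicit Defensive.

Import Order.TTheory GRing.Theory Num.Theory.
Import numFieldNormedType.Exports.

Local Open Scope classical_set_scope.
Local Open Scope ring_scope.

Variant scalar_field := RealScalars | ComplexScalars.

Section Scalars.
Variable R : realType.

Definition Scalar (F : scalar_field) : numFieldType :=
  match F with
  | RealScalars => R
  | ComplexScalars => R[i]
  end.

Definition scalar_conj (F : scalar_field) : Scalar F -> Scalar F :=
  match F return Scalar F -> Scalar F with
  | RealScalars => fun x : R => x
  | ComplexScalars => fun z : R[i] => conjc z
  end.

(* The norm of the numFieldType R[i] takes values in R[i]; here it is in R. *)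
Definition scalar_abs (F : scalar_field) : Scalar F -> R :=
  match F return Scalar F -> R with
  | RealScalars => fun x : R => `|x|
  | ComplexScalars => fun z : R[i] => complex.Re `|z|
  end.

Definition of_real (F : scalar_field) : R -> Scalar F :=
  match F return R -> Scalar F with
  | RealScalars => fun x : R => x
  | ComplexScalars => fun x : R => (x%:C)%C
  end.

(* Borel sets; R[i] is identified with R * R. *)
Definition borel (F : scalar_field) : set (set (Scalar F)) :=
  match F return set (set (Scalar F)) with
  | RealScalars => [set B : set R | measurable B]
  | ComplexScalars => [set B : set R[i] |
      measurable [set z : R * R | B (z.1 +i* z.2)%C]]
  end.

(* The centered Gaussian law of variance v; normal_prob takes the standard
   deviation. Over R[i] it is the law of (Z1 + i Z2) / sqrt 2 with Z1, Z2
   independent real centered Gaussians of variance v. *)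
Definition gaussian_law (F : scalar_field) (v : R) : set (Scalar F) -> \bar R :=
  match F return set (Scalar F) -> \bar R with
  | RealScalars => fun B : set R => normal_prob 0 (Num.sqrt v) B
  | ComplexScalars => fun B : set R[i] =>
      (normal_prob 0 (Num.sqrt v) \x normal_prob 0 (Num.sqrt v))%E
        [set z : R * R |
          B ((z.1%:C + 'i * z.2%:C) / (Num.sqrt (2 : R))%:C)%C]
  end.

End Scalars.

Section Matrices.
Variables (R : realType) (F : scalar_field).
Local Notation K := (Scalar R F).

Definition adjmx (m n : nat) (A : 'M[K]_(m, n)) : 'M[K]_(n, m) :=
  map_mx (@scalar_conj R F) A^T.

Definition frobenius (m n : nat) (A : 'M[K]_(m, n)) : R :=
  Num.sqrt (\sum_(i < m) \sum_(j < n) scalar_abs (A i j) ^+ 2).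

Definition best_rank_approx (m n r : nat) (A Ar : 'M[K]_(m, n)) : Prop :=
  (\rank Ar <= r)%N /\
  forall B : 'M[K]_(m, n), (\rank B <= r)%N ->
    frobenius (A - Ar) <= frobenius (A - B).

(* mxalgebra's %MS compares row spaces, hence the transpositions. *)
Definition orthonormal_col_basis (k m q : nat)
    (Q : 'M[K]_(k, m)) (M : 'M[K]_(k, q)) : Prop :=
  adjmx Q *m Q = 1%:M /\ (Q^T == M^T)%MS.

End Matrices.

Section RandomFamilies.
Variables (R : realType) (F : scalar_field).
Variables (disp : measure_display) (T : measurableType disp).
Variable Pr : probability T R.
Local Notation K := (Scalar R F).

Definition has_gaussian_law (v : R) (X : T -> K) : Prop :=
  forall B, borel B ->
    measurable (X @^-1` B) /\ Pr (X @^-1` B) = gaussian_law v B.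

Definition mutually_independent (I : finType) (X : I -> T -> K) : Prop :=
  forall (J : {set I}) (B : I -> set K), (forall i, borel (B i)) ->
    Pr [set w | forall i, i \in J -> B i (X i w)] =
    (\prod_(i in J) Pr (X i @^-1` B i))%E.

Definition iid_gaussian (v : R) (I : finType) (X : I -> T -> K) : Prop :=
  mutually_independent X /\ forall i, has_gaussian_law v (X i).

End RandomFamilies.

(* The tensor order is d.+1, which encodes that it is at least 1; modes are
   indexed by 'I_d.+1, and the first d of them carry square cores. *)
Definition inner_mode (d : nat) (l : 'I_d) : 'I_d.+1 := widen_ord (leqnSn d) l.

Definition multi_index (d : nat) (n : 'I_d.+1 -> nat) : finType :=
  {dffun forall l : 'I_d.+1, 'I_(n l)}.

Lemma card_multi_index (d : nat) (n : 'I_d.+1 -> nat) :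
  #|multi_index n| = (\prod_l n l)%N.
Proof. by rewrite card_dep_ffun foldrE big_map big_enum /=;
  apply: eq_bigr => l _; rewrite card_ord. Qed.

Definition col_index (d : nat) (n : 'I_d.+1 -> nat)
    (t : 'I_(\prod_l n l)) : multi_index n :=
  enum_val (cast_ord (esym (card_multi_index n)) t).

(* Inverse of mxvec_index. *)
Definition row_index (p b : nat) (s : 'I_(p * b)) : 'I_p * 'I_b :=
  enum_val (cast_ord (esym (mxvec_cast p b)) s).

(* p is the number P of stacked blocks and b the bond dimension R. *)
Section TTStack.
Variables (R : realType) (F : scalar_field).
Variables (d : nat) (n : 'I_d.+1 -> nat) (p b : nat).
Local Notation K := (Scalar R F).

Definition inner_cores : Type :=
  'I_p -> forall l : 'I_d, 'I_(n (inner_mode l)) -> 'M[K]_b.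

Definition last_cores : Type := 'I_p -> 'I_(n ord_max) -> 'cV[K]_b.

Definition tt_product (G : inner_cores) (H : last_cores)
    (j : 'I_p) (i : multi_index n) : 'cV[K]_b :=
  (\big[mulmx/1%:M]_(l < d) G j l (i (inner_mode l))) *m H j (i ord_max).

Definition ttstack (G : inner_cores) (H : last_cores) :
    'M[K]_(p * b, \prod_l n l) :=
  \matrix_(s, t)
    (of_real F (Num.sqrt p%:R)^-1 *
     tt_product G H (row_index s).1 (col_index t) (row_index s).2 0).

Definition core_entry : finType :=
  ('I_p * {l : 'I_d & 'I_(n (inner_mode l))} * 'I_b * 'I_b +
   'I_p * 'I_(n ord_max) * 'I_b)%type.

Definition core_entries (T : Type) (G : T -> inner_cores) (H : T -> last_cores)
    (e : core_entry) (w : T) : K :=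
  match e with
  | inl (j, existT l i, a, c) => G w j l i a c
  | inr (j, i, a) => H w j i a 0
  end.

Definition gaussian_cores (disp : measure_display) (T : measurableType disp)
    (Pr : probability T R) (G : T -> inner_cores) (H : T -> last_cores) : Prop :=
  iid_gaussian Pr (b%:R^-1) (core_entries G H).

End TTStack.

(* Main.v *)
Require Import Defs.
From HB Require Import structures.
From mathcomp Require Import all_boot all_order all_algebra.
From mathcomp Require Import complex spectral.
From mathcomp Require Import all_classical all_reals all_analysis.
From mathcomp Require Import measurable_realfun.
From mathcomp Require Import zify ring lra.

Import Order.TTheory GRing.Theory Num.Theory.
Import numFieldNormedType.Exports.

Local Open Scope classical_set_scope.
Local Open Scope ring_scope.

Set Implicit Arguments.
Unset Strict Implicit.
Unset Printing Implicit Defensive.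

(* Reduce to complex scalars. Let V be an orthonormal basis of the row space of
   A_r and B = A - A V V^*, so that |B| <= |A - A_r| in Frobenius norm. If
   |Om V v|^2 >= |v|^2 / 2 for all v, then
     |A - Q Q^* A|^2 <= |B|^2 + 4 |B Om^* Om V|^2,
   and it remains to show that this lower bound and |B Om^* Om V|^2 <= (8/P) |B|^2
   hold together with probability at least 1 - delta.
   Both follow from a moment bound on the deviation |Om x|^2 - |x|^2. Conditioning
   on all layers but one, Om x is linear in that layer, and Gaussian integration
   by parts bounds the moments of the energy after the layer by those before it;
   iterated over the d layers this gives a 2s-th moment of order
   (d s / (P R))^s |x|^(4s) as soon as R >= 8 s d. The lower bound follows by a union over
   a net of C^r, with s of order r + log(2/delta), and the bound on B Om^* Om V
   from polarization and convexity, with s of order log(2/delta). *)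

(** * Polynomials in independent Gaussian variables *)

(** Conditioning is never formalized: the independence of a layer from the others enters as the
    vanishing of formal partial derivatives, so one measure and one integration by parts formula
    serve all layers. Let [F] be the mean energy of the blocks after a layer, minus its initial
    value. A layer preserves the expected energy, so the moments of [F] do not multiply from layer
    to layer: each layer adds to the squared size of [F] a term of order [s / (P R)], whence a
    factor [d] and not an exponential in [d]. The price is that the energy of a single block must
    keep bounded moments of order [2 s], which is where [R >= 8 s d] comes from. The two halves of
    the good event use this differently. The lower bound asks only for constant relative accuracy,
    but at exponentially many net points. The cross term [B Om^* Om V] is a sum over the [r] columns
    of [V] and all rows of [B]; a weighted average in place of a union bound makes the number of
    rows disappear and costs a factor [r], hence [R] of order [r d log(2/delta)], while the mean
    over blocks supplies [1/P]. *)

Section Transfer.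
Variable R : realType.
Import HBNNSimple.
Local Open Scope ereal_scope.

Let integral_nnsfun_comp d (T : measurableType d)
    (mu : {measure set T -> \bar R}) (Y h : T -> R) (f : {nnsfun R >-> R}) :
  measurable_fun setT Y -> measurable_fun setT h -> (forall x, 0 <= h x)%R ->
  \int[mu]_x (f (Y x) * h x)%:E =
  \sum_(r \in range f) r%:E * \int[mu]_x (\1_(f @^-1` [set r]) (Y x) * h x)%:E.
Proof.
move=> mY mh h0.
have mind (r : R) : measurable_fun setT
    (fun x => \1_(f @^-1` [set r]) (Y x) * h x : R)%R.
  apply: measurable_funM => //.
  by apply: measurableT_comp => //; exact: measurable_indic.
transitivity (\int[mu]_x (\sum_(r \in range f)
    r%:E * (\1_(f @^-1` [set r]) (Y x) * h x)%:E)).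
  apply: eq_integral => x _; rewrite [in LHS](fimfunE f (Y x)).
  rewrite !fsbig_finite//= mulr_suml sumEFin; congr EFin.
  by apply: eq_bigr => r _; rewrite mulrA.
rewrite ge0_integral_fsum//.
- apply: eq_fsbigr => r; rewrite inE => -[y _ fy].
  rewrite ge0_integralZl//.
  + exact/measurable_EFinP.
  + by move=> x _; rewrite lee_fin mulr_ge0.
  + by rewrite lee_fin -fy.
- by move=> r; apply: measurable_funeM; exact/measurable_EFinP.
- move=> r x _; rewrite -EFinM lee_fin mulrA mulr_ge0//.
  have [<-|/eqP fYr] := eqVneq (f (Y x)) r; first by rewrite mulr_ge0.
  by rewrite indicE memNset ?mulr0.
Qed.

(** The weights [h1] and [h2] hold the other factors of a product, so that one coordinate passes
    from indicators to nonnegative functions while the rest stays fixed. Simple functions first,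
    then monotone convergence. *)
Lemma integral_transfer d1 d2 (T1 : measurableType d1) (T2 : measurableType d2)
    (mu1 : {measure set T1 -> \bar R}) (mu2 : {measure set T2 -> \bar R})
    (Y1 : T1 -> R) (Y2 : T2 -> R) (h1 : T1 -> R) (h2 : T2 -> R) (f : R -> R) :
  measurable_fun setT Y1 -> measurable_fun setT Y2 ->
  measurable_fun setT h1 -> measurable_fun setT h2 ->
  (forall x, 0 <= h1 x)%R -> (forall x, 0 <= h2 x)%R ->
  (forall B, measurable B ->
     \int[mu1]_x (\1_B (Y1 x) * h1 x)%:E = \int[mu2]_x (\1_B (Y2 x) * h2 x)%:E) ->
  measurable_fun setT f -> (forall x, 0 <= f x)%R ->
  \int[mu1]_x (f (Y1 x) * h1 x)%:E = \int[mu2]_x (f (Y2 x) * h2 x)%:E.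
Proof.
move=> mY1 mY2 mh1 mh2 h10 h20 h12 mf f0.
have mfE : measurable_fun setT (EFin \o f) by exact/measurable_EFinP.
pose g := nnsfun_approx measurableT mfE.
have lim_int d (T : measurableType d) (mu : {measure set T -> \bar R})
    (Y h : T -> R) : measurable_fun setT Y ->
    measurable_fun setT h -> (forall x, 0 <= h x)%R ->
    \int[mu]_x (f (Y x) * h x)%:E =
    limn (fun n => \int[mu]_x (g n (Y x) * h x)%:E).
  move=> mY mh h0; rewrite -monotone_convergence//.
  - apply: eq_integral => x _; apply/esym/cvg_lim => //.
    apply: cvg_EFin; first exact: nearW.
    apply: cvgMr_tmp; apply: (@fine_cvg _ _ _ _ (EFin \o g^~ (Y x))).
    have fE0 y : setT y -> 0 <= (EFin \o f) y by rewrite lee_fin.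
    exact: (cvg_nnsfun_approx measurableT mfE fE0).
  - move=> n; apply/measurable_EFinP; apply: measurable_funM => //.
    exact: measurableT_comp.
  - by move=> n x _; rewrite lee_fin mulr_ge0.
  - move=> x _ m n mn; rewrite lee_fin ler_wpM2r//.
    exact/lefP/nd_nnsfun_approx.
rewrite !lim_int//; apply: congr_lim; apply/funext => n.
rewrite !integral_nnsfun_comp//.
by apply: eq_fsbigr => r _; rewrite h12.
Qed.

End Transfer.

(** * Moments of the centered Gaussian density *)

Section GaussianMoments.
Variables (R : realType) (s : R).
Hypothesis s_gt0 : 0 < s.
Local Notation mu := (@lebesgue_measure R).
Local Notation phi := (normal_pdf 0 s).

Let F (a : nat) (x : R) := x ^+ a * expR (- (x ^+ 2) / (s ^+ 2 *+ 2)).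

Let s0 : s != 0. Proof. by rewrite gt_eqF. Qed.

Let derF (a : nat) (x : R) :
  is_derive x (1 : R) (F a) (a%:R * F a.-1 x - F a.+1 x / s ^+ 2).
Proof.
rewrite /F.
have d1 : is_derive x (1 : R) (fun x : R => - (x ^+ 2) / (s ^+ 2 *+ 2)) (- x / s ^+ 2).
  apply: is_derive_eq.
  rewrite /GRing.scale/=. 
  by field.
have d2 : is_derive x (1 : R) (fun x : R => expR (- (x ^+ 2) / (s ^+ 2 *+ 2)))
   (expR (- (x ^+ 2) / (s ^+ 2 *+ 2)) * (- x / s ^+ 2)).
  exact: (@is_derive1_comp _ expR).
have d0 : is_derive x (1 : R) (fun x : R => x ^+ a) (a%:R * x ^+ a.-1).
  rewrite [X in is_derive _ _ X _](_ : _ = (id ^+ a)%R); last first.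
    by apply/funext => y; rewrite exprfctE.
  by apply: is_derive_eq; rewrite /GRing.scale/= mulr1.
apply: is_derive_eq.
rewrite /GRing.scale/= [x ^+ a.+1]exprS.
by field.
Qed.

(** Half of the exponent pays for the power: with [y = x^2 / b], use [|x|^a <= 1 + (x^2)^(a+1)] and
    [y^(a+1) <= (a+1)! exp y]. The other half is, up to normalization, the density of standard
    deviation [s * Num.sqrt 2], which is integrable. *)
Let expR_bound (a : nat) : exists2 C : R, 0 <= C &
  forall x, `|F a x| <= C * normal_pdf 0 (s * Num.sqrt 2) x.
Proof.
set b := (4 * s ^+ 2).
have b0 : 0 < b by rewrite mulr_gt0// exprn_gt0.
have [s2] : s * Num.sqrt 2 != 0 by rewrite mulf_neq0// gt_eqF.
set C := 1 + b ^+ a.+1 * (a.+1)`!%:R.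
have C0 : 0 <= C by rewrite addr_ge0// mulr_ge0// exprn_ge0// ltW.
exists (C / normal_peak (s * Num.sqrt 2)).
  by rewrite divr_ge0// normal_peak_ge0.
move=> x; rewrite normal_pdfE// mulrA divfK; last first.
  by rewrite gt_eqF// normal_peak_gt0.
rewrite /normal_fun subr0 exprMn sqr_sqrtr//.
rewrite /F normrM (ger0_norm (expR_ge0 _)).
have -> : - x ^+ 2 / (s ^+ 2 *+ 2) = - (x ^+ 2 / b) - (x ^+ 2 / b).
  by rewrite /b; field.
have -> : - x ^+ 2 / (s ^+ 2 * 2 *+ 2) = - (x ^+ 2 / b).
  by rewrite /b; field.
rewrite expRD mulrA ler_wpM2r ?expR_ge0//.
rewrite expRN ler_pdivrMr ?expR_gt0//.
set y := x ^+ 2 / b.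
have y0 : 0 <= y by rewrite divr_ge0// ?sqr_ge0// ltW.
have xy : x ^+ 2 = b * y by rewrite /y mulrC divfK// gt_eqF.
apply: (@le_trans _ _ (1 + (x ^+ 2) ^+ a.+1)).
  rewrite normrX -[x ^+ 2]real_normK ?num_real// -exprM.
  have [x1|x1] := leP `|x| 1.
    by rewrite ler_wpDr ?exprn_ge0// exprn_ile1.
  rewrite ler_wpDl// ler_weXn2l// ?ltW//.
  exact: leq_trans (leqnSn a) (leq_pmull _ _).
rewrite xy exprMn /C mulrDl mul1r lerD//.
  by rewrite -expR0 ler_expR.
rewrite -mulrA ler_wpM2l ?exprn_ge0 ?(ltW b0)//.
rewrite mulrC -ler_pdivrMr ?ltr0n ?fact_gt0//.
by apply: le_trans (expR_ge1Dxn a y0); rewrite ler_wpDl.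
Qed.

Let phiF (a : nat) (x : R) : x ^+ a * phi x = normal_peak s * F a x.
Proof. by rewrite normal_pdfE// /normal_fun subr0 mulrCA. Qed.

Lemma measurable_expn_normal_pdf (a : nat) :
  measurable_fun setT (fun x : R => x ^+ a * phi x).
Proof. by apply: measurable_funM => //; exact: measurable_normal_pdf. Qed.

Lemma integrable_expn_normal_pdf (a : nat) :
  mu.-integrable setT (EFin \o (fun x => x ^+ a * phi x)).
Proof.
have [C C0 FC] := expR_bound a.
apply: (@le_integrable _ _ _ mu setT measurableT _
   (EFin \o (fun x => (normal_peak s * C) * normal_pdf 0 (s * Num.sqrt 2) x))).
- apply/measurable_EFinP; exact: measurable_expn_normal_pdf.
- move=> x _ /=; rewrite lee_fin phiF normrM ger0_norm ?normal_peak_ge0//.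
  rewrite [leRHS]ger0_norm; last by rewrite !mulr_ge0 ?normal_peak_ge0 ?normal_pdf_ge0.
  by rewrite -mulrA ler_wpM2l ?normal_peak_ge0.
- have -> : EFin \o (fun x => (normal_peak s * C) * normal_pdf 0 (s * Num.sqrt 2) x) =
    (fun x => ((normal_peak s * C)%:E * (normal_pdf 0 (s * Num.sqrt 2) x)%:E)%E).
    by apply/funext => x /=; rewrite EFinM.
  by apply: integrableZl => //; exact: integrable_normal_pdf.
Qed.

Let G (a : nat) (x : R) := a%:R * F a.-1 x - F a.+1 x / s ^+ 2.

Let continuousF a : continuous (F a).
Proof.
move=> x; apply: differentiable_continuous; apply/derivable1_diffP.
by have [] := derF a x.
Qed.

Let continuousG a : continuous (G a).
Proof.
move=> x; apply: (@cvgB _ R^o); first by apply: cvgMl_tmp; exact: continuousF.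
by apply: cvgMr_tmp; exact: continuousF.
Qed.

Let integrableF a : mu.-integrable setT (EFin \o F a).
Proof.
have p0 : normal_peak s != 0 by rewrite gt_eqF// normal_peak_gt0.
have -> : EFin \o F a =
    (fun x => ((normal_peak s)^-1%:E * (EFin \o (fun x : R => (x ^+ a * phi x)%R)) x)%E).
  by apply/funext => x /=; rewrite phiF -EFinM mulrA mulVf// mul1r.
by apply: integrableZl => //; exact: integrable_expn_normal_pdf.
Qed.

Let integrableG a : mu.-integrable setT (EFin \o G a).
Proof.
have -> : EFin \o G a = ((fun x => a%:R%:E * (EFin \o F a.-1) x) \-
    (fun x => (s ^+ 2)^-1%:E * (EFin \o F a.+1) x))%E.
  by apply/funext => x /=; rewrite EFinB !EFinM (muleC (F a.+1 x)%:E).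
by apply: integrableB => //; apply: integrableZl => //; exact: integrableF.
Qed.

Let FTC a (n : nat) : (\int[mu]_(x in `[(- n.+1%:R)%R, n.+1%:R]) (G a x)%:E =
  (F a n.+1%:R)%:E - (F a (- n.+1%:R))%:E)%E.
Proof.
apply: continuous_FTC2.
- by rewrite gtrN.
- by apply: continuous_subspaceT; exact: continuousG.
- split=> //.
  + by move=> x _; have [] := derF a x.
  + by apply: cvg_at_right_filter; exact: continuousF.
  + by apply: cvg_at_left_filter; exact: continuousF.
- by move=> x _; rewrite derive1E; have [_ ->] := derF a x.
Qed.

(** [G a] is the derivative of [F a], so its integral over a symmetric interval is a boundary
    difference. Boundedness of [F a.+1] gives [|F a x| <= D / |x|], which sends that difference to
    zero. *)
Let integralG0 a : (\int[mu]_x (G a x)%:E = 0)%E.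
Proof.
pose f_ (n : nat) (x : R) : \bar R :=
  ((EFin \o G a) \_ `[(- n.+1%:R)%R, n.+1%:R]) x.
have [] := @dominated_convergence _ _ _ mu setT measurableT f_ (EFin \o G a)
  (abse \o (EFin \o G a)).
- move=> n; apply/(measurable_restrictT _ _).1 => //.
  by apply: measurable_funTS; exact: measurable_int (integrableG a).
- exact: measurable_int (integrableG a).
- apply: aeW => x _; apply: cvg_near_cst.
  near=> n; rewrite /f_ patchE mem_set//= in_itv/= -ler_norml.
  apply: ltW; apply: lt_trans (truncnS_gt _) _.
  rewrite ltr_nat ltnS; near: n; exact: nbhs_infty_gt.
- exact: integrable_abse.
- apply: aeW => x n _; rewrite /f_ patchE; case: ifP => //= _.
  by rewrite normr0 lee_fin normr_ge0.
move=> _ _; set u := (X in X @ \oo --> _) => cvgu.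
have [C C0 FC] := expR_bound a.+1.
set D := C * normal_peak (s * Num.sqrt 2).
have s20 : s * Num.sqrt 2 != 0 by rewrite mulf_neq0// gt_eqF.
have FD x : `|F a.+1 x| <= D.
  by apply: le_trans (FC x) _; rewrite ler_wpM2l// normal_pdf_ub.
have Fbd n (x : R) : `|x| = n.+1%:R -> `|F a x| <= D / n.+1%:R.
  move=> xn; rewrite ler_pdivlMr// -xn -normrM.
  by rewrite mulrC mulrA -exprS; exact: FD.
suff cvgu0 : u @ \oo --> 0%E by exact: cvg_unique cvgu cvgu0.
have uE n : u n = (F a n.+1%:R - F a (- n.+1%:R))%:E.
  by rewrite EFinB -FTC /u /f_ [RHS]integral_mkcond.
apply/fine_cvgP; split; first by apply: nearW => n; rewrite uE.
apply/norm_cvg0P.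
apply: (@squeeze_cvgr _ _ _ _ (cst 0) (fun n : nat => (2 * D) * (n.+1%:R)^-1)).
- apply: nearW => n /=; rewrite normr_ge0/= uE/=.
  apply: le_trans (ler_normB _ _) _; rewrite -mulrA mulr2n mulrDl mul1r.
  by rewrite lerD// Fbd// ?normrN ger0_norm.
- exact: cvg_cst.
- rewrite -(mulr0 (2 * D)); apply: cvgMl_tmp.
  exact: cvg_harmonic.
Unshelve. all: by end_near. Qed.

Lemma gaussian_moment_rec (a : nat) :
  \int[mu]_x (x ^+ a.+1 * phi x) = s ^+ 2 * a%:R * \int[mu]_x (x ^+ a.-1 * phi x).
Proof.
have iF := integrableF.
have := integralG0 a.
rewrite -[X in (X = _)%E](@fineK)//; last first.
  by apply: integrable_fin_num (integrableG a).
move=> [] /eqP; rewrite -/(Rintegral mu setT (G a)) RintegralB//; last 2 first.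
  by apply: (integrableZl measurableT _ (iF a.-1)).
  rewrite (_ : _ \o _ = (fun x => (s ^+ 2)^-1%:E * (EFin \o F a.+1) x)%E).
    by apply: integrableZl.
  by apply/funext => x /=; rewrite EFinM muleC.
rewrite RintegralZl// RintegralZr// subr_eq0 => /eqP.
have phiFint b : \int[mu]_x (x ^+ b * phi x) = normal_peak s * \int[mu]_x F b x.
  by rewrite -RintegralZl//; apply: eq_Rintegral => x _; rewrite phiF.
rewrite !phiFint => h.
rewrite mulrCA -mulrA h mulrCA [_ / _]mulrC.
by field.
Qed.

End GaussianMoments.

(** * Independent Gaussian families and integration by parts *)

Section GaussianFamily.
Variables (R : realType) (d : measure_display) (T : measurableType d).
Variables (Pr : probability T R) (I : finType) (Y : I -> T -> R) (v : R).

Local Notation mu := (@lebesgue_measure R).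
Local Notation phi := (normal_pdf 0 (Num.sqrt v)).

Definition gaussian_family : Prop :=
  [/\ 0 < v, forall i, measurable_fun setT (Y i) &
    forall B : I -> set R, (forall i, measurable (B i)) ->
    Pr [set w | forall i, B i (Y i w)] =
    (\prod_i normal_prob 0 (Num.sqrt v) (B i))%E].

Hypothesis gY : gaussian_family.

Let v_gt0 : 0 < v. Proof. by have [] := gY. Qed.
Let mY i : measurable_fun setT (Y i). Proof. by have [] := gY. Qed.
Let sv_gt0 : 0 < Num.sqrt v. Proof. by rewrite sqrtr_gt0. Qed.

(** Induction on a list containing every coordinate at which [f i] may fail to be an indicator. The
    empty list is the product formula on rectangles; a step applies [integral_transfer] at [i0], the
    other factors being the weight on one side and the constant [c] on the other. *)
Lemma ge0_expectation_prod (f : I -> R -> R) (e : I -> R) :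
  (forall i, measurable_fun setT (f i)) -> (forall i x, 0 <= f i x) ->
  (forall i, \int[mu]_x (f i x * phi x)%:E = (e i)%:E)%E ->
  (\int[Pr]_w (\prod_i f i (Y i w))%:E = (\prod_i e i)%:E)%E.
Proof.
suff main (s : seq I) : forall (f : I -> R -> R) (e : I -> R),
    (forall i, i \notin s -> exists2 B, measurable B & f i = \1_B) ->
    (forall i, measurable_fun setT (f i)) -> (forall i x, 0 <= f i x) ->
    (forall i, \int[mu]_x (f i x * phi x)%:E = (e i)%:E)%E ->
    (\int[Pr]_w (\prod_i f i (Y i w))%:E = (\prod_i e i)%:E)%E.
  by apply: (main (enum I)) => i; rewrite mem_enum.
elim: s => [|i0 s IH] {}f {}e fB mf f0 fe.
  have [B BP] : {B : I -> set R & forall i, measurable (B i) /\ f i = \1_(B i)}.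
    apply: (@choice _ _ (fun i B => measurable B /\ f i = \1_B)) => i.
    by have [|B mB fi] := fB i; [|exists B].
  have mB i : measurable (B i) by have [] := BP i.
  have fE i : f i = \1_(B i) by have [] := BP i.
  transitivity (\int[Pr]_w (\1_[set w | forall i, B i (Y i w)] w)%:E)%E.
    apply: eq_integral => w _; congr EFin.
    under eq_bigr do rewrite fE indicE.
    rewrite indicE; have [inB|ninB] := boolP (w \in _).
      by rewrite big1// => i _; rewrite mem_set//; move: inB; rewrite inE; apply.
    move: ninB; rewrite notin_setE => /existsNP[i nBi].
    by rewrite (bigD1 i)//= memNset// mul0r.
  have mS : measurable [set w | forall i, B i (Y i w)].
    rewrite (_ : mkset _ = \bigcap_(i in [set` enum I]) (Y i @^-1` B i)); last first.
      apply/seteqP; split=> w /=; first by move=> h i _; exact: h.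
      by move=> h i; apply: h; rewrite /= mem_enum.
    apply: fin_bigcap_measurable => [|i _]; first exact: finite_seq.
    by rewrite -[_ @^-1` _]setTI; exact: mY.
  rewrite integral_indic// setIT; have [_ _ /(_ _ mB) PrE] := gY.
  apply: etrans PrE _; rewrite -prodEFin; apply: eq_bigr => i _; rewrite -fe /normal_prob.
  rewrite [LHS]integral_mkcond; apply: eq_integral => x _.
  rewrite fE patchE indicE; case: ifPn; rewrite ?mul1r// ?mul0r//.
have e0 i : 0 <= e i.
  rewrite -lee_fin -fe; apply: integral_ge0 => x _.
  by rewrite lee_fin mulr_ge0// normal_pdf_ge0.
pose h1 w := \prod_(i | i != i0) f i (Y i w).
pose c := \prod_(i | i != i0) e i.
have := @integral_transfer R _ _ T _ Pr mu (Y i0) idfun h1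
  (fun x => phi x * c) (f i0).
have -> : (\int[Pr]_x (f i0 (Y i0 x) * h1 x)%:E =
    \int[Pr]_w (\prod_i f i (Y i w))%:E)%E.
  by apply: eq_integral => w _; rewrite [in RHS](bigD1 i0).
have int_c (g : R -> R) : measurable_fun setT g -> (forall x, 0 <= g x) ->
  (\int[mu]_x (g (idfun x) * (phi x * c))%:E = c%:E * \int[mu]_x (g x * phi x)%:E)%E.
  move=> mg g0; rewrite -ge0_integralZl//=.
  - by apply: eq_integral => x _; rewrite -EFinM mulrA mulrC.
  - apply/measurable_EFinP; apply: measurable_funM => //.
    exact: measurable_normal_pdf.
  - by move=> x _; rewrite lee_fin mulr_ge0// normal_pdf_ge0.
  - by rewrite lee_fin prodr_ge0.
have -> : (\prod_i e i)%:E = (\int[mu]_x (f i0 (idfun x) * (phi x * c))%:E)%E.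
  by rewrite (int_c (f i0))// fe (bigD1 i0)//= mulrC EFinM.
apply => //.
- exact: (@measurable_id _ _ setT).
- rewrite (_ : h1 = fun w => \prod_(i <- [seq i <- index_enum I | i != i0]) f i (Y i w)).
    by apply: measurable_prod => i _; apply: measurableT_comp.
  by apply/funext => w; rewrite big_filter.
- by apply: measurable_funM => //; exact: measurable_normal_pdf.
- by move=> w; rewrite prodr_ge0.
- by move=> x; rewrite mulr_ge0 ?normal_pdf_ge0// prodr_ge0.
move=> B mB; rewrite int_c//.
pose eB := fine (normal_prob 0 (Num.sqrt v) B).
have eBE : (\int[mu]_x (\1_B x * phi x)%:E = eB%:E)%E.
  rewrite /eB fineK; last by rewrite fin_num_measure.
  rewrite /normal_prob [RHS]integral_mkcond; apply: eq_integral => x _.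
  by rewrite patchE indicE; case: ifPn; rewrite ?mul1r// ?mul0r.
rewrite eBE.
pose fB' i := if i == i0 then \1_B else f i.
pose eB' i := if i == i0 then eB else e i.
have prodE : \prod_i eB' i = c * eB.
  rewrite (bigD1 i0)//= {1}/eB' eqxx mulrC; congr (_ * _).
  by apply: eq_bigr => i /negbTE ni; rewrite /eB' ni.
have intE : (\int[Pr]_w (\prod_i fB' i (Y i w))%:E =
    \int[Pr]_x (\1_B (Y i0 x) * h1 x)%:E)%E.
  apply: eq_integral => w _; rewrite (bigD1 i0)//= {1}/fB' eqxx; congr (_ * _)%:E.
  by apply: eq_bigr => i /negbTE ni; rewrite /fB' ni.
rewrite -EFinM -prodE -intE; apply: IH.
- move=> i ni; rewrite /fB'; case: eqVneq => [_|ii0]; first by exists B.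
  by apply: fB; rewrite inE negb_or ii0.
- by move=> i; rewrite /fB'; case: eqVneq => // _; exact: measurable_indic.
- by move=> i x; rewrite /fB'; case: eqVneq => // _.
- by move=> i; rewrite /fB' /eB'; case: eqVneq.
Qed.


Definition gaussian_moment (a : nat) : R := \int[mu]_x (x ^+ a * phi x).

Definition mono (a : {ffun I -> nat}) (w : T) : R := \prod_i Y i w ^+ a i.

(** Positive and negative parts of each power turn a monomial into a signed sum of nonnegative
    products, to which [ge0_expectation_prod] applies. *)
Let pospart (b : bool) (a : nat) (x : R) : R :=
  Num.max (if b then x ^+ a else - x ^+ a) 0.

Let pospart_ge0 b a x : 0 <= pospart b a x.
Proof. by rewrite /pospart le_max lexx orbT. Qed.

Let measurable_pospart b a : measurable_fun setT (pospart b a).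
Proof.
apply: measurable_maxr => //; case: b => //.
by apply: measurableT_comp => //; exact: measurable_funX.
Qed.

Let posparteE a x : x ^+ a = \sum_(b : bool) (-1) ^+ (~~ b) * pospart b a x.
Proof.
rewrite big_bool/= expr0 expr1 mul1r mulN1r /pospart.
case: (leP 0 (x ^+ a)) => h.
  by rewrite (max_idPr _) ?oppr_le0// subr0.
by rewrite (max_idPl _) ?oppr_ge0 ?(ltW h)// add0r opprK.
Qed.

Let integrable_pospart b a :
  mu.-integrable setT (EFin \o (fun x : R => pospart b a x * phi x)).
Proof.
apply: (le_integrable measurableT _ _ (integrable_expn_normal_pdf sv_gt0 a)).
  apply/measurable_EFinP; apply: measurable_funM; first exact: measurable_pospart.
  exact: measurable_normal_pdf.
move=> x _ /=; rewrite lee_fin !normrM ler_wpM2r// ger0_norm// /pospart.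
by rewrite ge_max normr_ge0 andbT; case: b; rewrite ?ler_norm// -normrN ler_norm.
Qed.

Let pmoment b a : R := \int[mu]_x (pospart b a x * phi x).

Let gaussian_momentE a :
  gaussian_moment a = \sum_(b : bool) (-1) ^+ (~~ b) * pmoment b a.
Proof.
rewrite big_bool/= expr0 expr1 mul1r mulN1r /pmoment -RintegralB//.
apply: eq_Rintegral => x _; rewrite -mulrBl [in LHS]posparteE big_bool/=.
by rewrite expr0 expr1 mul1r mulN1r.
Qed.

Let int_pospart (a : {ffun I -> nat}) (b : {ffun I -> bool}) :
  (\int[Pr]_w (\prod_i pospart (b i) (a i) (Y i w))%:E =
   (\prod_i pmoment (b i) (a i))%:E)%E.
Proof.
apply: (@ge0_expectation_prod (fun i => pospart (b i) (a i))) => // i. rewrite /pmoment /Rintegral fineK//.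
by apply: integrable_fin_num => //; exact: integrable_pospart.
Qed.

Let measurable_prod_pospart (a : {ffun I -> nat}) (b : {ffun I -> bool}) :
  measurable_fun setT (fun w => \prod_i pospart (b i) (a i) (Y i w)).
Proof.
by apply: measurable_prod => i _; apply: measurableT_comp.
Qed.

Let integrable_prod_pospart (a : {ffun I -> nat}) (b : {ffun I -> bool}) :
  Pr.-integrable setT
    (EFin \o (fun w => \prod_i pospart (b i) (a i) (Y i w))).
Proof.
apply/integrableP; split; first exact/measurable_EFinP/measurable_prod_pospart.
under eq_integral => w _.
  rewrite gee0_abs//; last by rewrite /= lee_fin prodr_ge0.
  over.
by rewrite /= int_pospart ltry.
Qed.

Let monoE a w : mono a w = \sum_(b : {ffun I -> bool})
  (\prod_i (-1) ^+ (~~ b i)) * \prod_i pospart (b i) (a i) (Y i w).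
Proof.
rewrite /mono; under eq_bigr do rewrite posparteE.
rewrite bigA_distr_bigA/=; apply: eq_bigr => b _.
by rewrite big_split.
Qed.

Lemma RintegralZl_setT (k : R) (f : T -> R) : Pr.-integrable setT (EFin \o f) ->
  \int[Pr]_w (k * f w) = k * \int[Pr]_w f w.
Proof. by move=> h; rewrite RintegralZl. Qed.

Lemma integrable_EFin_sum (J : Type) (s : seq J) (f : J -> T -> R) :
  (forall j, Pr.-integrable setT (EFin \o f j)) ->
  Pr.-integrable setT (EFin \o (fun w => \sum_(j <- s) f j w)).
Proof.
move=> h; rewrite (_ : _ \o _ = (fun w => \sum_(j <- s) (EFin \o f j) w)%E).
  exact: integrable_sum.
by apply/funext => w /=; rewrite -sumEFin.
Qed.

Lemma integrable_EFinZl (k : R) (f : T -> R) : Pr.-integrable setT (EFin \o f) ->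
  Pr.-integrable setT (EFin \o (fun w => k * f w)).
Proof.
move=> h; rewrite (_ : _ \o _ = (fun w => k%:E * (EFin \o f) w)%E).
  exact: integrableZl.
by apply/funext => w /=; rewrite EFinM.
Qed.

Lemma Rintegral_sum (J : Type) (s : seq J) (f : J -> T -> R) :
  (forall j, Pr.-integrable setT (EFin \o f j)) ->
  \int[Pr]_w (\sum_(j <- s) f j w) = \sum_(j <- s) \int[Pr]_w f j w.
Proof.
move=> h; elim: s => [|j s IH].
  by rewrite big_nil; under eq_Rintegral do rewrite big_nil; rewrite Rintegral_cst// mul0r.
rewrite big_cons -IH -RintegralD//; last exact: integrable_EFin_sum.
by apply: eq_Rintegral => w _; rewrite big_cons.
Qed.

Lemma integrable_mono a : Pr.-integrable setT (EFin \o mono a).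
Proof.
rewrite (_ : mono a = fun w => \sum_(b : {ffun I -> bool})
  (\prod_i (-1) ^+ (~~ b i)) * \prod_i pospart (b i) (a i) (Y i w)).
  by apply: integrable_EFin_sum => b; exact: integrable_EFinZl.
by apply/funext => w; rewrite monoE.
Qed.

Lemma expectation_mono a :
  \int[Pr]_w mono a w = \prod_i gaussian_moment (a i).
Proof.
under eq_Rintegral do rewrite monoE.
rewrite Rintegral_sum; last by move=> b; exact: integrable_EFinZl.
under [RHS]eq_bigr do rewrite gaussian_momentE.
rewrite bigA_distr_bigA/=; apply: eq_bigr => b _.
by rewrite RintegralZl_setT// big_split/= /Rintegral int_pospart.
Qed.

(** The subtraction is truncated, but [dec_exp i a] always comes with the factor [(a i)%:R], which
    vanishes in the truncated case. *)
Definition dec_exp (i : I) (a : {ffun I -> nat}) : {ffun I -> nat} :=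
  [ffun j => (a j - (j == i))%N].

Definition add_exp (a b : {ffun I -> nat}) : {ffun I -> nat} :=
  [ffun j => (a j + b j)%N].

Definition var_exp (i : I) : {ffun I -> nat} := [ffun j => (j == i) : nat].

Lemma mono_add a b w : mono (add_exp a b) w = mono a w * mono b w.
Proof.
by rewrite /mono -big_split/=; apply: eq_bigr => i _; rewrite ffunE exprD.
Qed.

Lemma mono_var i w : mono (var_exp i) w = Y i w.
Proof.
rewrite /mono (bigD1 i)//= ffunE eqxx expr1 big1 ?mulr1// => j /negbTE ji.
by rewrite ffunE ji.
Qed.

Lemma mono0 w : mono [ffun => 0%N] w = 1.
Proof. by rewrite /mono big1// => i _; rewrite ffunE. Qed.

Lemma expectation_mono_rec i a :
  \int[Pr]_w (Y i w * mono a w) =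
  v * ((a i)%:R * \int[Pr]_w mono (dec_exp i a) w).
Proof.
under eq_Rintegral do rewrite -mono_var -mono_add.
rewrite !expectation_mono (bigD1 i)//= [in RHS](bigD1 i)//= !ffunE eqxx/=.
rewrite add1n subn1 /gaussian_moment gaussian_moment_rec//.
rewrite sqr_sqrtr ?(ltW v_gt0)// !mulrA; congr (_ * _).
by apply: eq_bigr => j /negbTE ji; rewrite !ffunE ji add0n subn0.
Qed.

Definition poly_eval (s : seq (R * {ffun I -> nat})) (w : T) : R :=
  \sum_(t <- s) t.1 * mono t.2 w.

Definition poly_deriv (i : I) (s : seq (R * {ffun I -> nat})) (w : T) : R :=
  \sum_(t <- s) t.1 * ((t.2 i)%:R * mono (dec_exp i t.2) w).

(* [f] is a polynomial in the family [Y], and [f'] is its formal partial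
   derivative; a relation because [Y] need not be algebraically independent
   as a family of functions *)
Definition der (i : I) (f f' : T -> R) : Prop :=
  exists s, f =1 poly_eval s /\ f' =1 poly_deriv i s.

Definition polyfun (f : T -> R) : Prop := exists s, f =1 poly_eval s.

Lemma der_poly i f f' : der i f f' -> polyfun f.
Proof. by move=> [s [h _]]; exists s. Qed.

Lemma integrable_poly f : polyfun f -> Pr.-integrable setT (EFin \o f).
Proof.
move=> [s /funext ->]; apply: integrable_EFin_sum => t.
by apply: integrable_EFinZl; exact: integrable_mono.
Qed.

Lemma measurable_poly f : polyfun f -> measurable_fun setT f.
Proof.
by move=> /integrable_poly/measurable_int/measurable_EFinP.
Qed.

Lemma gaussian_ibp i f f' : der i f f' ->
  \int[Pr]_w (Y i w * f w) = v * \int[Pr]_w f' w.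
Proof.
move=> [s [/funext -> /funext ->]].
transitivity (\int[Pr]_w (\sum_(t <- s) t.1 * mono (add_exp (var_exp i) t.2) w)).
  apply: eq_Rintegral => w _; rewrite mulr_sumr; apply: eq_bigr => t _.
  by rewrite mono_add mono_var mulrCA.
rewrite !Rintegral_sum; last 2 first.
- by move=> t; do 2 apply: integrable_EFinZl; exact: integrable_mono.
- by move=> t; apply: integrable_EFinZl; exact: integrable_mono.
rewrite mulr_sumr; apply: eq_bigr => t _.
have im b := integrable_mono b.
rewrite RintegralZl_setT; last exact: im.
rewrite [in RHS]RintegralZl_setT; last by apply: integrable_EFinZl; exact: im.
rewrite [in RHS]RintegralZl_setT; last exact: im.
under eq_Rintegral do rewrite mono_add mono_var.
by rewrite expectation_mono_rec mulrCA.
Qed.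

Lemma der_ext i f f' g g' : f =1 g -> f' =1 g' -> der i f f' -> der i g g'.
Proof. by move=> /funext -> /funext ->. Qed.

Lemma der_cst i c : der i (fun _ => c) (fun _ => 0).
Proof.
exists [:: (c, [ffun => 0%N])]; split=> w.
  by rewrite /poly_eval big_seq1 mono0 mulr1.
by rewrite /poly_deriv big_seq1/= ffunE mul0r mulr0.
Qed.

Lemma der_var i j : der i (Y j) (fun _ => (j == i)%:R).
Proof.
exists [:: (1, var_exp j)]; split=> w.
  by rewrite /poly_eval big_seq1 mono_var mul1r.
rewrite /poly_deriv big_seq1/= ffunE mul1r eq_sym.
have [<-|_] := eqVneq j i; last by rewrite mul0r.
rewrite mul1r [X in mono X](_ : _ = [ffun => 0%N]) ?mono0//.
by apply/ffunP => k; rewrite !ffunE subnn.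
Qed.

Lemma derD i f f' g g' : der i f f' -> der i g g' ->
  der i (fun w => f w + g w) (fun w => f' w + g' w).
Proof.
move=> [s [fs f's]] [t [gt g't]]; exists (s ++ t).
by split=> w; rewrite ?fs ?f's ?gt ?g't /poly_eval /poly_deriv big_cat.
Qed.

Let mono_dec_add i a b w :
  ((add_exp a b) i)%:R * mono (dec_exp i (add_exp a b)) w =
  (a i)%:R * mono (dec_exp i a) w * mono b w +
  mono a w * ((b i)%:R * mono (dec_exp i b) w).
Proof.
have half (a' b' : {ffun I -> nat}) : (a' i)%:R * mono (dec_exp i (add_exp a' b')) w =
    (a' i)%:R * (mono (dec_exp i a') w * mono b' w).
  have [->|a'0] := posnP (a' i); first by rewrite !mul0r.
  rewrite -mono_add; congr (_ * mono _ w); apply/ffunP => j; rewrite !ffunE.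
  have [->|_] := eqVneq j i; last by rewrite !subn0.
  by rewrite addnBAC.
have addC : add_exp a b = add_exp b a by apply/ffunP => j; rewrite !ffunE addnC.
rewrite ffunE natrD mulrDl half [in X in _ + X]addC half.
by rewrite !mulrA; congr (_ + _); rewrite mulrC mulrA.
Qed.

Lemma derM i f f' g g' : der i f f' -> der i g g' ->
  der i (fun w => f w * g w) (fun w => f' w * g w + f w * g' w).
Proof.
move=> [s [fs f's]] [t [gt g't]].
exists [seq (x.1 * y.1, add_exp x.2 y.2) | x <- s, y <- t]; split=> w.
  rewrite fs gt /poly_eval big_allpairs_dep big_distrlr/=.
  apply: eq_bigr => x _; apply: eq_bigr => y _.
  by rewrite mono_add mulrACA.
rewrite fs f's gt g't /poly_eval /poly_deriv big_allpairs_dep !big_distrlr/=.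
rewrite -big_split/=; apply: eq_bigr => x _.
rewrite -big_split/=; apply: eq_bigr => y _.
by rewrite mono_dec_add; ring.
Qed.

Lemma derZ i c f f' : der i f f' -> der i (fun w => c * f w) (fun w => c * f' w).
Proof.
move=> h; apply: der_ext (derM (der_cst i c) h) => // w.
by rewrite mul0r add0r.
Qed.

Lemma derB i f f' g g' : der i f f' -> der i g g' ->
  der i (fun w => f w - g w) (fun w => f' w - g' w).
Proof.
move=> hf hg; apply: der_ext (derD hf (derZ (-1) hg)) => w; by rewrite mulN1r.
Qed.

Lemma derX i n f f' : der i f f' ->
  der i (fun w => f w ^+ n) (fun w => n%:R * f w ^+ n.-1 * f' w).
Proof.
move=> hf; elim: n => [|n IH].
  by apply: der_ext (der_cst i 1) => w; rewrite ?mul0r.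
apply: der_ext (derM hf IH) => w; first by rewrite exprS.
case: n {IH} => [|n] /=; first by rewrite !expr0; ring.
by rewrite -!natr1 [f w ^+ n.+1]exprS; ring.
Qed.

Lemma der_sum i (J : Type) (s : seq J) (f f' : J -> T -> R) :
  (forall j, der i (f j) (f' j)) ->
  der i (fun w => \sum_(j <- s) f j w) (fun w => \sum_(j <- s) f' j w).
Proof.
move=> h; elim: s => [|j s IH].
  by apply: der_ext (der_cst i 0) => w; rewrite big_nil.
by apply: der_ext (derD (h j) IH) => w; rewrite big_cons.
Qed.

End GaussianFamily.

(** * Deviation moments of the sketched norm *)

Section FiniteInequalities.
Variable R : realFieldType.

(** Weighted arithmetic-geometric mean inequality. The induction step adds [a] times the previous
    case and [(s+1) b^s (a - b)^2 >= 0]. *)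
Lemma young_pow (a b : R) (s : nat) : 0 <= a -> 0 <= b ->
  s.+1%:R * (a * b ^+ s) <= a ^+ s.+1 + s%:R * b ^+ s.+1.
Proof.
move=> a0 b0; elim: s => [|s IH]; first by rewrite !expr0 mul0r addr0 expr1; lra.
have h1 := ler_wpM2l a0 IH.
have h2 : 0 <= s.+1%:R * (b ^+ s * (a - b) ^+ 2).
  by apply: mulr_ge0 => //; apply: mulr_ge0; [exact: exprn_ge0|exact: sqr_ge0].
move: h1 h2; rewrite -!natr1 !exprS !mulr1.
set B := b ^+ s; set A := a ^+ s; set t : R := s%:R.
have -> : a * ((t + 1) * (a * B)) = (t + 1) * a * a * B by ring.
have -> : a * (a * A + t * (b * B)) = a * (a * A) + t * a * b * B by ring.
nra.
Qed.

Lemma CauchySchwarz_sum (I : finType) (x y : I -> R) :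
  (\sum_i x i * y i) ^+ 2 <= (\sum_i x i ^+ 2) * (\sum_i y i ^+ 2).
Proof.
have : 0 <= \sum_i \sum_j (x i * y j - x j * y i) ^+ 2.
  by do 2 (apply: sumr_ge0 => ? _); exact: sqr_ge0.
have -> : \sum_i \sum_j (x i * y j - x j * y i) ^+ 2 =
    \sum_i \sum_j x i ^+ 2 * y j ^+ 2 + \sum_i \sum_j x j ^+ 2 * y i ^+ 2 -
    2 * \sum_i \sum_j (x i * y i) * (x j * y j).
  rewrite mulr_sumr -big_split/= -sumrB; apply: eq_bigr => i _.
  rewrite mulr_sumr -big_split/= -sumrB; apply: eq_bigr => j _.
  ring.
rewrite [X in _ + X - _]exchange_big/= -!big_distrlr/= -expr2; lra.
Qed.

(** Jensen's inequality with unnormalized weights: [young_pow] is the tangent line of [t^(s+1)] at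
    the mean [m], summed against [p]. *)
Lemma weighted_mean_pow (I : Type) (r : seq I) (p X : I -> R) (s : nat) :
  (forall i, 0 <= p i) -> (forall i, 0 <= X i) ->
  (\sum_(i <- r) p i * X i) ^+ s.+1 <=
  (\sum_(i <- r) p i) ^+ s * \sum_(i <- r) p i * X i ^+ s.+1.
Proof.
move=> p0 X0; set P := \sum_(i <- r) p i.
have P0 : 0 <= P by apply: sumr_ge0.
have W0 : 0 <= \sum_(i <- r) p i * X i by apply: sumr_ge0 => i _; rewrite mulr_ge0.
have [P0'|Pn0] := eqVneq P 0.
  suff -> : \sum_(i <- r) p i * X i = 0.
    rewrite expr0n/= mulr_ge0 ?exprn_ge0// sumr_ge0// => i _.
    by rewrite mulr_ge0// exprn_ge0.
  move: P0'; rewrite /P => {P P0 W0}; elim: r => [|i r IH]; rewrite ?big_nil// !big_cons.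
  have r0 : 0 <= \sum_(j <- r) p j by apply: sumr_ge0.
  move=> h; have [-> h2] : p i = 0 /\ \sum_(j <- r) p j = 0.
    by have := p0 i; move: h r0; lra.
  by rewrite mul0r add0r IH.
have Pp : 0 < P by rewrite lt_def Pn0.
set W := \sum_(i <- r) p i * X i; pose m := W / P.
have m0 : 0 <= m by rewrite divr_ge0.
have WE : W = P * m by rewrite /m mulrC divfK.
have key : s.+1%:R * (W * m ^+ s) <= \sum_(i <- r) p i * X i ^+ s.+1 + s%:R * (P * m ^+ s.+1).
  rewrite mulr_suml mulr_sumr /P mulr_suml mulr_sumr -big_split/=.
  apply: ler_sum => i _; have := ler_wpM2l (p0 i) (young_pow s (X0 i) m0).
  by set a := m ^+ s; set b := m ^+ s.+1; set c := X i ^+ _; lra.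
rewrite WE exprMn exprSr -mulrA ler_wpM2l ?exprn_ge0//.
move: key; rewrite WE -mulrA -exprS -natr1.
by set a := P * _; lra.
Qed.

End FiniteInequalities.

Definition expect (R : realType) (d : measure_display) (T : measurableType d)
  (Pr : probability T R) (f : T -> R) : R := \int[Pr]_w f w.

Section PolynomialExpectation.
Variables (R : realType) (d : measure_display) (T : measurableType d).
Variables (Pr : probability T R) (I : finType) (Y : I -> T -> R) (v : R).
Hypothesis gY : gaussian_family Pr Y v.
Local Notation poly := (polyfun Y).
Local Notation E := (expect Pr).

Lemma polyfun_cst c : poly (fun _ => c).
Proof. by exists [:: (c, [ffun => 0%N])] => w; rewrite /poly_eval big_seq1 mono0 mulr1. Qed.

Lemma polyfunD f g : poly f -> poly g -> poly (fun w => f w + g w).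
Proof. by move=> [s fs] [t gt]; exists (s ++ t) => w; rewrite fs gt /poly_eval big_cat. Qed.

Lemma polyfunM f g : poly f -> poly g -> poly (fun w => f w * g w).
Proof.
move=> [s fs] [t gt].
exists [seq (x.1 * y.1, add_exp x.2 y.2) | x <- s, y <- t] => w.
rewrite fs gt /poly_eval big_allpairs_dep big_distrlr/=.
apply: eq_bigr => x _; apply: eq_bigr => y _.
by rewrite mono_add mulrACA.
Qed.

Lemma polyfunZ c f : poly f -> poly (fun w => c * f w).
Proof. by move=> h; apply: polyfunM => //; exact: polyfun_cst. Qed.

Lemma polyfun_ext f g : f =1 g -> poly f -> poly g.
Proof. by move=> /funext ->. Qed.

Lemma polyfunN f : poly f -> poly (fun w => - f w).
Proof. by move=> h; apply: polyfun_ext (polyfunZ (-1) h) => w; rewrite mulN1r. Qed.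

Lemma polyfunB f g : poly f -> poly g -> poly (fun w => f w - g w).
Proof. by move=> hf hg; apply: polyfunD => //; exact: polyfunN. Qed.

Lemma polyfunX n f : poly f -> poly (fun w => f w ^+ n).
Proof.
move=> hf; elim: n => [|n IH]; first by apply: polyfun_ext (polyfun_cst 1) => w.
by apply: polyfun_ext (polyfunM hf IH) => w; rewrite exprS.
Qed.

Lemma polyfun_sum (J : Type) (s : seq J) (P : pred J) (f : J -> T -> R) :
  (forall j, poly (f j)) -> poly (fun w => \sum_(j <- s | P j) f j w).
Proof.
move=> h; elim: s => [|j s IH].
  by apply: polyfun_ext (polyfun_cst 0) => w; rewrite big_nil.
have [Pj|Pj] := boolP (P j).
  by apply: polyfun_ext (polyfunD (h j) IH) => w; rewrite big_cons Pj.
by apply: polyfun_ext IH => w; rewrite big_cons (negbTE Pj).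
Qed.

Lemma polyfun_var i : poly (Y i).
Proof.
by exists [:: (1, var_exp i)] => w; rewrite /poly_eval big_seq1 mono_var mul1r.
Qed.

Lemma expectation_cst c : E (fun _ => c) = c.
Proof. by rewrite /expect Rintegral_cst//= probability_setT mulr1. Qed.

Lemma expectationD f g : poly f -> poly g ->
  E (fun w => f w + g w) = E f + E g.
Proof. by move=> hf hg; rewrite /expect RintegralD//; exact: integrable_poly gY _ _. Qed.

Lemma expectationZ c f : poly f -> E (fun w => c * f w) = c * E f.
Proof. by move=> hf; rewrite /expect RintegralZl//; exact: integrable_poly gY _ _. Qed.

Lemma expectation_sum (J : Type) (s : seq J) (f : J -> T -> R) :
  (forall j, poly (f j)) -> E (fun w => \sum_(j <- s) f j w) = \sum_(j <- s) E (f j).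
Proof. by move=> hf; rewrite /expect Rintegral_sum// => j; exact: integrable_poly gY _ _. Qed.

Lemma expectation_le f g : poly f -> poly g -> (forall w, f w <= g w) -> E f <= E g.
Proof. by move=> hf hg fg; rewrite /expect; apply: le_Rintegral => //; exact: integrable_poly gY _ _. Qed.

(* Young's inequality in place of Hoelder's: [E (V X^s) <= |V| |X|^s] in the
   [L^(s+1)] norm *)
Lemma absorb_moment X V s : poly X -> poly V ->
  (forall w, 0 <= X w) -> (forall w, 0 <= V w) ->
  E (fun w => X w ^+ s.+1) <= E (fun w => V w * X w ^+ s) ->
  E (fun w => X w ^+ s.+1) <= E (fun w => V w ^+ s.+1).
Proof.
move=> pX pV X0 V0 h.
have pXs := polyfunX s.+1 pX; have pVs := polyfunX s.+1 pV.
have pVX := polyfunM pV (polyfunX s pX).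
have : s.+1%:R * E (fun w => V w * X w ^+ s) <=
    E (fun w => V w ^+ s.+1) + s%:R * E (fun w => X w ^+ s.+1).
  rewrite -!expectationZ// -expectationD//; last exact: polyfunZ.
  apply: expectation_le => [| |w]; first exact: polyfunZ.
    by apply: polyfunD => //; exact: polyfunZ.
  exact: young_pow.
have s0 : 0 <= s.+1%:R :> R by [].
have := ler_wpM2l s0 h; rewrite -natr1.
by lra.
Qed.

Lemma expectation_ibp i f f' : der Y i f f' -> E (fun w => Y i w * f w) = v * E f'.
Proof. exact: gaussian_ibp. Qed.

Lemma eq_expect f g : f =1 g -> E f = E g.
Proof. by move=> fg; apply: eq_Rintegral => w _; exact: fg. Qed.

Section OneLayer.
Variables (J A : finType) (iota : J -> I) (c : A -> J -> T -> R).
Hypothesis iota_inj : injective iota.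
Hypothesis c_free : forall a i j, der Y (iota j) (c a i) (fun _ => 0).

Let z a w := \sum_i c a i w * Y (iota i) w.
Let S w := \sum_a z a w ^+ 2.
Let S' w := v * \sum_a \sum_i c a i w ^+ 2.
Let g i w := \sum_a c a i w * z a w.

Let der_z a i : der Y (iota i) (z a) (c a i).
Proof.
have h j : der Y (iota i) (fun w => c a j w * Y (iota j) w)
   (fun w => c a j w * (j == i)%:R).
  apply: der_ext (derM (c_free a j i) (der_var Y (iota i) (iota j))) => // w.
  by rewrite mul0r add0r (inj_eq iota_inj).
apply: der_ext (der_sum _ h) => // w.
rewrite (bigD1 i)//= eqxx mulr1 big1 ?addr0// => j /negbTE ->.
by rewrite mulr0.
Qed.

Let der_S i : der Y (iota i) S (fun w => 2 * g i w).
Proof.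
have h a : der Y (iota i) (fun w => z a w ^+ 2) (fun w => 2 * z a w * c a i w).
  by apply: der_ext (derX 2 (der_z a i)) => // w; rewrite expr1.
apply: der_ext (der_sum _ h) => // w; rewrite mulr_sumr; apply: eq_bigr => a _.
by ring.
Qed.

(** [S] is a quadratic form in the layer variables, [S'] its mean over them and [2 * g i] its
    derivative along [Y (iota i)]. Integrating by parts against one factor [Y (iota i)] of each
    [z a ^+ 2], the derivative of the remaining [z a] produces [S'] and the derivative of the power
    produces the last term. *)
Lemma layer_ibp (k : R) (m : nat) :
  (forall a i, poly (c a i)) ->
  E (fun w => S w * (S w - k) ^+ m) = E (fun w => S' w * (S w - k) ^+ m) +
  2 * v * m%:R * E (fun w => (S w - k) ^+ m.-1 * \sum_i g i w ^+ 2).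
Proof.
move=> pc.
have pz a : poly (z a).
  by apply: polyfun_sum => i; apply: polyfunM => //; exact: polyfun_var.
have pS : poly S by apply: polyfun_sum => a; exact: polyfunX.
have pg i : poly (g i) by apply: polyfun_sum => a; exact: polyfunM.
have pk n : poly (fun w => (S w - k) ^+ n).
  by apply: polyfunX; apply: polyfunB => //; exact: polyfun_cst.
pose f a i w := c a i w * z a w * (S w - k) ^+ m.
pose f' a i w := c a i w ^+ 2 * (S w - k) ^+ m +
  2 * m%:R * ((S w - k) ^+ m.-1 * (c a i w * z a w * g i w)).
have der_f a i : der Y (iota i) (f a i) (f' a i).
  have dk := derX m (derB (der_S i) (der_cst Y (iota i) k)).
  apply: der_ext (derM (derM (c_free a i i) (der_z a i)) dk) => // w.
  by rewrite /f'; ring.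
have pf' a i : poly (f' a i).
  apply: polyfunD; first by apply: polyfunM => //; exact: polyfunX.
  by apply: polyfunZ; apply: polyfunM => //; do 2 (apply: polyfunM => //).
transitivity (E (fun w => \sum_a \sum_i Y (iota i) w * f a i w)).
  apply: eq_expect => w; rewrite /S mulr_suml; apply: eq_bigr => a _.
  rewrite expr2 {1}/z -mulrA mulr_suml; apply: eq_bigr => i _.
  by rewrite /f -/(S w); ring.
have pYf a i : poly (fun w => Y (iota i) w * f a i w).
  by apply: polyfunM; [exact: polyfun_var|exact: der_poly (der_f a i)].
rewrite expectation_sum; last by move=> a; exact: polyfun_sum.
under eq_bigr => a _.
  rewrite expectation_sum//; under eq_bigr do rewrite (expectation_ibp (der_f _ _)).
  rewrite -mulr_sumr -expectation_sum//; over.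
rewrite -mulr_sumr -expectation_sum; last by move=> a; exact: polyfun_sum.
have pS' : poly (fun w => S' w * (S w - k) ^+ m).
  apply: polyfunM => //; apply: polyfunZ; do 2 apply: polyfun_sum => ?.
  exact: polyfunX.
have pG : poly (fun w => (S w - k) ^+ m.-1 * \sum_i g i w ^+ 2).
  by apply: polyfunM => //; apply: polyfun_sum => i; exact: polyfunX.
rewrite -expectationZ; last by do 2 apply: polyfun_sum => ?.
rewrite -expectationZ// -expectationD//; last exact: polyfunZ.
apply: eq_expect => w; rewrite /f' /S'.
under eq_bigr => a _ do rewrite big_split/= -mulr_suml -mulr_sumr -mulr_sumr.
rewrite big_split/= -mulr_suml -mulr_sumr -mulr_sumr mulrDr; congr (_ + _).
  by rewrite !mulrA.
rewrite exchange_big/= !mulrA; congr (_ * _); first by ring.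
apply: eq_bigr => i _; rewrite expr2 {2}/g mulr_suml; apply: eq_bigr => a _; ring.
Qed.

End OneLayer.

End PolynomialExpectation.

Lemma eq_ler (R : numDomainType) (x y : R) : x = y -> x <= y.
Proof. by move=> ->. Qed.

Section ComplexParts.
Variable R : realType.
Local Notation C := R[i].

Definition cpart (h : bool) (z : C) : R := if h then complex.Re z else complex.Im z.

Definition nsq (z : C) : R := complex.Re z ^+ 2 + complex.Im z ^+ 2.

Lemma nsq_ge0 z : 0 <= nsq z.
Proof. by rewrite addr_ge0// sqr_ge0. Qed.

Lemma nsqE z : nsq z = \sum_(h : bool) cpart h z ^+ 2.
Proof. by rewrite big_bool. Qed.

Lemma nsq0 : nsq 0 = 0.
Proof. by rewrite /nsq expr0n/= addr0. Qed.

Lemma nsqM x y : nsq (x * y) = nsq x * nsq y.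
Proof. by case: x => a b; case: y => c d; rewrite /nsq/=; ring. Qed.

Lemma cpart0 h : cpart h 0 = 0. Proof. by case: h. Qed.

Lemma cpartD h x y : cpart h (x + y) = cpart h x + cpart h y.
Proof. by case: h; case: x => ? ?; case: y. Qed.

Lemma cpart_sum h (J : Type) (s : seq J) (P : pred J) (f : J -> C) :
  cpart h (\sum_(j <- s | P j) f j) = \sum_(j <- s | P j) cpart h (f j).
Proof. by apply: (big_morph (cpart h)) => [x y|]; [exact: cpartD|exact: cpart0]. Qed.

Lemma cpart_real h x (r : R) : cpart h (x * r%:C%C) = cpart h x * r.
Proof. by case: h; case: x => a b /=; rewrite mulr0 ?subr0 ?add0r. Qed.

Lemma cpartM h x y : cpart h (x * y) =
  if h then cpart true x * cpart true y - cpart false x * cpart false y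
  else cpart true x * cpart false y + cpart false x * cpart true y.
Proof. by case: h; case: x => a b; case: y. Qed.

End ComplexParts.

Section ComplexLayer.
Variables (R : realType) (d : measure_display) (T : measurableType d).
Variables (Pr : probability T R) (I : finType) (Y : I -> T -> R) (v : R).
Hypothesis gY : gaussian_family Pr Y v.
Local Notation C := R[i].
Local Notation E := (expect Pr).

(** The formal counterpart of being independent of the variables in [D]. *)
Definition pfree (D : pred I) (f : T -> C) : Prop :=
  forall h, polyfun Y (fun w => cpart h (f w)) /\
    forall i, D i -> der Y i (fun w => cpart h (f w)) (fun _ => 0).

Lemma pfree_ext D f g : f =1 g -> pfree D f -> pfree D g.
Proof. by move=> /funext ->. Qed.

Lemma pfree_cst D c : pfree D (fun _ => c).
Proof. by move=> h; split=> [|i _]; [exact: polyfun_cst|exact: der_cst]. Qed.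

Lemma pfreeD D f g : pfree D f -> pfree D g -> pfree D (fun w => f w + g w).
Proof.
move=> hf hg h; have [pf df] := hf h; have [pg dg] := hg h; split=> [|i Di].
  by apply: polyfun_ext (polyfunD pf pg) => w; rewrite cpartD.
apply: der_ext (derD (df i Di) (dg i Di)) => w; first by rewrite cpartD.
by rewrite addr0.
Qed.

Lemma pfreeM D f g : pfree D f -> pfree D g -> pfree D (fun w => f w * g w).
Proof.
move=> hf hg h.
have [[pf1 df1] [pf2 df2]] := (hf true, hf false).
have [[pg1 dg1] [pg2 dg2]] := (hg true, hg false).
have ext : (fun w => cpart h (f w * g w)) =
  fun w => if h then cpart true (f w) * cpart true (g w) - cpart false (f w) * cpart false (g w)
  else cpart true (f w) * cpart false (g w) + cpart false (f w) * cpart true (g w).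
  by apply/funext => w; rewrite cpartM.
rewrite ext; case: h {ext}; split=> [|i Di].
- by apply: polyfunB; exact: polyfunM.
- apply: der_ext (derB (derM (df1 i Di) (dg1 i Di)) (derM (df2 i Di) (dg2 i Di))) => // w.
  by rewrite !mul0r !mulr0 !addr0 subr0.
- by apply: polyfunD; exact: polyfunM.
- apply: der_ext (derD (derM (df1 i Di) (dg2 i Di)) (derM (df2 i Di) (dg1 i Di))) => // w.
  by rewrite !mul0r !mulr0 !addr0.
Qed.

Lemma pfree_sum D (J : Type) (s : seq J) (P : pred J) (f : J -> T -> C) :
  (forall j, pfree D (f j)) -> pfree D (fun w => \sum_(j <- s | P j) f j w).
Proof.
move=> h; elim: s => [|j s IH].
  by apply: pfree_ext (pfree_cst D 0) => w; rewrite big_nil.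
have [Pj|/negbTE Pj] := boolP (P j).
  by apply: pfree_ext (pfreeD (h j) IH) => w; rewrite big_cons Pj.
by apply: pfree_ext IH => w; rewrite big_cons Pj.
Qed.

Lemma pfree_var (D : pred I) i : ~~ D i -> pfree D (fun w => (Y i w)%:C%C).
Proof.
move=> Di h; split=> [|j Dj]; case: h => /=.
- exact: polyfun_var.
- exact: polyfun_cst.
- apply: der_ext (der_var Y j i) => // w.
  by case: eqVneq => // ij; rewrite ij Dj in Di.
- exact: der_cst.
Qed.

Lemma polyfun_nsq D f : pfree D f -> polyfun Y (fun w => nsq (f w)).
Proof.
move=> hf; have [[p1 _] [p2 _]] := (hf true, hf false).
by apply: polyfunD; exact: polyfunX.
Qed.

(* One layer of the network: block [j] multiplies the inputs [U j th m] by
   independent Gaussian matrices with row index [A]. A Gaussian scalar is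
   [\sum_o om o * Y_o], with one summand in the real case and two in the complex
   case. *)
Section Layer.
Variables (Jb A Th M O : finType) (yi : (Jb * A) * (Th * O) -> I) (om : O -> C).
Variable U : Jb -> Th -> M -> T -> C.
Hypothesis yi_inj : injective yi.
Hypothesis om1 : \sum_o nsq (om o) = 1.
Hypothesis vA : v * #|A|%:R = 1.
Hypothesis U_free : forall j th m,
  pfree [pred i | i \in codom yi] (U j th m).

Definition layer_out j a m w : C :=
  \sum_th (\sum_o om o * (Y (yi ((j, a), (th, o))) w)%:C%C) * U j th m w.

Definition layer_energy j w : R := \sum_a \sum_m nsq (layer_out j a m w).

Definition layer_input j w : R := \sum_th \sum_m nsq (U j th m w).

(** Coefficients of the real and imaginary parts of the outputs, scaled by [q], as real linear forms
    in the Gaussians of the layer. The test reflects that a row of a block's matrix feeds only its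
    own output coordinate. *)
Let c (q : Jb -> R) (al : (Jb * A) * (M * bool)) (i : (Jb * A) * (Th * O)) w : R :=
  if al.1 == i.1 then q al.1.1 * cpart al.2.2 (om i.2.2 * U al.1.1 i.2.1 al.2.1 w)
  else 0.

(** The weights [q] allow both a single block (an indicator) and the mean over blocks (a constant).
    Cauchy-Schwarz bounds [\sum_i g i w ^+ 2]; there [q] occurs in [c] and again in [z], hence the
    fourth power. The sign hypothesis lets this bound be multiplied by the power of [S - k]. *)
Lemma layer_ineq (q : Jb -> R) (k : R) (m : nat) :
  (forall w, 0 <= (\sum_j q j ^+ 2 * layer_energy j w - k) ^+ m.-1) ->
  E (fun w => (\sum_j q j ^+ 2 * layer_energy j w) *
              (\sum_j q j ^+ 2 * layer_energy j w - k) ^+ m) <=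
  E (fun w => (\sum_j q j ^+ 2 * layer_input j w) *
              (\sum_j q j ^+ 2 * layer_energy j w - k) ^+ m) +
  2 * v * m%:R * E (fun w => (\sum_j q j ^+ 2 * layer_energy j w - k) ^+ m.-1 *
     \sum_j q j ^+ 4 * (layer_input j w * layer_energy j w)).
Proof.
move=> pos.
have v0 : 0 < v by have [] := gY.
have c_free al i i' : der Y (yi i') (c q al i) (fun _ => 0).
  rewrite /c; case: eqP => _; last exact: der_cst.
  have Di' : [pred i | i \in codom yi] (yi i') by rewrite /= codom_f.
  have fr : pfree [pred i | i \in codom yi] (fun w => om i.2.2 * U al.1.1 i.2.1 al.2.1 w).
    by apply: pfreeM => //; exact: pfree_cst.
  have [_ /(_ _ Di') h] := fr al.2.2.
  by apply: der_ext (derZ (q al.1.1) h) => // w; rewrite mulr0.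
have c_poly al i : polyfun Y (c q al i) by exact: der_poly (c_free al i i).
pose z al w := \sum_i c q al i w * Y (yi i) w.
have zE al w : z al w = q al.1.1 * cpart al.2.2 (layer_out al.1.1 al.1.2 al.2.1 w).
  rewrite /z (eq_bigr (fun i => c q al (i.1, i.2) w * Y (yi (i.1, i.2)) w)); last by case.
  rewrite -(pair_bigA _ (fun i1 i2 => c q al (i1, i2) w * Y (yi (i1, i2)) w))/=.
  rewrite (bigD1 al.1)//= [X in _ + X]big1 ?addr0; last first.
    move=> i /negbTE ni; apply: big1 => j _.
    by rewrite /c/= eq_sym ni mul0r.
  rewrite /layer_out cpart_sum mulr_sumr.
  rewrite (eq_bigr (fun x => c q al (al.1, (x.1, x.2)) w * Y (yi (al.1, (x.1, x.2))) w)); last by case.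
  rewrite -(pair_bigA _ (fun x1 x2 => c q al (al.1, (x1, x2)) w * Y (yi (al.1, (x1, x2))) w))/=.
  apply: eq_bigr => th _; rewrite mulr_suml cpart_sum mulr_sumr; apply: eq_bigr => o _.
  rewrite /c/= eqxx -surjective_pairing -mulrA; congr (_ * _).
  by rewrite mulrAC cpart_real.
have SE w : \sum_j q j ^+ 2 * layer_energy j w = \sum_al z al w ^+ 2.
  rewrite [RHS](eq_bigr (fun al => z (al.1, al.2) w ^+ 2)); last by case.
  rewrite -(pair_bigA _ (fun x1 x2 => z (x1, x2) w ^+ 2))/=.
  rewrite [RHS](eq_bigr (fun be => \sum_x2 z ((be.1, be.2), x2) w ^+ 2)); last by case.
  rewrite -(pair_bigA _ (fun j a => \sum_x2 z ((j, a), x2) w ^+ 2))/=.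
  apply: eq_bigr => j _; rewrite mulr_sumr; apply: eq_bigr => a _.
  rewrite (eq_bigr (fun x => z (j, a, (x.1, x.2)) w ^+ 2)); last by case.
  rewrite -(pair_bigA _ (fun x1 x2 => z (j, a, (x1, x2)) w ^+ 2))/=.
  rewrite mulr_sumr; apply: eq_bigr => mm _; rewrite nsqE mulr_sumr.
  by apply: eq_bigr => h _; rewrite zE exprMn.
have inE j w : \sum_(x : Th * O) \sum_mm \sum_h cpart h (om x.2 * U j x.1 mm w) ^+ 2 =
    layer_input j w.
  rewrite (eq_bigr (fun x => \sum_mm \sum_h cpart h (om (x.1, x.2).2 * U j (x.1, x.2).1 mm w) ^+ 2)); last by case.
  rewrite -(pair_bigA _ (fun x1 x2 => \sum_mm \sum_h cpart h (om x2 * U j x1 mm w) ^+ 2))/=.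
  apply: eq_bigr => th _; rewrite exchange_big/=; apply: eq_bigr => mm _.
  rewrite -[RHS]mul1r -om1 mulr_suml; apply: eq_bigr => o _.
  by rewrite -nsqM nsqE.
have c_sum w : v * \sum_al \sum_i c q al i w ^+ 2 = \sum_j q j ^+ 2 * layer_input j w.
  rewrite exchange_big/=.
  rewrite (eq_bigr (fun i => \sum_al c q al (i.1, i.2) w ^+ 2)); last by case.
  rewrite -(pair_bigA _ (fun i1 i2 => \sum_al c q al (i1, i2) w ^+ 2))/=.
  rewrite (eq_bigr (fun be => q be.1 ^+ 2 * layer_input be.1 w)); last first.
    move=> be _; rewrite -inE mulr_sumr; apply: eq_bigr => x _.
    rewrite (eq_bigr (fun al => c q (al.1, al.2) (be, x) w ^+ 2)); last by case.
    rewrite -(pair_bigA _ (fun x1 x2 => c q (x1, x2) (be, x) w ^+ 2))/=.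
    rewrite (bigD1 be)//= [X in _ + X]big1 ?addr0; last first.
      move=> i /negbTE ni; apply: big1 => j _.
      by rewrite /c/= ni expr0n.
    rewrite (eq_bigr (fun y => c q (be, (y.1, y.2)) (be, x) w ^+ 2)); last by case.
    rewrite -(pair_bigA _ (fun x1 x2 => c q (be, (x1, x2)) (be, x) w ^+ 2))/=.
    rewrite mulr_sumr; apply: eq_bigr => mm _; rewrite mulr_sumr.
    by apply: eq_bigr => h _; rewrite /c/= eqxx exprMn.
  rewrite (eq_bigr (fun be => q (be.1, be.2).1 ^+ 2 * layer_input (be.1, be.2).1 w)); last by case.
  rewrite -(pair_bigA _ (fun j (a : A) => q j ^+ 2 * layer_input j w))/=.
  rewrite mulr_sumr; apply: eq_bigr => j _.
  rewrite -[RHS]mul1r -vA -mulrA; congr (_ * _).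
  by rewrite sumr_const -[LHS]mulr_natl; congr (_%:R * _); exact: eq_card.
pose g i w := \sum_al c q al i w * z al w.
have g_sum w : \sum_i g i w ^+ 2 <=
    \sum_j q j ^+ 4 * (layer_input j w * layer_energy j w).
  rewrite (eq_bigr (fun i => g (i.1, i.2) w ^+ 2)); last by case.
  rewrite -(pair_bigA _ (fun i1 i2 => g (i1, i2) w ^+ 2))/=.
  have gE be x : g (be, x) w = \sum_(y : M * bool)
      (q be.1 * cpart y.2 (om x.2 * U be.1 x.1 y.1 w)) *
      (q be.1 * cpart y.2 (layer_out be.1 be.2 y.1 w)).
    rewrite /g (eq_bigr (fun al => c q (al.1, al.2) (be, x) w * z (al.1, al.2) w)); last by case.
    rewrite -(pair_bigA _ (fun x1 x2 => c q (x1, x2) (be, x) w * z (x1, x2) w))/=.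
    rewrite (bigD1 be)//= [X in _ + X]big1 ?addr0; last first.
      move=> i /negbTE ni; apply: big1 => j _.
      by rewrite /c/= ni mul0r.
    by apply: eq_bigr => y _; rewrite zE /c/= eqxx.
  have two (f : M -> C) (r : R) : \sum_(y : M * bool) (r * cpart y.2 (f y.1)) ^+ 2 =
      r ^+ 2 * \sum_mm nsq (f mm).
    rewrite (eq_bigr (fun y => (r * cpart (y.1, y.2).2 (f (y.1, y.2).1)) ^+ 2)); last by case.
    rewrite -(pair_bigA _ (fun y1 y2 => (r * cpart y2 (f y1)) ^+ 2))/= mulr_sumr.
    apply: eq_bigr => mm _; rewrite nsqE mulr_sumr; apply: eq_bigr => h _.
    by rewrite exprMn.
  apply: (@le_trans _ _ (\sum_(be : Jb * A) q be.1 ^+ 4 *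
     (layer_input be.1 w * \sum_mm nsq (layer_out be.1 be.2 mm w)))).
    apply: ler_sum => be _.
    rewrite mulrCA -inE mulr_suml; apply: ler_sum => x _.
    rewrite gE; apply: le_trans (CauchySchwarz_sum _ _) _.
    rewrite (two (fun mm => om x.2 * U be.1 x.1 mm w) (q be.1)).
    rewrite (two (fun mm => layer_out be.1 be.2 mm w) (q be.1)).
    rewrite -(eq_bigr _ (fun mm _ => nsqE (om x.2 * U be.1 x.1 mm w))).
    by apply: eq_ler; ring.
  rewrite (eq_bigr (fun be => q (be.1, be.2).1 ^+ 4 *
     (layer_input (be.1, be.2).1 w * \sum_mm nsq (layer_out (be.1, be.2).1 (be.1, be.2).2 mm w)))); last by case.
  rewrite -(pair_bigA _ (fun j a => q j ^+ 4 *
     (layer_input j w * \sum_mm nsq (layer_out j a mm w))))/=.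
  by apply: ler_sum => j _; rewrite /layer_energy !mulr_sumr.
have pz al : polyfun Y (z al).
  by apply: polyfun_sum => i; apply: polyfunM => //; exact: polyfun_var.
have pS : polyfun Y (fun w => \sum_j q j ^+ 2 * layer_energy j w).
  apply: (@polyfun_ext _ _ _ _ _ (fun w => \sum_al z al w ^+ 2)) => [w|]; first by rewrite SE.
  by apply: polyfun_sum => al; exact: polyfunX.
have pk n : polyfun Y (fun w => (\sum_j q j ^+ 2 * layer_energy j w - k) ^+ n).
  by apply: polyfunX; apply: polyfunB => //; exact: polyfun_cst.
have pin j : polyfun Y (layer_input j).
  by do 2 apply: polyfun_sum => ?; exact: polyfun_nsq (U_free _ _ _).
have pout j : polyfun Y (layer_energy j).
  apply: polyfun_sum => a; apply: polyfun_sum => mm; apply: (@polyfun_nsq pred0).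
  apply: pfree_sum => th; apply: pfreeM.
    by apply: pfree_sum => o; apply: pfreeM; [exact: pfree_cst|exact: pfree_var].
  by move=> h; have [] := U_free j th mm h.
have := layer_ibp gY yi_inj c_free k m c_poly.
rewrite -/z.
have -> : (fun w => (\sum_a z a w ^+ 2) * (\sum_a z a w ^+ 2 - k) ^+ m) =
  fun w => (\sum_j q j ^+ 2 * layer_energy j w) * (\sum_j q j ^+ 2 * layer_energy j w - k) ^+ m.
  by apply/funext => w; rewrite SE.
move=> ->.
apply: lerD.
  by apply: eq_ler; apply: eq_expect => w; rewrite -SE c_sum.
apply: ler_wpM2l; first by rewrite !mulr_ge0// ltW.
apply: (expectation_le gY).
- apply: (@polyfun_ext _ _ _ _ _ (fun w => (\sum_j q j ^+ 2 * layer_energy j w - k) ^+ m.-1 *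
    \sum_i g i w ^+ 2)) => [w|]; first by rewrite SE.
  apply: polyfunM => //; apply: polyfun_sum => i; apply: polyfunX.
  by apply: polyfun_sum => al; exact: polyfunM.
- apply: polyfunM => //; apply: polyfun_sum => j; apply: polyfunZ.
  exact: polyfunM.
- by move=> w; rewrite -SE ler_wpM2l//; exact: g_sum.
Qed.

End Layer.
End ComplexLayer.

(** * Energy moments through successive layers *)

Section LevelInduction.
Variables (R : realType) (d : measure_display) (T : measurableType d).
Variables (Pr : probability T R) (I : finType) (Y : I -> T -> R) (v : R).
Hypothesis gY : gaussian_family Pr Y v.
Local Notation E := (expect Pr).
Variables (p b D : nat) (N2 : R) (Z : nat -> 'I_p -> T -> R).
Hypotheses (p_gt0 : (0 < p)%N) (b_gt0 : (0 < b)%N) (N2_ge0 : 0 <= N2).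
Hypothesis Z_poly : forall l j, polyfun Y (Z l j).
Hypothesis Z_ge0 : forall l j w, 0 <= Z l j w.
Hypothesis Z0 : forall j w, Z 0 j w = N2.
Hypothesis Z_step : forall l, (l < D)%N -> forall (q : 'I_p -> R) (k : R) (m : nat),
  (forall w, 0 <= (\sum_j q j ^+ 2 * Z l.+1 j w - k) ^+ m.-1) ->
  E (fun w => (\sum_j q j ^+ 2 * Z l.+1 j w) *
              (\sum_j q j ^+ 2 * Z l.+1 j w - k) ^+ m) <=
  E (fun w => (\sum_j q j ^+ 2 * Z l j w) *
              (\sum_j q j ^+ 2 * Z l.+1 j w - k) ^+ m) +
  2 * b%:R^-1 * m%:R * E (fun w => (\sum_j q j ^+ 2 * Z l.+1 j w - k) ^+ m.-1 *
     \sum_j q j ^+ 4 * (Z l j w * Z l.+1 j w)).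

Let b0 : 0 < b%:R :> R. Proof. by rewrite ltr0n. Qed.
Let p0 : 0 < p%:R :> R. Proof. by rewrite ltr0n. Qed.

(** Take [k = 0] and [q] the indicator of block [j]: the integration by parts term is then itself a
    multiple of [E (Z l j * Z l.+1 j ^+ m)], and [absorb_moment] removes the powers of
    [Z l.+1 j]. *)
Lemma level_moment_step l j m : (l < D)%N ->
  E (fun w => Z l.+1 j w ^+ m.+1) <=
  (1 + 2 * m%:R / b%:R) ^+ m.+1 * E (fun w => Z l j w ^+ m.+1).
Proof.
move=> lD; pose q (i : 'I_p) : R := (i == j)%:R.
have qE n f : (0 < n)%N -> \sum_i q i ^+ n * f i = f j :> R.
  move=> n0; rewrite (bigD1 j)//= /q eqxx expr1n mul1r big1 ?addr0// => i /negbTE ->.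
  by rewrite expr0n gtn_eqF// mul0r.
have := @Z_step l lD q 0 m.
under eq_fun do rewrite !qE// subr0.
under [X in _ <= E X + _]eq_fun do rewrite !qE// subr0.
under [X in _ <= _ + _ * E X]eq_fun do rewrite !qE// subr0.
rewrite -/(expect _ _) => h.
have {}h : E (fun w => Z l.+1 j w * Z l.+1 j w ^+ m) <=
    E (fun w => Z l j w * Z l.+1 j w ^+ m) +
    2 * b%:R^-1 * m%:R * E (fun w => Z l.+1 j w ^+ m.-1 * (Z l j w * Z l.+1 j w)).
  by apply: h => w; rewrite qE// subr0 exprn_ge0.
pose V w := (1 + 2 * m%:R / b%:R) * Z l j w.
have pV : polyfun Y V by exact: polyfunZ.
have V0 w : 0 <= V w by rewrite mulr_ge0// addr_ge0// divr_ge0// mulr_ge0.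
have pZm l' n : polyfun Y (fun w => Z l' j w ^+ n) by exact: polyfunX.
have := @absorb_moment _ _ _ _ _ _ _ gY (Z l.+1 j) V m (Z_poly _ _) pV (Z_ge0 _ _) V0.
have VE : E (fun w => V w ^+ m.+1) =
    (1 + 2 * m%:R / b%:R) ^+ m.+1 * E (fun w => Z l j w ^+ m.+1).
  by rewrite -(expectationZ gY)//; apply: eq_expect => w; rewrite exprMn.
rewrite VE; apply.
rewrite (@eq_expect _ _ _ _ _ (fun w => Z l.+1 j w * Z l.+1 j w ^+ m)); last first.
  by move=> w; rewrite exprS.
apply: le_trans h _.
rewrite {}/V in pV V0 VE *; case: m {pV V0 VE} => [|m].
  by rewrite !mulr0 !mul0r !addr0; apply: eq_ler; apply: eq_expect => w; rewrite mul1r.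
have pZZ : polyfun Y (fun w => Z l j w * Z l.+1 j w ^+ m.+1) by exact: polyfunM.
have -> : E (fun w => Z l.+1 j w ^+ m.+1.-1 * (Z l j w * Z l.+1 j w)) =
    E (fun w => Z l j w * Z l.+1 j w ^+ m.+1).
  by apply: eq_expect => w; rewrite /= exprS; ring.
rewrite -{1}[E _]mul1r -mulrDl -(expectationZ gY)//; apply: eq_ler; apply: eq_expect => w.
by ring.
Qed.

Lemma level_moment l j m : (l <= D)%N ->
  E (fun w => Z l j w ^+ m.+1) <= (1 + 2 * m%:R / b%:R) ^+ (m.+1 * l) * N2 ^+ m.+1.
Proof.
elim: l => [|l IH] lD.
  rewrite muln0 expr0 mul1r (@eq_expect _ _ _ _ _ (fun _ => N2 ^+ m.+1)) ?expectation_cst//.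
  by move=> w; rewrite Z0.
apply: le_trans (level_moment_step j m lD) _.
rewrite mulnS exprD -[X in _ <= X]mulrA ler_wpM2l ?IH ?(ltnW lD)//.
Qed.

Variable s : nat.
Hypothesis sb : (8 * s.+1 * D <= b)%N.

Let m2s := (2 * s).+1.

(** The growth factor is at most the exponential of [4 (s+1) (2s+1) D / b], which is below [s + 1]
    because [b >= 8 (s+1) D]. *)
Lemma level_moment_bound l j : (l <= D)%N ->
  E (fun w => Z l j w ^+ m2s.+1) <= expR s.+1%:R * N2 ^+ m2s.+1.
Proof.
move=> lD; apply: le_trans (level_moment j m2s lD) _.
rewrite ler_wpM2r ?exprn_ge0//.
have m0 : 0 <= m2s%:R / b%:R :> R by rewrite divr_ge0.
apply: (@le_trans _ _ (expR (2 * m2s%:R / b%:R) ^+ (m2s.+1 * D))).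
  apply: (@le_trans _ _ ((1 + 2 * m2s%:R / b%:R) ^+ (m2s.+1 * D))).
    apply: ler_weXn2l; last by rewrite leq_mul2l lD orbT.
    by rewrite lerDl -mulrA mulr_ge0.
  by apply: lerXn2r; rewrite ?nnegrE ?expR_ge0// ?expR_ge1Dx// addr_ge0// -mulrA mulr_ge0.
rewrite -expRM_natl ler_expR mulrA ler_pdivrMr// -!natrM ler_nat.
apply: leq_trans (leq_mul (leqnn s.+1) sb).
rewrite /m2s; set t := s.+1.
have -> : (2 * s).+2 = (2 * t)%N by rewrite /t; lia.
rewrite (_ : s.+1 * _ = 8 * (t * t) * D)%N; last by rewrite /t; lia.
rewrite [X in (X <= _)%N](_ : _ = 4 * (t * (2 * s).+1) * D)%N; last by lia.
rewrite leq_mul2r; apply/orP; right; rewrite /t; nia.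
Qed.

Let Q : R := 8 * s.+1%:R * expR 1 / (p%:R * b%:R) * N2 ^+ 2.

Let F l w : R := p%:R^-1 * (\sum_j Z l j w) - N2.

Let W l w : R := 8 * s.+1%:R / (p%:R * b%:R) * (p%:R^-1 * \sum_j Z l j w * Z l.+1 j w).

Let W_poly l : polyfun Y (W l).
Proof.
by do 2 apply: polyfunZ; apply: polyfun_sum => j; exact: polyfunM.
Qed.

Let F_poly l : polyfun Y (F l).
Proof.
by apply: polyfunB; [apply: polyfunZ; exact: polyfun_sum|exact: polyfun_cst].
Qed.

Let W_ge0 l w : 0 <= W l w.
Proof.
apply: mulr_ge0; first by rewrite divr_ge0// mulr_ge0.
by rewrite mulr_ge0// sumr_ge0// => j _; rewrite mulr_ge0.
Qed.

(** Jensen over the blocks, then [x y <= (x^2 + y^2) / 2], which raises the moments of single blocks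
    to order [2 (s+1)]. This fixes the order in [level_moment_bound]. *)
Let W_moment l : (l < D)%N -> E (fun w => W l w ^+ s.+1) <= Q ^+ s.+1.
Proof.
move=> lD.
pose K : R := 8 * s.+1%:R / (p%:R * b%:R).
have K0 : 0 <= K by rewrite divr_ge0// mulr_ge0.
have pZ l' j n : polyfun Y (fun w => Z l' j w ^+ n) by exact: polyfunX.
apply: (@le_trans _ _ (E (fun w => K ^+ s.+1 * (p%:R^-1 * \sum_j
    2^-1 * (Z l j w ^+ m2s.+1 + Z l.+1 j w ^+ m2s.+1))))).
  apply: (expectation_le gY); first exact: polyfunX.
    do 2 apply: polyfunZ; apply: polyfun_sum => j; apply: polyfunZ.
    exact: polyfunD.
  move=> w; rewrite /W exprMn ler_wpM2l ?exprn_ge0//.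
  have := @weighted_mean_pow R _ (index_enum 'I_p) (fun _ => p%:R^-1)
    (fun j => Z l j w * Z l.+1 j w) s (fun _ => ltac:(rewrite invr_ge0//))
    (fun j => mulr_ge0 (Z_ge0 _ _ _) (Z_ge0 _ _ _)).
  rewrite -!mulr_sumr sumr_const card_ord -[p%:R^-1 *+ p]mulr_natr mulVf ?gt_eqF// expr1n mul1r.
  move=> /le_trans; apply; rewrite ler_wpM2l ?invr_ge0// mulr_sumr; apply: ler_sum => j _.
  rewrite exprMn /m2s (_ : (2 * s).+2 = s.+1 * 2)%N; last by lia.
  rewrite !exprM; have := sqr_ge0 (Z l j w ^+ s.+1 - Z l.+1 j w ^+ s.+1).
  by set x := Z l j w ^+ _; set y := Z l.+1 j w ^+ _; nra.
rewrite (expectationZ gY); last first.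
  apply: polyfunZ; apply: polyfun_sum => j; apply: polyfunZ; exact: polyfunD.
rewrite /Q -/K [X in _ <= X](_ : _ = K ^+ s.+1 * (expR s.+1%:R * N2 ^+ m2s.+1)); last first.
  rewrite (_ : 8 * s.+1%:R * expR 1 / (p%:R * b%:R) = K * expR 1); last first.
    by rewrite /K mulrAC.
  rewrite exprMn -exprM exprMn -expRM_natl mulr1 /m2s (_ : (2 * s).+2 = 2 * s.+1)%N ?mulrA//.
  by lia.
rewrite ler_wpM2l ?exprn_ge0// (expectationZ gY); last first.
  apply: polyfun_sum => j; apply: polyfunZ; exact: polyfunD.
rewrite mulrC ler_pdivrMr// (expectation_sum gY); last first.
  move=> j; apply: polyfunZ; exact: polyfunD.
apply: (@le_trans _ _ (\sum_(j < p) expR s.+1%:R * N2 ^+ m2s.+1)); last first.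
  by rewrite sumr_const card_ord mulr_natr.
apply: ler_sum => j _; rewrite (expectationZ gY); last exact: polyfunD.
rewrite (expectationD gY)//.
have := level_moment_bound j (ltnW lD); have := level_moment_bound j lD.
lra.
Qed.

(** With [k = N2] and an odd exponent, the terms in [N2] cancel. Then [F l * F l.+1] is split by
    [2 x y <= x^2 + y^2], half of the left side is absorbed, and [absorb_moment] is applied to the
    squares. The factor [8 (s+1)] in [W] covers the [4 (2s+1)] coming from integration by parts. *)
Let F_step l : (l < D)%N ->
  E (fun w => F l.+1 w ^+ (2 * s.+1)) <= E (fun w => (F l w ^+ 2 + W l w) ^+ s.+1).
Proof.
move=> lD; pose q (i : 'I_p) : R := Num.sqrt (p%:R^-1).
have q2 i : q i ^+ 2 = p%:R^-1 by rewrite sqr_sqrtr// invr_ge0.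
have q4 i : q i ^+ 4 = p%:R^-1 * p%:R^-1 by rewrite (exprM _ 2 2) q2 expr2.
have := @Z_step l lD q N2 m2s.
have S2 l' w : \sum_j q j ^+ 2 * Z l' j w = F l' w + N2.
  by rewrite /F subrK mulr_sumr; apply: eq_bigr => j _; rewrite q2.
have S4 w : \sum_j q j ^+ 4 * (Z l j w * Z l.+1 j w) =
    p%:R^-1 * (p%:R^-1 * \sum_j Z l j w * Z l.+1 j w).
  by rewrite !mulr_sumr; apply: eq_bigr => j _; rewrite q4 -mulrA.
pose X w := p%:R^-1 * (p%:R^-1 * \sum_j Z l j w * Z l.+1 j w).
have e1 : E (fun w => (\sum_j q j ^+ 2 * Z l.+1 j w) *
     (\sum_j q j ^+ 2 * Z l.+1 j w - N2) ^+ m2s) =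
   E (fun w => (F l.+1 w + N2) * F l.+1 w ^+ m2s).
  by apply: eq_expect => w; rewrite !S2 addrK.
have e2 : E (fun w => (\sum_j q j ^+ 2 * Z l j w) *
     (\sum_j q j ^+ 2 * Z l.+1 j w - N2) ^+ m2s) =
   E (fun w => (F l w + N2) * F l.+1 w ^+ m2s).
  by apply: eq_expect => w; rewrite !S2 addrK.
have e3 : E (fun w => (\sum_j q j ^+ 2 * Z l.+1 j w - N2) ^+ m2s.-1 *
     \sum_j q j ^+ 4 * (Z l j w * Z l.+1 j w)) =
   E (fun w => X w * F l.+1 w ^+ (2 * s)).
  by apply: eq_expect => w; rewrite !S2 addrK S4 mulrC.
have even_ge0 n (x : R) : 0 <= x ^+ (2 * n) by rewrite exprM exprn_ge0// sqr_ge0.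
rewrite e1 e2 e3 => h.
have {e1 e2 e3}h := h (fun w => ltac:(rewrite S2 addrK; exact: even_ge0)).
have pX : polyfun Y X.
  by do 2 apply: polyfunZ; apply: polyfun_sum => j; exact: polyfunM.
have pF n : polyfun Y (fun w => F l.+1 w ^+ n) by exact: polyfunX.
pose V w := F l w ^+ 2 + W l w.
have pV : polyfun Y V by apply: polyfunD => //; exact: polyfunX.
have V0 w : 0 <= V w by rewrite addr_ge0// sqr_ge0.
have pXF : polyfun Y (fun w => X w * F l.+1 w ^+ (2 * s)) by exact: polyfunM.
have pFF : polyfun Y (fun w => F l w * F l.+1 w ^+ m2s) by exact: polyfunM.
have pVF : polyfun Y (fun w => V w * F l.+1 w ^+ (2 * s)) by exact: polyfunM.
have split_h f : polyfun Y f -> E (fun w => (f w + N2) * F l.+1 w ^+ m2s) =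
    E (fun w => f w * F l.+1 w ^+ m2s) + N2 * E (fun w => F l.+1 w ^+ m2s).
  move=> pf; rewrite -(expectationZ gY)// -(expectationD gY); last 2 first.
  - exact: polyfunM.
  - exact: polyfunZ.
  by apply: eq_expect => w; rewrite mulrDl.
move: h; rewrite !split_h// => h.
have key : E (fun w => F l w * F l.+1 w ^+ m2s) +
    2 * b%:R^-1 * m2s%:R * E (fun w => X w * F l.+1 w ^+ (2 * s)) <=
    2^-1 * E (fun w => F l.+1 w ^+ (2 * s.+1)) +
    2^-1 * E (fun w => V w * F l.+1 w ^+ (2 * s)).
  rewrite -!(expectationZ gY)// -!(expectationD gY)//; try exact: polyfunZ.
  apply: (expectation_le gY) => [| |w]; try by apply: polyfunD => //; exact: polyfunZ.
  have X0 : 0 <= X w.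
    by do 2 (rewrite mulr_ge0// ?invr_ge0//); rewrite sumr_ge0// => j _; rewrite mulr_ge0.
  have XW : 4 * b%:R^-1 * m2s%:R * X w <= W l w.
    rewrite /W /X; set G := _^-1 * \sum_j _.
    have G0 : 0 <= G.
      by rewrite mulr_ge0// ?invr_ge0// sumr_ge0// => j _; rewrite mulr_ge0.
    rewrite mulrA ler_wpM2r// invfM.
    rewrite (_ : 4 / b%:R * m2s%:R / p%:R = 4 * m2s%:R * (p%:R^-1 * b%:R^-1)); last by ring.
    rewrite ler_wpM2r ?mulr_ge0 ?invr_ge0// -!natrM ler_nat /m2s.
    by lia.
  move: (X w) XW {X0} => x XW.
  rewrite (_ : F l.+1 w ^+ (2 * s.+1) = F l.+1 w ^+ 2 * F l.+1 w ^+ (2 * s)); last first.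
    by rewrite -exprD mulnS.
  rewrite (_ : F l.+1 w ^+ m2s = F l.+1 w * F l.+1 w ^+ (2 * s)); last by rewrite /m2s exprS.
  rewrite !mulrA -!mulrDl ler_wpM2r// /V.
  have := sqr_ge0 (F l w - F l.+1 w); nra.
have := @absorb_moment _ _ _ _ _ _ _ gY (fun w => F l.+1 w ^+ 2) V s (pF 2) pV
  (fun w => sqr_ge0 _) V0.
have -> : E (fun w => (F l.+1 w ^+ 2) ^+ s.+1) = E (fun w => F l.+1 w ^+ (2 * s.+1)).
  by apply: eq_expect => w; rewrite exprM.
have -> : E (fun w => V w * (F l.+1 w ^+ 2) ^+ s) = E (fun w => V w * F l.+1 w ^+ (2 * s)).
  by apply: eq_expect => w; rewrite exprM.
apply; move: h key.
have -> : E (fun w => F l.+1 w * F l.+1 w ^+ m2s) = E (fun w => F l.+1 w ^+ (2 * s.+1)).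
  by apply: eq_expect => w; rewrite -exprS /m2s mulnS.
lra.
Qed.

(** In the norm of order [s + 1], each layer adds at most [Q] to the square of [F]. Jensen with
    weights [l] and [1] takes the place of Minkowski's inequality. *)
Lemma level_deviation_moment :
  E (fun w => (p%:R^-1 * (\sum_j Z D j w) - N2) ^+ (2 * s.+1)) <=
  (D%:R * (8 * s.+1%:R * expR 1 / (p%:R * b%:R) * N2 ^+ 2)) ^+ s.+1.
Proof.
rewrite -/Q.
have Q0 : 0 <= Q.
  by rewrite mulr_ge0 ?sqr_ge0// divr_ge0// ?mulr_ge0// expR_ge0.
suff main l : (l <= D)%N -> E (fun w => F l w ^+ (2 * s.+1)) <= (l%:R * Q) ^+ s.+1.
  exact: main.
elim: l => [|l IH] lD.
  rewrite (@eq_expect _ _ _ _ _ (fun _ => 0)) ?expectation_cst ?mul0r ?expr0n//=.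
  move=> w; rewrite /F; under eq_bigr do rewrite Z0.
  rewrite sumr_const card_ord -[N2 *+ p]mulr_natl mulrA mulVf ?gt_eqF//.
  by rewrite mul1r subrr expr0n.
apply: le_trans (F_step lD) _.
(* At [l = 0] the quotient by [l] below is zero by convention, which is correct because [F] vanishes
   there. *)
have F0 w : l = 0%N -> F l w = 0.
  move=> ->; rewrite /F; under eq_bigr do rewrite Z0.
  by rewrite sumr_const card_ord -[N2 *+ p]mulr_natl mulrA mulVf ?gt_eqF// mul1r subrr.
have pFX : polyfun Y (fun w => F l w ^+ (2 * s.+1)) by exact: polyfunX.
have pWX : polyfun Y (fun w => W l w ^+ s.+1) by exact: polyfunX.
apply: (@le_trans _ _ (E (fun w => l.+1%:R ^+ s *
   (l%:R * l%:R ^- s.+1 * F l w ^+ (2 * s.+1) + W l w ^+ s.+1)))).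
  apply: (expectation_le gY).
  - by apply: polyfunX; apply: polyfunD => //; exact: polyfunX.
  - by apply: polyfunZ; apply: polyfunD => //; exact: polyfunZ.
  - move=> w; have := @weighted_mean_pow R _ (index_enum bool)
      (fun i => if i then l%:R else 1)
      (fun i => if i then F l w ^+ 2 / l%:R else W l w) s.
    rewrite !big_bool/= !mul1r natr1 => h.
    have FE : F l w ^+ 2 = l%:R * (F l w ^+ 2 / l%:R).
      have [l0|l0] := posnP l; first by rewrite F0// expr0n mul0r mulr0.
      by rewrite mulrC divfK// pnatr_eq0 -lt0n.
    rewrite {1}FE; apply: le_trans (h _ _) _; first by case.
      by case=> //; rewrite divr_ge0// sqr_ge0.
    by rewrite exprMn exprVn -exprM -mulrA [_ ^- _ * _]mulrC.
rewrite (expectationZ gY); last by apply: polyfunD => //; exact: polyfunZ.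
rewrite (expectationD gY)//; last exact: polyfunZ.
rewrite (expectationZ gY)// [X in _ <= X]exprMn [X in _ <= X * _]exprSr -[X in _ <= X]mulrA ler_wpM2l ?exprn_ge0//.
apply: (@le_trans _ _ (l%:R * l%:R ^- s.+1 * (l%:R * Q) ^+ s.+1 + Q ^+ s.+1)).
  apply: lerD; last exact: W_moment.
  by rewrite ler_wpM2l ?IH ?(ltnW lD)// mulr_ge0// invr_ge0 exprn_ge0.
have [->|l0] := posnP l; first by rewrite !mul0r add0r mul1r.
rewrite exprMn mulrA mulfVK ?expf_neq0 ?pnatr_eq0 -?lt0n//.
by rewrite -natr1 mulrDl mul1r.
Qed.

End LevelInduction.

(** * Contracting a tensor with the cores, from the last mode to the first *)

Section TTLevels.
Variables (R : realType) (d : nat) (n : 'I_d.+1 -> nat) (p b : nat).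
Local Notation C := R[i].
Local Notation midx := (multi_index n).
Local Notation entry := (core_entry n p b).

Definition inner_mx (g : entry -> C) (j : 'I_p) (l : 'I_d)
    (t : 'I_(n (inner_mode l))) : 'M[C]_b :=
  \matrix_(a, c) g (inl (j, existT (fun l => 'I_(n (inner_mode l))) l t, a, c)).

Definition last_mx (g : entry -> C) (j : 'I_p) (t : 'I_(n ord_max)) : 'cV[C]_b :=
  \col_a g (inr (j, t, a)).

Definition tail_product (g : entry -> C) (k : nat) (j : 'I_p) (i : midx) : 'cV[C]_b :=
  (\big[mulmx/1%:M]_(l <- drop k (enum 'I_d)) inner_mx g j (i (inner_mode l)))
    *m last_mx g j (i ord_max).

(** Multi-indices keep their full length, and partial ones are classes of this relation; this avoids
    a dependent type for each number of remaining modes. *)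
Definition agree (k : nat) (i i' : midx) : bool :=
  [forall l : 'I_d.+1, (l < k)%N ==> (i' l == i l)].

(* [x] contracted with the cores of the modes [k, ..., d], the first [k] indices
   being those of [i]. *)
Definition tail_vec (g : entry -> C) (x : midx -> C) (k : nat) (j : 'I_p) (i : midx)
    : 'cV[C]_b :=
  \sum_(i' | agree k i i') x i' *: tail_product g k j i'.

Definition upd (i : midx) (l : 'I_d.+1) (t : 'I_(n l)) : midx :=
  finfun (eqtype.dfwith (fun l => i l) t).

Lemma upd_same i l t : @upd i l t l = t.
Proof. by rewrite ffunE eqtype.dfwith_in. Qed.

Lemma upd_diff i l t l' : l' != l -> @upd i l t l' = i l'.
Proof. by move=> ll'; rewrite ffunE eqtype.dfwith_out// eq_sym. Qed.

Lemma agree_upd k i i' (l : 'I_d.+1) t : l = k :> nat ->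
  agree k.+1 (@upd i l t) i' = agree k i i' && (i' l == t).
Proof.
move=> lk; apply/forallP/andP => [h|[/forallP h /eqP it] l'].
  split; last by have := h l; rewrite lk ltnSn upd_same.
  apply/forallP => l'; apply/implyP => l'k.
  have := h l'; rewrite ltnS (ltnW l'k)/= upd_diff//.
  by apply: contraTneq l'k => ->; rewrite lk ltnn.
apply/implyP; rewrite ltnS leq_eqVlt => /orP[/eqP l'k|l'k].
  have -> : l' = l by apply: val_inj; rewrite /= l'k lk.
  by rewrite upd_same it.
rewrite upd_diff; first by have := h l'; rewrite l'k.
by apply: contraTneq l'k => ->; rewrite lk ltnn.
Qed.

Lemma tail_product_step g k j i (l : 'I_d) : l = k :> nat ->
  tail_product g k j i =
  inner_mx g j (i (inner_mode l)) *m tail_product g k.+1 j i.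
Proof.
move=> lk; rewrite /tail_product (drop_nth l) ?size_enum_ord -?lk//.
by rewrite big_cons nth_ord_enum mulmxA.
Qed.

Lemma tail_vec_step g x k j i (l : 'I_d) : l = k :> nat ->
  tail_vec g x k j i =
  \sum_t inner_mx g j t *m tail_vec g x k.+1 j (@upd i (inner_mode l) t).
Proof.
move=> lk; rewrite /tail_vec.
rewrite (partition_big (fun i' : midx => i' (inner_mode l)) predT)//=.
apply: eq_bigr => t _; rewrite mulmx_sumr.
apply: eq_big => i'; first by rewrite agree_upd.
move=> /andP[_ /eqP <-]; rewrite (tail_product_step _ _ _ lk).
by rewrite scalemxAr.
Qed.

Lemma tail_vec_last g x j i :
  tail_vec g x d j i = \sum_t x (@upd i ord_max t) *: last_mx g j t.
Proof.
rewrite /tail_vec (partition_big (fun i' : midx => i' ord_max) predT)//=.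
apply: eq_bigr => t _; rewrite (big_pred1 (upd i t)).
  rewrite /tail_product drop_oversize ?size_enum_ord// big_nil mul1mx.
  by rewrite upd_same.
move=> i'; rewrite -agree_upd//; apply/forallP/eqP => [h|-> l].
  by apply/ffunP => l; have := h l; rewrite ltn_ord/= => /eqP.
by rewrite eqxx implybT.
Qed.

Lemma tail_vec0 g x j i : tail_vec g x 0 j i =
  \sum_i' x i' *: ((\big[mulmx/1%:M]_(l < d) inner_mx g j (i' (inner_mode l)))
    *m last_mx g j (i' ord_max)).
Proof.
apply: eq_big => i'; first by apply/forallP.
by move=> _; rewrite /tail_product drop0 [X in \big[_/_]_(_ <- X) _]enumT; congr (_ *: (_ *m _)); rewrite [index_enum _]unlock.
Qed.

Variable i0 : midx.

(* The [i] with [base k i] represent the classes of [agree k]. *)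
Definition base (k : nat) (i : midx) : bool :=
  [forall l : 'I_d.+1, (k <= l)%N ==> (i l == i0 l)].

Lemma base_upd k (l : 'I_d.+1) (f : midx -> R) : l = k :> nat ->
  \sum_(i | base k.+1 i) f i = \sum_(i | base k i) \sum_t f (@upd i l t).
Proof.
move=> lk.
have ne_l (l' : 'I_d.+1) : (k < l')%N -> l' != l.
  by move=> kl'; apply: contraTneq kl' => ->; rewrite lk ltnn.
rewrite (partition_big (fun i : midx => @upd i l (i0 l)) (base k))/=; last first.
  move=> i /forallP h; apply/forallP => l'; apply/implyP.
  rewrite leq_eqVlt => /orP[/eqP kl'|kl'].
    have -> : l' = l by apply: val_inj; rewrite /= -kl' lk.
    by rewrite upd_same.
  by rewrite upd_diff ?ne_l//; have := h l'; rewrite kl'.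
apply: eq_bigr => i1 /forallP hi1.
have i1l : i1 l = i0 l by have := hi1 l; rewrite lk leqnn => /eqP.
rewrite (reindex_onto (fun t => @upd i1 l t) (fun i : midx => i l))/=; last first.
  move=> i /andP[_ /eqP <-]; apply/ffunP => l'.
  have [->|l'l] := eqVneq l' l; first by rewrite upd_same.
  by rewrite !upd_diff.
apply: eq_bigl => t; rewrite upd_same eqxx andbT; apply/andP; split.
  apply/forallP => l'; apply/implyP => kl'; rewrite upd_diff ?ne_l//.
  by have := hi1 l'; rewrite (ltnW kl').
apply/eqP/ffunP => l'; have [->|l'l] := eqVneq l' l; first by rewrite upd_same.
by rewrite !upd_diff.
Qed.

(* The value at [k = d.+1] stands for "no core contracted". *)
Definition tail_energy (g : entry -> C) (x : midx -> C) (k : nat) (j : 'I_p) : R :=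
  if (k <= d)%N then \sum_(i | base k i) \sum_a nsq (tail_vec g x k j i a 0)
  else \sum_i nsq (x i).

Lemma base_top i : base d.+1 i.
Proof. by apply/forallP => l; rewrite leqNgt ltn_ord. Qed.

Lemma base_bottom i : base 0 i = (i == i0).
Proof.
apply/forallP/eqP => [h|-> l]; last by rewrite eqxx implybT.
by apply/ffunP => l; have := h l => /= /eqP.
Qed.


Lemma tail_energy_top g x j : tail_energy g x d.+1 j = \sum_i nsq (x i).
Proof. by rewrite /tail_energy ltnn. Qed.

Lemma tail_energy_bottom g x j :
  tail_energy g x 0 j = \sum_a nsq (tail_vec g x 0 j i0 a 0).
Proof.
by rewrite /tail_energy leq0n (big_pred1 i0)// => i; rewrite base_bottom.
Qed.

Lemma tail_energy_ge0 g x k j : 0 <= tail_energy g x k j.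
Proof.
rewrite /tail_energy; case: ifP => _; last by apply: sumr_ge0 => i _; exact: nsq_ge0.
by do 2 (apply: sumr_ge0 => ? _); exact: nsq_ge0.
Qed.

End TTLevels.

Section TTMoments.
Variables (R : realType) (d : nat) (n : 'I_d.+1 -> nat) (p b : nat).
Variables (disp : measure_display) (T : measurableType disp).
Variable (Pr : probability T R).
Local Notation C := R[i].
Local Notation midx := (multi_index n).
Local Notation entry := (core_entry n p b).
Variables (O : finType) (om : O -> C) (Y : entry * O -> T -> R).
Hypothesis gY : gaussian_family Pr Y b%:R^-1.
Hypothesis om1 : \sum_o nsq (om o) = 1.
Hypotheses (p_gt0 : (0 < p)%N) (b_gt0 : (0 < b)%N).
Variables (i0 : midx) (x : midx -> C).
Local Notation E := (expect Pr).

Definition gauss_entry (w : T) (e : entry) : C :=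
  \sum_o om o * (Y (e, o) w)%:C%C.

Definition entry_layer (e : entry) : nat :=
  match e with
  | inl (_, existT l _, _, _) => l
  | inr _ => d
  end.

Local Notation below k := [pred i : entry * O | (entry_layer i.1 < k)%N].

Lemma gauss_entry_free k e : (k <= entry_layer e)%N ->
  pfree Y (below k) (fun w => gauss_entry w e).
Proof.
move=> ke; apply: pfree_sum => o; apply: pfreeM; first exact: pfree_cst.
by apply: pfree_var; rewrite /= -leqNgt.
Qed.

Lemma pfree_sub (I : finType) (Y' : I -> T -> R) (D D' : pred I) f :
  {subset D' <= D} -> pfree Y' D f -> pfree Y' D' f.
Proof.
by move=> sub hf h; have [pf df] := hf h; split=> // i Di; apply: df; exact: sub.
Qed.

(** This makes the input of a layer independent of its own cores. The induction runs from the last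
    mode downwards, hence on [d - k]. *)
Lemma tail_vec_free k j i a : (k <= d)%N ->
  pfree Y (below k) (fun w => tail_vec (gauss_entry w) x k j i a 0).
Proof.
move=> kd; rewrite -(subKn kd); move: (leq_subr k d); move: (d - k)%N => m.
elim: m i a => [|m IH] i a md.
  rewrite subn0; apply: (@pfree_ext _ _ _ _ _ _ (fun w =>
    \sum_t x (upd i t) * gauss_entry w (inr (j, t, a)))).
    move=> w; rewrite tail_vec_last summxE; apply: eq_bigr => t _.
    by rewrite !mxE.
  apply: pfree_sum => t; apply: pfreeM; first exact: pfree_cst.
  exact: gauss_entry_free.
have ld : (d - m.+1 < d)%N by rewrite ltn_subrL/= (leq_trans _ md).
pose l := Ordinal ld.
have lk : l = (d - m.+1)%N :> nat by [].
apply: (@pfree_ext _ _ _ _ _ _ (fun w => \sum_t \sum_c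
   gauss_entry w (inl (j, existT (fun l => 'I_(n (inner_mode l))) l t, a, c)) *
   tail_vec (gauss_entry w) x (d - m) j (@upd _ n i (inner_mode l) t) c 0)).
  move=> w; rewrite (tail_vec_step _ _ _ _ lk) summxE; apply: eq_bigr => t _.
  rewrite mxE; apply: eq_bigr => c _; rewrite mxE.
  by rewrite -subSn// subSS.
apply: pfree_sum => t; apply: pfree_sum => c; apply: pfreeM.
  exact: gauss_entry_free.
apply: pfree_sub (IH _ _ (ltnW md)) => y; rewrite !inE => /leq_trans; apply.
exact: leq_sub2l.
Qed.

Definition energy (k : nat) (j : 'I_p) (w : T) : R :=
  tail_energy i0 (gauss_entry w) x k j.

Lemma energy_poly k j : polyfun Y (energy k j).
Proof.
rewrite /energy /tail_energy; case kd: (k <= d)%N; last first.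
  by apply: polyfun_sum => i; exact: polyfun_cst.
apply: polyfun_sum => i; apply: polyfun_sum => a.
exact: polyfun_nsq (tail_vec_free _ _ _ kd).
Qed.

(** An instance of [layer_ineq]: the summed index [Th] is the mode index, paired with the bond index
    for an inner core. The passive index runs over all multi-indices, so inputs outside the
    representatives [base i0 k] are set to zero. *)
Lemma energy_step k (q : 'I_p -> R) (K : R) (m : nat) : (k <= d)%N ->
  (forall w, 0 <= (\sum_j q j ^+ 2 * energy k j w - K) ^+ m.-1) ->
  E (fun w => (\sum_j q j ^+ 2 * energy k j w) *
              (\sum_j q j ^+ 2 * energy k j w - K) ^+ m) <=
  E (fun w => (\sum_j q j ^+ 2 * energy k.+1 j w) *
              (\sum_j q j ^+ 2 * energy k j w - K) ^+ m) +
  2 * b%:R^-1 * m%:R * E (fun w => (\sum_j q j ^+ 2 * energy k j w - K) ^+ m.-1 *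
     \sum_j q j ^+ 4 * (energy k.+1 j w * energy k j w)).
Proof.
move=> kd.
have bA : b%:R^-1 * #|'I_b|%:R = 1 :> R.
  by rewrite card_ord mulVf// pnatr_eq0 -lt0n.
suff [Th [yi [U [yi_inj U_free [eout ein]]]]] : exists (Th : finType)
    (yi : ('I_p * 'I_b) * (Th * O) -> entry * O)
    (U : 'I_p -> Th -> midx -> T -> C),
    [/\ injective yi, forall j th i, pfree Y [pred i | i \in codom yi] (U j th i) &
    (forall j w, layer_energy Y yi om U j w = energy k j w) /\
    (forall j w, layer_input U j w = energy k.+1 j w)].
  have := @layer_ineq _ _ _ _ _ _ _ gY _ _ _ _ _ yi om U yi_inj om1 bA U_free q K m.
  have -> : layer_energy Y yi om U = energy k by apply/funext => j; apply/funext => w.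
  have -> : layer_input U = energy k.+1 by apply/funext => j; apply/funext => w.
  exact.
have nsq_if (P : bool) (z : C) : nsq (if P then z else 0) = if P then nsq z else 0.
  by case: P; rewrite ?nsq0.
move: kd; rewrite leq_eqVlt => /orP[/eqP kd|kd].
- exists 'I_(n ord_max).
  exists (fun y => (inr (y.1.1, y.2.1, y.1.2), y.2.2)).
  exists (fun j t i w => if base i0 k i then x (upd i t) else 0).
  split=> [|j t i|]; first by case=> [[j a] [t o]] [[j' a'] [t' o']] /= [-> -> -> ->].
    by case: ifP => _; exact: pfree_cst.
  split=> j w.
    rewrite /energy /tail_energy kd leqnn [LHS]exchange_big/= [RHS]big_mkcond/=.
    apply: eq_bigr => i _; case: ifPn => bi; last first.
      by apply: big1 => a _; rewrite /layer_out big1 ?nsq0// => t _; rewrite (negbTE bi) mulr0.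
    apply: eq_bigr => a _; congr nsq; rewrite /layer_out tail_vec_last summxE.
    by apply: eq_bigr => t _; rewrite bi !mxE mulrC.
  rewrite /energy /tail_energy kd ltnn /layer_input [LHS]exchange_big/=.
  rewrite [RHS](eq_bigl (base i0 d.+1)); last by move=> i; rewrite base_top.
  rewrite (base_upd _ (l := ord_max))// [RHS]big_mkcond/=.
  apply: eq_bigr => i _; case: ifPn => // _.
  by apply: big1 => t _; rewrite nsq0.
- pose l := Ordinal kd.
  have lk : l = k :> nat by [].
  have lk' : inner_mode l = k :> nat by [].
  exists ('I_(n (inner_mode l)) * 'I_b)%type.
  exists (fun y => (inl (y.1.1, existT (fun l => 'I_(n (inner_mode l))) l y.2.1.1, y.1.2, y.2.1.2), y.2.2)).
  exists (fun j th i w => if base i0 k i then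
    tail_vec (gauss_entry w) x k.+1 j (@upd _ n i (inner_mode l) th.1) th.2 0 else 0).
  split=> [|j t i|].
  + case=> [[j a] [[t c] o]] [[j' a'] [[t' c'] o']] /= h.
    move: h => [-> h1 -> -> ->].
    have -> // : t = t'.
    have /eqP h2 := h1.
    by move: h2; rewrite (@eq_Tagged _ (fun l => 'I_(n (inner_mode l)) : eqType)
      (existT _ l t) t') => /eqP.
  + case: (base i0 k i); last exact: pfree_cst.
    apply: pfree_sub (tail_vec_free _ _ _ kd) => y; rewrite !inE => /codomP[z ->] /=.
    by rewrite ltnSn.
  split=> j w.
    rewrite /energy /tail_energy (ltnW kd) [LHS]exchange_big/= [RHS]big_mkcond/=.
    apply: eq_bigr => i _; case: ifPn => bi; last first.
      by apply: big1 => a _; rewrite /layer_out big1 ?nsq0// => t _; rewrite (negbTE bi) mulr0.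
    apply: eq_bigr => a _; congr nsq; rewrite /layer_out (tail_vec_step _ _ _ _ lk) summxE.
    under eq_bigr do rewrite bi.
    rewrite [RHS](eq_bigr (fun t => \sum_c inner_mx (gauss_entry w) j t a c *
       tail_vec (gauss_entry w) x k.+1 j (@upd _ n i (inner_mode l) t) c 0)); last first.
      by move=> t _; rewrite mxE.
    rewrite pair_bigA/=; apply: eq_bigr => tc _.
    by rewrite mxE.
  rewrite /energy /tail_energy kd /layer_input [LHS]exchange_big/=.
  rewrite (base_upd _ (l := inner_mode l))// [RHS]big_mkcond/=.
  apply: eq_bigr => i _; case: ifPn => _; last by apply: big1 => t _; rewrite nsq0.
  by rewrite pair_bigA.
Qed.

Variable s : nat.

Lemma tt_deviation_moment : (8 * s.+1 * d.+1 <= b)%N ->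
  E (fun w => (p%:R^-1 * (\sum_j energy 0 j w) - \sum_i nsq (x i)) ^+ (2 * s.+1)) <=
  (d.+1%:R * (8 * s.+1%:R * expR 1 / (p%:R * b%:R) * (\sum_i nsq (x i)) ^+ 2)) ^+ s.+1.
Proof.
move=> sb.
(* Level [l] means [l] cores contracted, so it starts from the uncontracted tensor at [d.+1] and
   ends at [0]. *)
pose Z l := energy (d.+1 - l).
have := @level_deviation_moment _ _ _ _ _ _ _ gY p b d.+1 (\sum_i nsq (x i)) Z p_gt0 b_gt0.
rewrite /Z subnn; apply => //.
- by apply: sumr_ge0 => i _; exact: nsq_ge0.
- by move=> l j; exact: energy_poly.
- by move=> l j w; exact: tail_energy_ge0.
- by move=> j w; rewrite subn0; exact: tail_energy_top.
- move=> l ld q K m.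
  rewrite [(d.+1 - l)%N](_ : _ = (d.+1 - l.+1).+1); last by rewrite subSS subSn// -ltnS.
  by apply: energy_step; rewrite subSS leq_subr.
Qed.

End TTMoments.

(** * Deterministic error bound *)

Section Frobenius.
Variable R : realType.
Local Notation C := R[i].

Definition adj m n (A : 'M[C]_(m, n)) : 'M[C]_(n, m) := map_mx (@conjc R) A^T.

Lemma adjE m n (A : 'M[C]_(m, n)) i j : adj A i j = (A j i)^*%C.
Proof. by rewrite !mxE. Qed.

Lemma adjK m n (A : 'M[C]_(m, n)) : adj (adj A) = A.
Proof. by apply/matrixP => i j; rewrite !adjE conjcK. Qed.

Lemma adj_mul m n k (A : 'M[C]_(m, n)) (B : 'M[C]_(n, k)) :
  adj (A *m B) = adj B *m adj A.
Proof. by rewrite /adj trmx_mul map_mxM. Qed.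

Lemma adj0 m n : adj (0 : 'M[C]_(m, n)) = 0.
Proof. by rewrite /adj trmx0 map_mx0. Qed.

Lemma adjB m n (A B : 'M[C]_(m, n)) : adj (A - B) = adj A - adj B.
Proof. by rewrite /adj linearB/= map_mxB. Qed.

Definition fro2 m n (A : 'M[C]_(m, n)) : R := \sum_i \sum_j nsq (A i j).

Definition frodot m n (A B : 'M[C]_(m, n)) : R := complex.Re (\tr (A *m adj B)).

Lemma fro2_ge0 m n (A : 'M[C]_(m, n)) : 0 <= fro2 A.
Proof. by do 2 (apply: sumr_ge0 => ? _); exact: nsq_ge0. Qed.

Lemma Re_sum (J : Type) (s : seq J) (P : pred J) (f : J -> C) :
  complex.Re (\sum_(j <- s | P j) f j) = \sum_(j <- s | P j) complex.Re (f j).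
Proof. exact: (cpart_sum true). Qed.

Lemma frodotE m n (A B : 'M[C]_(m, n)) : frodot A B =
  \sum_i \sum_j (complex.Re (A i j) * complex.Re (B i j) +
                 complex.Im (A i j) * complex.Im (B i j)).
Proof.
rewrite /frodot /mxtrace Re_sum; apply: eq_bigr => i _.
rewrite mxE Re_sum; apply: eq_bigr => j _; rewrite adjE.
by case: (A i j) => a a'; case: (B i j) => c c' /=; ring.
Qed.

Lemma fro2E m n (A : 'M[C]_(m, n)) : fro2 A = frodot A A.
Proof.
rewrite frodotE; apply: eq_bigr => i _; apply: eq_bigr => j _.
by rewrite /nsq !expr2.
Qed.

Lemma fro2D m n (A B : 'M[C]_(m, n)) : fro2 (A + B) = fro2 A + fro2 B + 2 * frodot A B.
Proof.
rewrite frodotE mulr_sumr -!big_split; apply: eq_bigr => i _ /=.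
rewrite mulr_sumr -!big_split; apply: eq_bigr => j _ /=.
rewrite mxE /nsq; case: (A i j) => a a'; case: (B i j) => c c' /=; ring.
Qed.

Lemma frodotN m n (A B : 'M[C]_(m, n)) : frodot A (- B) = - frodot A B.
Proof.
rewrite !frodotE -sumrN; apply: eq_bigr => i _; rewrite -sumrN; apply: eq_bigr => j _.
by rewrite mxE; case: (A i j) => a a'; case: (B i j) => c c' /=; ring.
Qed.

Lemma fro2N m n (A : 'M[C]_(m, n)) : fro2 (- A) = fro2 A.
Proof.
apply: eq_bigr => i _; apply: eq_bigr => j _; rewrite mxE /nsq.
by case: (A i j) => a a' /=; ring.
Qed.

Lemma fro2B m n (A B : 'M[C]_(m, n)) : fro2 (A - B) = fro2 A + fro2 B - 2 * frodot A B.
Proof. by rewrite fro2D fro2N frodotN mulrN. Qed.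

Lemma fro2_orthD m n (A B : 'M[C]_(m, n)) : \tr (A *m adj B) = 0 ->
  fro2 (A + B) = fro2 A + fro2 B.
Proof. by move=> h; rewrite fro2D /frodot h/= mulr0 addr0. Qed.

Lemma fro2_orthB m n (A B : 'M[C]_(m, n)) : \tr (A *m adj B) = 0 ->
  fro2 (A - B) = fro2 A + fro2 B.
Proof. by move=> h; rewrite fro2B /frodot h/= mulr0 subr0. Qed.

Lemma fro2_adj m n (A : 'M[C]_(m, n)) : fro2 (adj A) = fro2 A.
Proof.
rewrite /fro2 exchange_big; apply: eq_bigr => i _; apply: eq_bigr => j _.
by rewrite adjE /nsq; case: (A i j) => a a' /=; ring.
Qed.

Lemma fro2_col m n (A : 'M[C]_(m, n)) : fro2 A = \sum_j fro2 (col j A).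
Proof.
rewrite /fro2 exchange_big; apply: eq_bigr => j _; apply: eq_bigr => i _.
by rewrite big_ord1 mxE.
Qed.

Lemma fro2_eq0 m n (A : 'M[C]_(m, n)) : fro2 A = 0 -> A = 0.
Proof.
move=> h; apply/matrixP => i j; rewrite mxE; apply/eqP.
have nij : nsq (A i j) = 0.
  move/eqP: h; rewrite psumr_eq0; last first.
    by move=> *; apply: sumr_ge0 => *; exact: nsq_ge0.
  move=> /allP/(_ i (mem_index_enum _))/=; rewrite psumr_eq0; last first.
    by move=> *; exact: nsq_ge0.
  by move=> /allP/(_ j (mem_index_enum _))/= /eqP.
move: nij; rewrite /nsq; case: (A i j) => a a' /= /eqP.
by rewrite paddr_eq0 ?sqr_ge0// !sqrf_eq0 => /andP[/eqP -> /eqP ->].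
Qed.

Lemma fro2_unitary_mul m n k (Z : 'M[C]_(m, n)) (V : 'M[C]_(k, n)) :
  adj V *m V = 1%:M -> fro2 (Z *m adj V) = fro2 Z.
Proof.
move=> VV; rewrite !fro2E /frodot adj_mul adjK mulmxA -(mulmxA Z) VV mulmx1.
by [].
Qed.

(** The columns of the residual are orthogonal to the range of [Q], and any [M *m W] differs from
    the projection of [A] by a matrix in that range. *)
Lemma projection_error m n k q (A : 'M[C]_(m, n)) (Q : 'M[C]_(m, k))
    (X : 'M[C]_(k, q)) (M : 'M[C]_(m, q)) (W : 'M[C]_(q, n)) :
  adj Q *m Q = 1%:M -> M = Q *m X ->
  fro2 (A - Q *m (adj Q *m A)) <= fro2 (A - M *m W).
Proof.
move=> QQ ->.
pose D := A - Q *m (adj Q *m A).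
have QD : adj Q *m D = 0.
  by rewrite /D mulmxBr !mulmxA QQ mul1mx subrr.
have -> : A - Q *m X *m W = D + Q *m (adj Q *m A - X *m W).
  by rewrite mulmxBr /D !mulmxA addrA subrK.
rewrite -/D (@fro2_orthD _ _ D); first by rewrite lerDl fro2_ge0.
by rewrite adj_mul mulmxA mxtrace_mulC mulmxA QD mul0mx linear0.
Qed.

Lemma nsq_sum_mul (J : finType) (x y : J -> C) :
  nsq (\sum_j x j * y j) <= (\sum_j nsq (x j)) * (\sum_j nsq (y j)).
Proof.
set c := \sum_j _.
have nsq_c : nsq c = \sum_i \sum_j complex.Re (x i * y i * (x j * y j)^*%C).
  transitivity (complex.Re (c * c^*%C)).
    by case: c => a a'; rewrite /nsq/=; ring.
  rewrite rmorph_sum/= big_distrlr/= Re_sum; apply: eq_bigr => i _.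
  by rewrite Re_sum.
have : 0 <= \sum_i \sum_j nsq (x i * (y j)^*%C - x j * (y i)^*%C).
  by do 2 (apply: sumr_ge0 => ? _); exact: nsq_ge0.
have -> : \sum_i \sum_j nsq (x i * (y j)^*%C - x j * (y i)^*%C) =
    \sum_i \sum_j nsq (x i) * nsq (y j) + \sum_i \sum_j nsq (x j) * nsq (y i)
    - 2 * nsq c.
  rewrite nsq_c mulr_sumr -big_split/= -sumrB; apply: eq_bigr => i _.
  rewrite mulr_sumr -big_split/= -sumrB; apply: eq_bigr => j _.
  case: (x i) => a a'; case: (x j) => e e'; case: (y i) => f f'; case: (y j) => g g'.
  by rewrite /nsq/=; ring.
rewrite [X in _ + X - _]exchange_big/= -!big_distrlr/=; lra.
Qed.

Lemma fro2_mul m n k (A : 'M[C]_(m, n)) (B : 'M[C]_(n, k)) :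
  fro2 (A *m B) <= fro2 A * fro2 B.
Proof.
rewrite /fro2 mulr_suml; apply: ler_sum => i _.
rewrite [X in _ * X]exchange_big/= mulr_sumr; apply: ler_sum => j _.
by rewrite mxE; exact: nsq_sum_mul.
Qed.

Lemma row_space_basis k n (A : 'M[C]_(k, n)) : exists V : 'M[C]_(n, \rank A),
  adj V *m V = 1%:M /\ A *m V *m adj V = A.
Proof.
have aux r (V0 : 'M[C]_(r, n)) : V0 *m adj V0 = 1%:M -> (A <= V0)%MS ->
    A *m adj V0 *m V0 = A.
  by move=> V0u /submxP[D ->]; rewrite -2!mulmxA [V0 *m _]mulmxA V0u mul1mx.
pose V0 := schmidt (row_base A).
have V0u : V0 *m adj V0 = 1%:M.
  by apply/unitarymxP; apply: schmidt_unitarymx; exact: rank_leq_col.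
exists (adj V0); rewrite adjK; split=> //; apply: aux => //.
apply: submx_trans (schmidt_sub _).
by rewrite eq_row_base.
Qed.

(** [A - Ar] splits into the left-hand residual and [(A - Ar) *m V *m adj V], whose rows lie in
    orthogonal spaces. *)
Lemma tail_le_approx k n r (A Ar : 'M[C]_(k, n)) (V : 'M[C]_(n, r)) :
  adj V *m V = 1%:M -> Ar *m V *m adj V = Ar ->
  fro2 (A - A *m V *m adj V) <= fro2 (A - Ar).
Proof.
move=> VV ArV.
have -> : A - Ar = (A - A *m V *m adj V) + (A - Ar) *m V *m adj V.
  by rewrite !mulmxBl ArV addrA subrK.
pose B : 'M[C]_(k, n) := A - A *m V *m adj V.
rewrite -/B (@fro2_orthD _ _ B); first by rewrite lerDl fro2_ge0.
rewrite /B adj_mul adjK mulmxA mulmxBl -!mulmxA VV mulmx1 subrr mul0mx.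
by rewrite linear0.
Qed.

Lemma col_bound_mx q r l (G : 'M[C]_(q, r)) (Z : 'M[C]_(r, l)) :
  (forall v : 'cV[C]_r, 2^-1 * fro2 v <= fro2 (G *m v)) ->
  2^-1 * fro2 Z <= fro2 (G *m Z).
Proof.
move=> low; rewrite fro2_col [X in _ <= X]fro2_col mulr_sumr; apply: ler_sum => j _.
by rewrite [col j (G *m Z)]colE -mulmxA -colE; exact: low.
Qed.

Lemma gram_unit q r (G : 'M[C]_(q, r)) :
  (forall v : 'cV[C]_r, 2^-1 * fro2 v <= fro2 (G *m v)) ->
  adj G *m G \in unitmx.
Proof.
move=> low; set H := adj G *m G.
rewrite -row_free_unit -kermx_eq0; apply/eqP; apply: fro2_eq0.
rewrite -fro2_adj.
have GK : G *m adj (kermx H) = 0.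
  apply: fro2_eq0; rewrite fro2E /frodot adj_mul adjK mxtrace_mulC.
  by rewrite mulmxA -(mulmxA _ (adj G) G) mulmx_ker mul0mx linear0.
apply: le_anti; rewrite fro2_ge0 andbT.
have := col_bound_mx (adj (kermx H)) low; rewrite GK.
have -> : fro2 (0 : 'M[C]_(q, r)) = 0.
  by rewrite /fro2 big1// => i _; rewrite big1// => j _; rewrite mxE nsq0.
lra.
Qed.

Lemma frodotZ_real m n (A B : 'M[C]_(m, n)) (t : R) :
  frodot A (t%:C%C *: B) = t * frodot A B.
Proof.
rewrite !frodotE mulr_sumr; apply: eq_bigr => i _; rewrite mulr_sumr; apply: eq_bigr => j _.
by rewrite mxE; case: (B i j) => a a' /=; ring.
Qed.

Lemma fro2Z m n (c : C) (A : 'M[C]_(m, n)) : fro2 (c *: A) = nsq c * fro2 A.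
Proof.
rewrite /fro2 mulr_sumr; apply: eq_bigr => i _; rewrite mulr_sumr; apply: eq_bigr => j _.
by rewrite mxE nsqM.
Qed.

Lemma nsq_real (t : R) : nsq (t%:C%C) = t ^+ 2.
Proof. by rewrite /nsq/= expr0n/= addr0. Qed.

(** With [Y] the product on the left, the lower bound on [G] gives [|Y|^2 / 2 <= frodot T Y], and
    [|T - Y/2|^2 >= 0] gives [frodot T Y <= |T|^2 + |Y|^2 / 4]. *)
Lemma gram_inv_bound q r k (G : 'M[C]_(q, r)) (T : 'M[C]_(k, r)) :
  (forall v : 'cV[C]_r, 2^-1 * fro2 v <= fro2 (G *m v)) ->
  fro2 (T *m invmx (adj G *m G)) <= 4 * fro2 T.
Proof.
move=> low; have Hu := gram_unit low; set Y := T *m invmx _.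
have TY : T = Y *m (adj G *m G) by rewrite /Y mulmxKV.
have h1 : 2^-1 * fro2 Y <= frodot T Y.
  rewrite -(fro2_adj Y); apply: le_trans (col_bound_mx (adj Y) low) _.
  by rewrite fro2E /frodot adj_mul adjK mxtrace_mulC [in X in _ <= X]TY !mulmxA.
have : 0 <= fro2 (T - (2^-1 : R)%:C%C *: Y) by exact: fro2_ge0.
rewrite fro2B frodotZ_real fro2Z nsq_real; lra.
Qed.

(** The competitor is [W = G H^-1 adj V] with [G = Om V] and [H] its Gram matrix. It reproduces
    [A V adj V] exactly, so the sketch only perturbs [B], by [T H^-1 adj V], which is orthogonal to
    [B] since [B V = 0]. *)
Lemma sketch_error k n r q m (A : 'M[C]_(k, n)) (V : 'M[C]_(n, r))
    (Om : 'M[C]_(q, n)) (Q : 'M[C]_(k, m)) (X : 'M[C]_(m, q)) :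
  let B := A - A *m V *m adj V in
  adj V *m V = 1%:M ->
  (forall v : 'cV[C]_r, 2^-1 * fro2 v <= fro2 (Om *m V *m v)) ->
  adj Q *m Q = 1%:M -> A *m adj Om = Q *m X ->
  fro2 (A - Q *m (adj Q *m A)) <=
  fro2 B + 4 * fro2 (B *m adj Om *m (Om *m V)).
Proof.
move=> B VV low QQ MQ.
set T := B *m adj Om *m (Om *m V).
have Hu := gram_unit low; have YT := gram_inv_bound T low.
set H := adj (Om *m V) *m (Om *m V) in Hu YT.
have BV : B *m V = 0.
  by rewrite /B mulmxBl -!mulmxA VV mulmx1 subrr.
pose W := Om *m V *m invmx H *m adj V.
apply: le_trans (projection_error A W QQ MQ) _.
have AE (B' : 'M[C]_(k, n)) : A = A *m V *m adj V + B' ->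
    A *m adj Om *m W =
    A *m V *m adj V + B' *m adj Om *m (Om *m V) *m invmx H *m adj V.
  move=> {1}->; rewrite !mulmxDl; congr (_ + _); last by rewrite /W !mulmxA.
  have -> : A *m V *m adj V *m adj Om *m W = A *m V *m (H *m invmx H) *m adj V.
    by rewrite /W /H adj_mul !mulmxA.
  by rewrite mulmxV// mulmx1.
have -> : A - A *m adj Om *m W = B - T *m invmx H *m adj V.
  have AB : A = A *m V *m adj V + B by rewrite /B addrC subrK.
  by rewrite (AE B AB) opprD addrA.
rewrite fro2_orthB; first by rewrite fro2_unitary_mul// lerD2l.
by rewrite adj_mul adjK mulmxA BV mul0mx linear0.
Qed.

(** The fourth roots of unity: [h] selects the real or imaginary axis, [s] the sign. *)
Definition quarter (h s : bool) : C :=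
  (if s then 1 else -1) * (if h then 1 else 'i)%C.

Lemma nsq_adj_mul m (x y : 'cV[C]_m) :
  nsq ((adj x *m y) 0 0) =
  frodot x (quarter true true *: y) ^+ 2 + frodot x (quarter false true *: y) ^+ 2.
Proof.
have -> : frodot x (quarter true true *: y) = complex.Re ((adj x *m y) 0 0).
  rewrite frodotE mxE Re_sum; apply: eq_bigr => i _; rewrite big_ord1 mxE !adjE.
  by rewrite /quarter; case: (x i 0) => a a'; case: (y i 0) => c c' /=; ring.
have -> : frodot x (quarter false true *: y) = - complex.Im ((adj x *m y) 0 0).
  rewrite frodotE mxE -[complex.Im _]/(cpart false _) cpart_sum -sumrN.
  apply: eq_bigr => i _; rewrite big_ord1 mxE !adjE.
  by rewrite /quarter; case: (x i 0) => a a'; case: (y i 0) => c c' /=; ring.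
by rewrite sqrrN.
Qed.

Definition polar_vec n (b v : 'cV[C]_n) (h s : bool) : 'cV[C]_n :=
  b + (quarter h s * (Num.sqrt (fro2 b))%:C%C) *: v.

Lemma nsq_quarter h s : nsq (quarter h s) = 1.
Proof. by rewrite /nsq /quarter; case: h; case: s => /=; ring. Qed.

Lemma frodot_orth n (b v : 'cV[C]_n) (c : C) : adj v *m b = 0 -> frodot b (c *: v) = 0.
Proof.
move=> vb; rewrite /frodot mxtrace_mulC /adj linearZ/= map_mxZ -scalemxAl -/(adj v).
by rewrite vb scaler0 linear0.
Qed.

Lemma fro2_polar n (b v : 'cV[C]_n) h s : adj v *m b = 0 -> fro2 v = 1 ->
  fro2 (polar_vec b v h s) = 2 * fro2 b.
Proof.
move=> vb v1; rewrite /polar_vec fro2D frodot_orth// mulr0 addr0 fro2Z v1 mulr1.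
rewrite nsqM nsq_quarter mul1r nsq_real sqr_sqrtr ?fro2_ge0//; ring.
Qed.

(** Two applications of [x^2 + y^2 >= (x - y)^2 / 2], with [x] and [y] the deviations from [2 f]. *)
Lemma polar_num (d1 d2 d3 d4 x1 x2 be f : R) : be ^+ 2 = f ->
  d1 - d2 = 4 * (be * x1) -> d3 - d4 = 4 * (be * x2) ->
  8 * f * (x1 ^+ 2 + x2 ^+ 2) <= (d1 - 2 * f) ^+ 2 + (d2 - 2 * f) ^+ 2 +
    ((d3 - 2 * f) ^+ 2 + (d4 - 2 * f) ^+ 2).
Proof.
move=> <-; set B := 2 * be ^+ 2 => k1 k2.
have -> : 8 * be ^+ 2 * (x1 ^+ 2 + x2 ^+ 2) =
   ((4 * (be * x1)) ^+ 2 + (4 * (be * x2)) ^+ 2) / 2 by field.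
rewrite -k1 -k2.
have := sqr_ge0 ((d3 - B) + (d4 - B)); have := sqr_ge0 ((d1 - B) + (d2 - B)).
nra.
Qed.

(* The four polarization vectors have the same norm, so [<G b, G v>] only sees
   their deviations [|G z|^2 - |z|^2]. *)
Lemma polarization m n (G : 'M[C]_(m, n)) (b v : 'cV[C]_n) :
  adj v *m b = 0 -> fro2 v = 1 ->
  8 * fro2 b * nsq ((adj (G *m b) *m (G *m v)) 0 0) <=
  \sum_(h : bool) \sum_(s : bool)
    (fro2 (G *m polar_vec b v h s) - fro2 (polar_vec b v h s)) ^+ 2.
Proof.
move=> vb v1; set be := Num.sqrt (fro2 b).
have be2 : be ^+ 2 = fro2 b by rewrite sqr_sqrtr// fro2_ge0.
have key h : fro2 (G *m polar_vec b v h true) - fro2 (G *m polar_vec b v h false) =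
    4 * (be * frodot (G *m b) (quarter h true *: (G *m v))).
  have GE s : G *m polar_vec b v h s =
      G *m b + ((if s then be else - be)%:C%C *: (quarter h true *: (G *m v))).
    rewrite mulmxDr -scalemxAr; congr (_ + _); rewrite scalerA; congr (_ *: _).
    rewrite -/be /quarter; case: s; case: h => //=;
    by apply/eqP; rewrite eq_complex/=; apply/andP; split; apply/eqP; ring.
  rewrite !GE !fro2D !frodotZ_real !fro2Z !nsq_real sqrrN; ring.
rewrite nsq_adj_mul.
have -> : \sum_(h : bool) \sum_(s : bool)
    (fro2 (G *m polar_vec b v h s) - fro2 (polar_vec b v h s)) ^+ 2 =
  \sum_(h : bool) \sum_(s : bool) (fro2 (G *m polar_vec b v h s) - 2 * fro2 b) ^+ 2.
  by apply: eq_bigr => h _; apply: eq_bigr => s _; rewrite fro2_polar.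
have -> : \sum_(h : bool) \sum_(s : bool) (fro2 (G *m polar_vec b v h s) - 2 * fro2 b) ^+ 2 =
  (fro2 (G *m polar_vec b v true true) - 2 * fro2 b) ^+ 2 +
  (fro2 (G *m polar_vec b v true false) - 2 * fro2 b) ^+ 2 +
  ((fro2 (G *m polar_vec b v false true) - 2 * fro2 b) ^+ 2 +
  (fro2 (G *m polar_vec b v false false) - 2 * fro2 b) ^+ 2).
  by rewrite !big_bool.
exact: polar_num be2 (key true) (key false).
Qed.

End Frobenius.

(** * Lower bounds from a net *)

Section Grid.
Variable R : realType.
Local Notation C := R[i].

(** The absolute difference of [a] and [B]: one of the truncated subtractions is zero. *)
Definition grid_dist (B a : nat) : nat := (a - B + (B - a))%N.

Lemma grid_distE (B a : nat) : (grid_dist B a)%:R ^+ 2 = (a%:R - B%:R) ^+ 2 :> R.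
Proof.
rewrite /grid_dist; have [aB|/ltnW Ba] := leqP a B.
  rewrite (eqP (aB : (a - B == 0)%N)) add0n natrB//; ring.
by rewrite (eqP (Ba : (B - a == 0)%N)) addn0 natrB.
Qed.

Lemma sum_half_pow (B : nat) :
  \sum_(a < (2 * B).+1) (2^-1 : R) ^+ grid_dist B a = 3 - 2 * 2^-1 ^+ B.
Proof.
elim: B => [|B IH].
  by rewrite muln0 big_ord1 /grid_dist !expr0; ring.
rewrite mulnS !addSn add0n big_ord_recl big_ord_recr/=.
rewrite (eq_bigr (fun a : 'I_(2 * B).+1 => (2^-1 : R) ^+ grid_dist B a)); last first.
  by move=> a _; rewrite /grid_dist /bump/= add1n !subSS.
rewrite IH /grid_dist /bump/= add1n sub0n add0n subn0.
rewrite (_ : (2 * B).+2 - B.+1 + (B.+1 - (2 * B).+2) = B.+1)%N; last by lia.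
by rewrite exprS; field.
Qed.

(* Chernoff: weight each grid point by [2^(L - |f|^2)]. *)
Lemma grid_count (J : finType) (B L : nat) :
  (#|[pred f : {ffun J -> 'I_(2 * B).+1} | (\sum_j grid_dist B (f j) ^ 2 <= L)%N]|%:R : R)
  <= 2 ^+ L * 3 ^+ #|J|.
Proof.
rewrite -sum1_card natr_sum.
apply: (@le_trans _ _ (\sum_(f : {ffun J -> 'I_(2 * B).+1})
   2 ^+ L * \prod_j (2^-1 : R) ^+ (grid_dist B (f j) ^ 2))).
  rewrite big_mkcond/=; apply: ler_sum => f _; rewrite inE; case: ifP => [h|_].
    rewrite -expr_sum exprVn ler_pdivlMr ?exprn_gt0// mul1r.
    by apply: ler_weXn2l => //; rewrite ler1n.
  by rewrite mulr_ge0 ?exprn_ge0// prodr_ge0// => j _; rewrite exprn_ge0// invr_ge0.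
rewrite -mulr_sumr ler_wpM2l ?exprn_ge0//.
rewrite -(bigA_distr_bigA (fun _ a => (2^-1 : R) ^+ (grid_dist B (a : 'I_(2 * B).+1) ^ 2)))/=.
rewrite prodr_const.
apply: lerXn2r; rewrite ?nnegrE//.
  by apply: sumr_ge0 => a _; rewrite exprn_ge0// invr_ge0.
apply: (@le_trans _ _ (\sum_(a < (2 * B).+1) (2^-1 : R) ^+ grid_dist B a)).
  apply: ler_sum => a _; apply: ler_wiXn2l; rewrite ?invr_ge0// ?invf_le1 ?ler1n//.
  by case: (grid_dist B a) => // n; rewrite -mulnn leq_pmulr.
by rewrite sum_half_pow lerBlDr lerDl mulr_ge0// exprn_ge0// invr_ge0.
Qed.

Lemma fro2_young m n (x y : 'M[C]_(m, n)) (e : R) : 0 < e ->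
  fro2 (x + y) <= (1 + e) * fro2 x + (1 + e^-1) * fro2 y.
Proof.
move=> e0.
have : 0 <= e^-1 * fro2 (y - e%:C%C *: x).
  by rewrite mulr_ge0 ?fro2_ge0// invr_ge0 ltW.
rewrite fro2B frodotZ_real fro2Z nsq_real [x + y]addrC fro2D.
have -> : e^-1 * (fro2 y + e ^+ 2 * fro2 x - 2 * (e * frodot y x)) =
   e^-1 * fro2 y + e * fro2 x - 2 * frodot y x by field; rewrite gt_eqF.
lra.
Qed.

Lemma fro2_young_eighth m n (x y : 'M[C]_(m, n)) :
  fro2 (x + y) <= 9 / 8 * fro2 x + 9 * fro2 y.
Proof.
have e0 : 0 < 8^-1 :> R by rewrite invr_gt0.
by apply: le_trans (fro2_young x y e0) _; rewrite invrK; lra.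
Qed.

Lemma fro2_scale_unit n (v : 'cV[C]_n) : fro2 v != 0 ->
  exists2 u : 'cV[C]_n, fro2 u = 1 & v = (Num.sqrt (fro2 v))%:C%C *: u.
Proof.
move=> v0; exists ((Num.sqrt (fro2 v))^-1%:C%C *: v).
  by rewrite fro2Z nsq_real exprVn sqr_sqrtr ?fro2_ge0// mulVf.
rewrite scalerA -rmorphM mulfV ?rmorph1 ?scale1r//.
by rewrite gt_eqF// sqrtr_gt0 lt_def v0 fro2_ge0.
Qed.

Section Net.
Variables r N : nat.
Hypothesis r_gt0 : (0 < r)%N.
Hypothesis rN : (2 * 28 * 9 * r <= N)%N.

(** The grid step in each of the [2 r] real coordinates. Rounding costs at most
    [2 r h^2 <= 1 / (28 * 9)] in squared norm; the [9] cancels the constant of [fro2_young_eighth],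
    leaving a contraction by [1/28]. *)
Let h : R := (Num.sqrt N%:R)^-1.
Local Notation gridt := {ffun 'I_r * bool -> 'I_(2 * N).+1}.

Definition grid_point (f : gridt) : 'cV[C]_r :=
  \col_i ((Num.sqrt N%:R)^-1 * ((f (i, true))%:R - N%:R) +i*
          ((Num.sqrt N%:R)^-1 * ((f (i, false))%:R - N%:R)))%C.

(** Grid points of squared norm at most [2]; the approximants of unit vectors stay below [7/6], and
    the truncation keeps the net of exponential size in [N]. *)
Definition net : pred gridt :=
  [pred f : gridt | (\sum_j grid_dist N (f j) ^ 2 <= 2 * N)%N].

Lemma net_card : (#|net|%:R : R) <= 2 ^+ (2 * N) * 3 ^+ (2 * r).
Proof.
have := grid_count ('I_r * bool)%type N (2 * N).
by rewrite card_prod card_ord card_bool [(r * 2)%N]mulnC.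
Qed.

Let N_gt0 : (0 < N)%N.
Proof. by apply: leq_trans rN; rewrite muln_gt0 r_gt0. Qed.

Let N0 : 0 < N%:R :> R. Proof. by rewrite ltr0n. Qed.

Let h_gt0 : 0 < h. Proof. by rewrite invr_gt0 sqrtr_gt0. Qed.

Let h2 : h ^+ 2 = N%:R^-1.
Proof. by rewrite exprVn sqr_sqrtr// ltW. Qed.

Let h2r : 28 * 9 * (h ^+ 2 *+ (2 * r)) <= 1.
Proof.
rewrite -(mulr_natl (h ^+ 2)) h2 mulrA ler_pdivrMr// mul1r.
have := rN; rewrite -(ler_nat R) !natrM => H.
apply: le_trans H; rewrite le_eqVlt; apply/orP; left; apply/eqP; ring.
Qed.

Lemma sum_parts (F : 'I_r * bool -> R) :
  \sum_(q : 'I_r * bool) F q = \sum_i (F (i, true) + F (i, false)).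
Proof.
rewrite (eq_bigr (fun q => F (q.1, q.2))); last by case.
rewrite -(pair_bigA _ (fun i c => F (i, c)))/=.
by apply: eq_bigr => i _; rewrite big_bool.
Qed.

Lemma fro2_grid_point f : fro2 (grid_point f) =
  h ^+ 2 * (\sum_j grid_dist N (f j) ^ 2)%:R.
Proof.
rewrite natr_sum sum_parts mulr_sumr; apply: eq_bigr => i _.
rewrite big_ord1 mxE /nsq/= !natrX !grid_distE -/h; ring.
Qed.

Lemma grid_approx (v : 'cV[C]_r) : fro2 v = 1 ->
  exists f : gridt, fro2 (v - grid_point f) <= (28 * 9)^-1.
Proof.
move=> v1.
pose x (q : 'I_r * bool) : R := cpart q.2 (v q.1 0).
have x2 q : x q ^+ 2 <= 1.
  rewrite -v1 /fro2 (eq_bigr (fun i => cpart true (v i 0) ^+ 2 + cpart false (v i 0) ^+ 2)).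
    rewrite -(sum_parts (fun q => x q ^+ 2)) (bigD1 q)//= lerDl.
    by apply: sumr_ge0 => j _; exact: sqr_ge0.
  by move=> i _; rewrite big_ord1.
have xh q : `|x q / h| <= N%:R.
  rewrite -(@ler_pXn2r _ 2)// ?nnegrE// ?ler0n// real_normK ?num_real//.
  rewrite exprMn exprVn h2 invrK.
  apply: (@le_trans _ _ (1 * N%:R)); first by rewrite ler_wpM2r// ltW.
  by rewrite mul1r expr2 -natrM ler_nat leq_pmulr.
pose y q := x q / h + N%:R.
have y0 q : 0 <= y q by have := xh q; rewrite ler_norml /y => /andP[]; lra.
have y2 q : y q <= (2 * N)%:R.
  by have := xh q; rewrite ler_norml /y natrM => /andP[]; lra.
(* The shift by [N] makes the coordinate nonnegative, so truncation rounds down and moves it by at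
   most one step [h]. *)
pose k q := Num.truncn (y q).
have kP q : (k q)%:R <= y q < (k q).+1%:R by exact: truncn_itv.
have kB q : (k q < (2 * N).+1)%N.
  by rewrite ltnS -(ler_nat R); have /andP[h1 _] := kP q; exact: le_trans h1 (y2 q).
exists [ffun q => Ordinal (kB q)].
have dq q : (x q - h * ((k q)%:R - N%:R)) ^+ 2 <= h ^+ 2.
  have -> : x q = h * (y q - N%:R) by rewrite /y addrK mulrC divfK// gt_eqF.
  rewrite -mulrBr exprMn -[X in _ <= X]mulr1 ler_wpM2l ?sqr_ge0//.
  have /andP[] := kP q; rewrite -natr1 => h1 h3.
  by nra.
apply: (@le_trans _ _ (\sum_(q : 'I_r * bool) h ^+ 2)); last first.
  rewrite sumr_const card_prod card_ord card_bool [(r * 2)%N]mulnC.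
  rewrite -[X in _ <= X]mulr1 ler_pdivlMl; first exact: h2r.
  by rewrite mulr_gt0.
rewrite sum_parts; apply: ler_sum => i _.
rewrite big_ord1 !mxE !ffunE /nsq.
have := dq (i, true); have := dq (i, false); rewrite /x/= -/h.
rewrite -[v i ord0]/(v i 0).
by case: (v i 0) => a a' /=; lra.
Qed.

Variables (m : nat) (G : 'M[C]_(m, r)).
Hypothesis G_net : forall f, net f ->
  `|fro2 (G *m grid_point f) - fro2 (grid_point f)| <= 16^-1 * fro2 (grid_point f).

(** The norm bounds come from [9/8 + 1/28 = 65/56 <= 7/6] and from [1 <= 9/8 |z|^2 + 1/28]. *)
Let unit_net (u : 'cV[C]_r) : fro2 u = 1 -> exists z : 'cV[C]_r,
  [/\ fro2 (u - z) <= (28 * 9)^-1, 6 / 7 <= fro2 z <= 7 / 6,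
      fro2 (G *m z) <= 17 / 16 * fro2 z & 15 / 16 * fro2 z <= fro2 (G *m z)].
Proof.
move=> u1; have [f uf] := grid_approx u1; exists (grid_point f).
set z := grid_point f in uf *.
have z_up : fro2 z <= 7 / 6.
  have := fro2_young_eighth u (z - u); rewrite addrC subrK -[fro2 (z - u)]fro2N opprB u1.
  by move: uf; move: (fro2 (u - z)) (fro2 z) => a b; lra.
have z_lo : 6 / 7 <= fro2 z.
  have := fro2_young_eighth z (u - z); rewrite addrC subrK u1.
  by move: uf; move: (fro2 (u - z)) (fro2 z) => a b; lra.
have fnet : net f.
  rewrite /net/= -(ler_nat R) natrM.
  have -> : (\sum_j grid_dist N (f j) ^ 2)%:R = fro2 z * N%:R :> R.
    by rewrite fro2_grid_point h2 mulrC mulVKf// gt_eqF.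
  rewrite ler_wpM2r ?(ltW N0)//.
  by apply: le_trans z_up _; lra.
have := G_net fnet; rewrite -/z ler_norml => /andP[].
move: (fro2 (G *m z)) z_lo z_up uf => g; move: (fro2 z) => zz z_lo z_up uf h1 h3.
by split; [exact: uf|apply/andP|lra|lra].
Qed.

Let scale_bound (M : R) (v : 'cV[C]_r) :
  (forall u : 'cV[C]_r, fro2 u = 1 -> fro2 (G *m u) <= M) ->
  fro2 (G *m v) <= M * fro2 v.
Proof.
move=> hM; have [v0|v0] := eqVneq (fro2 v) 0.
  have -> : v = 0 by exact: fro2_eq0.
  rewrite mulmx0 /fro2 !big1 ?mulr0// => i _; rewrite big1// => j _; by rewrite mxE nsq0.
have [u u1 ->] := fro2_scale_unit v0.
by rewrite -scalemxAr !fro2Z u1 mulr1 mulrC ler_wpM2r ?nsq_ge0// hM.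
Qed.

(* If [M] bounds [|G w|^2 / |w|^2], then so does [alpha + M / 28], by
   approximation on the net; iterate from [M = fro2 G]. *)
Let net_upper (v : 'cV[C]_r) : fro2 (G *m v) <= 3 / 2 * fro2 v.
Proof.
have step (M : R) : (forall w : 'cV[C]_r, fro2 (G *m w) <= M * fro2 w) -> 0 <= M ->
    forall w : 'cV[C]_r, fro2 (G *m w) <= (9 / 8 * (17 / 16) * (7 / 6) + 28^-1 * M) * fro2 w.
  move=> hM M0 w; apply: scale_bound => u u1.
  have [z [uz /andP[_ z_up] Gz _]] := unit_net u1.
  have -> : G *m u = G *m z + G *m (u - z) by rewrite -mulmxDr addrC subrK.
  apply: le_trans (fro2_young_eighth _ _) _.
  have := hM (u - z); move: uz Gz z_up.
  move: (fro2 (G *m z)) (fro2 (G *m (u - z))) (fro2 z) (fro2 (u - z)) => a b c e.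
  move=> he ha hc hb.
  have : 9 * b <= 28^-1 * M by nra.
  lra.
(* [29/20] lies above the fixed point of [M -> 9/8 * 17/16 * 7/6 + M / 28], so the step preserves it
   and at least halves the excess. *)
have iter k : forall w : 'cV[C]_r,
    fro2 (G *m w) <= (29 / 20 + 2^-1 ^+ k * fro2 G) * fro2 w.
  have G0 := fro2_ge0 G.
  elim: k => [|k IH] w.
    rewrite expr0 mul1r; apply: le_trans (fro2_mul _ _) _.
    by rewrite ler_wpM2r ?fro2_ge0// lerDr.
  have k0 : 0 <= 2^-1 ^+ k * fro2 G by rewrite mulr_ge0// exprn_ge0// invr_ge0.
  apply: le_trans (step _ IH _ w) _; first by rewrite addr_ge0.
  rewrite ler_wpM2r ?fro2_ge0// [X in _ <= _ + X](_ : _ = 2^-1 * (2^-1 ^+ k * fro2 G)).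
    by move: (2^-1 ^+ k * fro2 G) k0 => g g0; lra.
  by rewrite exprS mulrA.
(* Enough iterations for the excess to drop below [1/20 = 3/2 - 29/20]. *)
pose k := Num.truncn (20 * fro2 G).
apply: le_trans (iter k.+1 v) _.
rewrite ler_wpM2r ?fro2_ge0//.
have hk : 20 * fro2 G < k.+1%:R by exact: truncnS_gt.
have h2k : k.+1%:R <= 2 ^+ k.+1 :> R by rewrite -natrX ler_nat ltnW// ltn_expl.
have : 2^-1 ^+ k.+1 * fro2 G <= 20^-1.
  rewrite exprVn mulrC ler_pdivrMr ?exprn_gt0//.
  by move: (2 ^+ k.+1) (k.+1%:R) (fro2 G) hk h2k => a b c; lra.
by move: (_ * fro2 G) => g; lra.
Qed.

(** The upper bound is needed for the rounding error: [15/16 * 6/7 <= |G z|^2 <= 9/8 |G u|^2 + 9 |G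
    (z - u)|^2], and the last term is at most [9 * 3/2 / (28 * 9)]. *)
Lemma net_lower (v : 'cV[C]_r) : 2^-1 * fro2 v <= fro2 (G *m v).
Proof.
have [v0|v0] := eqVneq (fro2 v) 0; first by rewrite v0 mulr0 fro2_ge0.
have [u u1 ->] := fro2_scale_unit v0.
rewrite -scalemxAr !fro2Z u1 mulr1 mulrC ler_wpM2l ?nsq_ge0//.
have [z [uz /andP[z_lo _] _ Gz]] := unit_net u1.
have := fro2_young_eighth (G *m u) (G *m (z - u)); rewrite -mulmxDr addrC subrK.
have := net_upper (z - u); rewrite -[fro2 (z - u)]fro2N opprB.
move: uz z_lo Gz; move: (fro2 (u - z)) (fro2 z) (fro2 (G *m z)) (fro2 (G *m (z - u))) (fro2 (G *m u)) => a b c e g.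
lra.
Qed.

End Net.
End Grid.

(** * The good event *)

Section Markov.
Variables (R : realType) (d : measure_display) (T : measurableType d).
Variables (Pr : probability T R) (I : finType) (Y : I -> T -> R) (v : R).
Hypothesis gY : gaussian_family Pr Y v.

Lemma markov_le1 (U : T -> R) : polyfun Y U -> (forall w, 0 <= U w) ->
  measurable [set w | U w <= 1] /\
  ((1 - expect Pr U)%:E <= Pr [set w | (U w <= 1)%R])%E.
Proof.
move=> pU U0.
have mU := measurable_poly gY pU.
have mG : measurable [set w | U w <= 1].
  rewrite (_ : [set w | U w <= 1] = setT `&` U @^-1` `]-oo, 1]%classic).
    exact: mU.
  by rewrite setTI; apply/seteqP; split=> w /=; rewrite in_itv.
split=> //.
have mB : measurable (~` [set w | U w <= 1]) by exact: measurableC.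
have : (Pr (~` [set w | (U w <= 1)%R]) <= (expect Pr U)%:E)%E.
  rewrite /expect /Rintegral fineK; last first.
    by apply: integrable_fin_num => //; exact: integrable_poly gY _ pU.
  rewrite -[X in (X <= _)%E]mul1e -(integral_cst Pr mB 1).
  rewrite integral_mkcond; apply: ge0_le_integral => //.
  - by move=> w _; rewrite patchE; case: ifP => //= _; rewrite lee_fin.
  - by apply/(measurable_restrictT _ mB).1; exact: measurable_cst.
  - exact/measurable_EFinP.
  - move=> w _; rewrite patchE; case: ifPn => [|_] /=; last by rewrite lee_fin.
    by rewrite inE/= => /negP; rewrite -ltNge lee_fin => /ltW.
rewrite probability_setC// => h.
have fG : Pr [set w | U w <= 1] \is a fin_num by rewrite fin_num_measure.
move: h; rewrite -(fineK fG) -EFinB !lee_fin; lra.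
Qed.

Lemma expectation_sum_pred (J : finType) (P : pred J) (f : J -> T -> R) :
  (forall j, polyfun Y (f j)) ->
  expect Pr (fun w => \sum_(j | P j) f j w) = \sum_(j | P j) expect Pr (f j).
Proof.
move=> pf; rewrite -big_filter -(expectation_sum gY)//.
by apply: eq_expect => w; rewrite big_filter.
Qed.

End Markov.

(** * The sketch matrix and its block energies *)

Section SketchMatrix.
Variables (R : realType) (d : nat) (n : 'I_d.+1 -> nat) (p b : nat).
Local Notation C := R[i].
Local Notation entry := (core_entry n p b).

Definition sketch_mx (g : entry -> C) : 'M[C]_(p * b, \prod_l n l) :=
  \matrix_(s, t) ((Num.sqrt p%:R)^-1%:C%C *
    ((\big[mulmx/1%:M]_(l < d) inner_mx g (row_index s).1 (col_index t (inner_mode l)))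
      *m last_mx g (row_index s).1 (col_index t ord_max)) (row_index s).2 0).

Definition col_rank (i : multi_index n) : 'I_(\prod_l n l) :=
  cast_ord (card_multi_index n) (enum_rank i).

Lemma col_rankK : cancel col_rank (@col_index d n).
Proof. by move=> i; rewrite /col_rank /col_index cast_ordK enum_rankK. Qed.

Lemma col_indexK : cancel (@col_index d n) col_rank.
Proof. by move=> t; rewrite /col_rank /col_index enum_valK cast_ordKV. Qed.

Lemma row_index_bij : bijective (@row_index p b).
Proof.
exists (fun jb => cast_ord (mxvec_cast p b) (enum_rank jb)) => x.
  by rewrite /row_index enum_valK cast_ordKV.
by rewrite /row_index cast_ordK enum_rankK.
Qed.

Definition tensor_of (x : 'cV[C]_(\prod_l n l)) (i : multi_index n) : C :=
  x (col_rank i) 0.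

Lemma fro2_tensor_of x : fro2 x = \sum_i nsq (tensor_of x i).
Proof.
rewrite /fro2 (reindex col_rank) /=; last first.
  by exists (@col_index d n) => i _; rewrite ?col_rankK ?col_indexK.
by apply: eq_bigr => i _; rewrite big_ord1.
Qed.

Lemma sketch_mul_entry (i0 : multi_index n) (g : entry -> C) x s :
  (sketch_mx g *m x) s 0 = (Num.sqrt p%:R)^-1%:C%C *
    tail_vec g (tensor_of x) 0 (row_index s).1 i0 (row_index s).2 0.
Proof.
rewrite tail_vec0 mxE (reindex col_rank) /=; last first.
  by exists (@col_index d n) => i _; rewrite ?col_rankK ?col_indexK.
rewrite summxE mulr_sumr; apply: eq_bigr => i _.
by rewrite mxE col_rankK -mulrA; congr (_ * _); rewrite mulrC [in RHS]mxE.
Qed.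

Lemma fro2_sketch (i0 : multi_index n) (g : entry -> C) x : (0 < p)%N ->
  fro2 (sketch_mx g *m x) =
  p%:R^-1 * \sum_j tail_energy i0 g (tensor_of x) 0 j.
Proof.
move=> p0.
transitivity (\sum_s p%:R^-1 *
    nsq (tail_vec g (tensor_of x) 0 (row_index s).1 i0 (row_index s).2 0)).
  apply: eq_bigr => s _.
  by rewrite big_ord1 (sketch_mul_entry i0) nsqM nsq_real exprVn sqr_sqrtr.
rewrite -mulr_sumr; congr (_ * _).
under [RHS]eq_bigr do rewrite tail_energy_bottom.
rewrite pair_bigA/= (reindex (@row_index p b))//=.
exact: onW_bij row_index_bij.
Qed.

End SketchMatrix.

Section GoodEvent.
Variables (R : realType) (d : nat) (n : 'I_d.+1 -> nat) (p b : nat).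
Variables (disp : measure_display) (T : measurableType disp).
Variable (Pr : probability T R).
Local Notation C := R[i].
Local Notation entry := (core_entry n p b).
Local Notation N := (\prod_l n l)%N.
Variables (O : finType) (om : O -> C) (Y : entry * O -> T -> R).
Hypothesis gY : gaussian_family Pr Y b%:R^-1.
Hypothesis om1 : \sum_o nsq (om o) = 1.
Hypotheses (p_gt0 : (0 < p)%N) (b_gt0 : (0 < b)%N).
Variable i0 : multi_index n.
Local Notation E := (expect Pr).
Local Notation Om w := (sketch_mx (gauss_entry om Y w)).

Definition sketch_dev (x : 'cV[C]_N) (w : T) : R := fro2 (Om w *m x) - fro2 x.

Let devE x : sketch_dev x = fun w => p%:R^-1 *
  (\sum_j energy om Y i0 (tensor_of x) 0 j w) - \sum_i nsq (tensor_of x i).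
Proof.
by apply/funext => w; rewrite /sketch_dev (fro2_sketch i0)// fro2_tensor_of.
Qed.

Lemma sketch_dev_poly x : polyfun Y (sketch_dev x).
Proof.
rewrite devE; apply: polyfunB; last exact: polyfun_cst.
by apply: polyfunZ; apply: polyfun_sum => j; exact: energy_poly.
Qed.

Lemma sketch_dev_moment x s : (8 * s.+1 * d.+1 <= b)%N ->
  E (fun w => sketch_dev x w ^+ (2 * s.+1)) <=
  (d.+1%:R * (8 * s.+1%:R * expR 1 / (p%:R * b%:R) * fro2 x ^+ 2)) ^+ s.+1.
Proof.
by move=> sb; rewrite devE fro2_tensor_of; exact: tt_deviation_moment.
Qed.

Variables (k r : nat) (V : 'M[C]_(N, r)) (B : 'M[C]_(k, N)) (delta : R).
Hypothesis V_on : adj V *m V = 1%:M.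
Hypothesis BV : B *m V = 0.
Hypothesis delta01 : 0 < delta < 1.
Variables (s1 s2 M : nat).
Hypothesis rM : (2 * 28 * 9 * r <= M)%N.
Hypothesis s1b : (8 * s1.+1 * d.+1 <= b)%N.
Hypothesis s2b : (8 * s2.+1 * d.+1 <= b)%N.
Hypothesis s1_ge : ln (2 / delta) <= s1.+1%:R.
Hypothesis s2_ge : ln (2 / delta) + (2 * M + 4 * r)%:R <= s2.+1%:R.
Hypothesis b1 : 2 * expR 2 * r%:R * d.+1%:R * s1.+1%:R <= b%:R :> R.
Hypothesis b2 : 16 * 16 * 8 * expR 2 * d.+1%:R * s2.+1%:R <= b%:R :> R.

Let p0 : 0 < p%:R :> R. Proof. by rewrite ltr0n. Qed.
Let b0 : 0 < b%:R :> R. Proof. by rewrite ltr0n. Qed.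

Let cross w := B *m adj (Om w) *m (Om w *m V).

Let vB (l : 'I_k) : 'cV[C]_N := adj (row l B).
Let pv (m : 'I_k * 'I_r * (bool * bool)) : 'cV[C]_N :=
  polar_vec (vB m.1.1) (col m.1.2 V) m.2.1 m.2.2.
Let wt (m : 'I_k * 'I_r * (bool * bool)) : R := fro2 (vB m.1.1).
(* Summing [wt * X] over [m] bounds [fro2 (cross w)]; with these weights Jensen's
   inequality gives a moment bound independent of [k]. If [wt m = 0] then
   [X m = 0] because division by [0] gives [0]. *)
Let X (m : 'I_k * 'I_r * (bool * bool)) (w : T) : R :=
  (8 * wt m ^+ 2)^-1 * sketch_dev (pv m) w ^+ 2.

Let Q1 w := \sum_m wt m * X m w.

Let wt0 m : 0 <= wt m. Proof. exact: fro2_ge0. Qed.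

Let X0 m w : 0 <= X m w.
Proof. by rewrite mulr_ge0 ?sqr_ge0// invr_ge0 mulr_ge0// sqr_ge0. Qed.

Let orth l i : adj (col i V) *m vB l = 0.
Proof.
rewrite /vB -adj_mul rowE colE -mulmxA [B *m _]mulmxA BV mul0mx mulmx0.
exact: adj0.
Qed.

Let col_unit i : fro2 (col i V) = 1.
Proof.
rewrite -fro2_adj fro2E /frodot adjK colE adj_mul -mulmxA [adj V *m _]mulmxA V_on.
rewrite mul1mx /mxtrace big_ord1 mxE (bigD1 i)//= big1 => [|j ji].
  by rewrite adjE !mxE !eqxx/= oppr0 mulr1 mulr0 !addr0 subr0.
by rewrite adjE !mxE (negbTE ji)/= mulr0.
Qed.

Let fro2_pv m : fro2 (pv m) = 2 * wt m.
Proof. by rewrite fro2_polar ?orth ?col_unit. Qed.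

Let cross_entry w l i : cross w l i =
  (adj (Om w *m vB l) *m (Om w *m col i V)) 0 0.
Proof.
rewrite adj_mul adjK rowE colE !mulmxA -colE [RHS]mxE -!mulmxA -rowE [RHS]mxE.
by rewrite /cross !mulmxA.
Qed.

Let cross_row0 w l i : wt (l, i, (true, true)) = 0 -> cross w l i = 0.
Proof.
move=> /fro2_eq0; rewrite /= => v0.
by rewrite cross_entry v0 mulmx0 adj0 mul0mx mxE.
Qed.

Let wtX m w : wt m * X m w = (8 * wt m)^-1 * sketch_dev (pv m) w ^+ 2.
Proof.
rewrite /X mulrA; congr (_ * _).
have [->|h] := eqVneq (wt m) 0; first by rewrite mul0r mulr0 invr0.
by field.
Qed.

Let cross_le w : fro2 (cross w) <= Q1 w.
Proof.
rewrite /Q1 (eq_bigr (fun m => wt (m.1, m.2) * X (m.1, m.2) w)); last by case.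
rewrite -(pair_bigA _ (fun li hs => wt (li, hs) * X (li, hs) w))/=.
rewrite (eq_bigr (fun li => \sum_hs wt ((li.1, li.2), hs) * X ((li.1, li.2), hs) w)); last by case.
rewrite -(pair_bigA _ (fun l i => \sum_hs wt ((l, i), hs) * X ((l, i), hs) w))/=.
rewrite /fro2; apply: ler_sum => l _; apply: ler_sum => i _.
rewrite (eq_bigr (fun hs => wt ((l, i), (hs.1, hs.2)) * X ((l, i), (hs.1, hs.2)) w)); last by case.
rewrite -(pair_bigA _ (fun h s => wt ((l, i), (h, s)) * X ((l, i), (h, s)) w))/=.
have [f0|f0] := eqVneq (wt ((l, i), (true, true))) 0.
  rewrite cross_row0// nsq0; do 2 (apply: sumr_ge0 => ? _).
  by rewrite mulr_ge0.
have := polarization (Om w) (orth l i) (col_unit i).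
rewrite -cross_entry => h.
have f1 : 0 < 8 * fro2 (vB l) by rewrite mulr_gt0// lt_def f0 fro2_ge0.
rewrite -(ler_pM2l f1); apply: le_trans h _.
rewrite mulr_sumr; apply: ler_sum => a _; rewrite mulr_sumr; apply: ler_sum => c _.
by rewrite wtX mulrA mulfV ?mul1r// gt_eqF.
Qed.

Let X_poly m : polyfun Y (X m).
Proof. by apply: polyfunZ; apply: polyfunX; exact: sketch_dev_poly. Qed.

(** The deviation constant [8 d.+1 s1.+1 e / (p b)] times [(2 wt)^2 / (8 wt^2) = 1/2], since
    [fro2 (pv m) = 2 * wt m]. *)
Let kappa : R := 4 * d.+1%:R * s1.+1%:R * expR 1 / (p%:R * b%:R).

Let kappa0 : 0 <= kappa.
Proof. by rewrite !mulr_ge0 ?expR_ge0// invr_ge0 mulr_ge0. Qed.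

Let X_moment m : E (fun w => X m w ^+ s1.+1) <= kappa ^+ s1.+1.
Proof.
have := sketch_dev_moment (pv m) s1b; rewrite fro2_pv => h.
rewrite [E _](_ : _ = E (fun w => (8 * wt m ^+ 2)^-1 ^+ s1.+1 * sketch_dev (pv m) w ^+ (2 * s1.+1))); last first.
  by apply: eq_expect => w; rewrite /X exprMn exprM.
rewrite (expectationZ gY); last by apply: polyfunX; exact: sketch_dev_poly.
have c0 : 0 <= (8 * wt m ^+ 2)^-1 by rewrite invr_ge0 mulr_ge0 ?sqr_ge0.
apply: (le_trans (ler_wpM2l (exprn_ge0 _ c0) h)).
rewrite -exprMn lerXn2r ?nnegrE//.
  rewrite mulr_ge0// mulr_ge0// mulr_ge0 ?sqr_ge0// divr_ge0 ?mulr_ge0 ?expR_ge0//.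
have [->|w0] := eqVneq (wt m) 0; first by rewrite expr0n/= mulr0 invr0 mul0r.
rewrite /kappa le_eqVlt; apply/orP; left; apply/eqP; field.
by rewrite w0 !gt_eqF.
Qed.

Let sum_wt : \sum_m wt m = 4 * r%:R * fro2 B.
Proof.
rewrite (eq_bigr (fun m => wt (m.1, m.2))); last by case.
rewrite -(pair_bigA _ (fun li hs => wt (li, hs)))/=.
rewrite (eq_bigr (fun li => \sum_(hs : bool * bool) wt ((li.1, li.2), hs))); last by case.
rewrite -(pair_bigA _ (fun l i => \sum_(hs : bool * bool) wt ((l, i), hs)))/=.
rewrite [fro2 B]/fro2 mulr_sumr; apply: eq_bigr => l _.
rewrite /wt/= [X in \sum_(i < r) X]sumr_const sumr_const card_prod card_bool card_ord.
have -> : fro2 (vB l) = \sum_j nsq (B l j).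
  by rewrite /vB fro2_adj /fro2 big_ord1; apply: eq_bigr => j _; rewrite mxE.
by move: (\sum_j _) => x; rewrite -mulrnA -(mulr_natl x) !natrM; ring.
Qed.

Let Q1_poly : polyfun Y Q1.
Proof. by apply: polyfun_sum => m; exact: polyfunZ. Qed.

Let Q1_ge0 w : 0 <= Q1 w.
Proof. by apply: sumr_ge0 => m _; rewrite mulr_ge0. Qed.

Let Q1_moment : E (fun w => Q1 w ^+ s1.+1) <= (4 * r%:R * fro2 B * kappa) ^+ s1.+1.
Proof.
have pS m : polyfun Y (fun w => wt m * X m w ^+ s1.+1).
  by apply: polyfunZ; apply: polyfunX.
apply: (@le_trans _ _ (E (fun w => (4 * r%:R * fro2 B) ^+ s1 * \sum_m wt m * X m w ^+ s1.+1))).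
  apply: (expectation_le gY); first exact: polyfunX.
    by apply: polyfunZ; apply: polyfun_sum.
  by move=> w; rewrite -sum_wt; apply: weighted_mean_pow.
have S0 : 0 <= 4 * r%:R * fro2 B by rewrite mulr_ge0 ?fro2_ge0// mulr_ge0.
rewrite (expectationZ gY); last exact: polyfun_sum.
rewrite (expectation_sum gY)// -sum_wt in S0 *.
rewrite [(_ * kappa) ^+ _]exprMn [X in _ <= X * _]exprSr -mulrA.
apply: ler_wpM2l; first exact: exprn_ge0.
rewrite mulr_suml; apply: ler_sum => m _.
rewrite (expectationZ gY); last exact: polyfunX.
by apply: ler_wpM2l.
Qed.

Let lam : R := 8 / p%:R * fro2 B.

Let lam0 : 0 <= lam.
Proof. by rewrite mulr_ge0 ?fro2_ge0// divr_ge0. Qed.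

(** The total weight [4 r |B|^2] times [kappa], divided by [lam], is [2 e r d.+1 s1.+1 / b]; [p]
    cancels, and [b1] says that this is at most [1/e]. *)
Let Q1_scaled_moment : E (fun w => (lam^-1 * Q1 w) ^+ s1.+1) <= expR (- 1) ^+ s1.+1.
Proof.
rewrite [E _](_ : _ = E (fun w => lam^-1 ^+ s1.+1 * Q1 w ^+ s1.+1)); last first.
  by apply: eq_expect => w; rewrite exprMn.
rewrite (expectationZ gY); last exact: polyfunX.
have c0 : 0 <= lam^-1 by rewrite invr_ge0.
apply: (le_trans (ler_wpM2l (exprn_ge0 _ c0) Q1_moment)).
have e10 : 0 < expR 1 :> R by exact: expR_gt0.
rewrite -exprMn lerXn2r ?nnegrE ?expR_ge0//.
  by rewrite mulr_ge0// mulr_ge0// mulr_ge0 ?fro2_ge0// mulr_ge0.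
have [f0|f0] := eqVneq (fro2 B) 0; first by rewrite /lam f0 mulr0 invr0 mul0r expR_ge0.
have -> : lam^-1 * (4 * r%:R * fro2 B * kappa) =
    (2 * (expR 1 * expR 1) * r%:R * d.+1%:R * s1.+1%:R) / (b%:R * expR 1).
  by rewrite /lam /kappa; field; rewrite f0 !gt_eqF.
rewrite -expRD -[1 + 1]/(2 : R) expRN ler_pdivrMr ?mulr_gt0//.
by rewrite [_^-1 * _]mulrC mulfK ?gt_eqF.
Qed.

Let zf (f : {ffun 'I_r * bool -> 'I_(2 * M).+1}) : 'cV[C]_r := @grid_point R r M f.
(** If a term is at most [1], the relative deviation at that net point is at most [1/16], as
    [net_lower] requires. Even powers turn the union bound into a sum of moments. *)
Let Q2 w := \sum_(f | net f) (16 / fro2 (zf f) * sketch_dev (V *m zf f) w) ^+ (2 * s2.+1).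

Let fro2_V z : fro2 (V *m z : 'cV[C]_N) = fro2 (z : 'cV[C]_r).
Proof.
by rewrite -fro2_adj -[in RHS]fro2_adj adj_mul fro2_unitary_mul.
Qed.

Let Q2_poly : polyfun Y Q2.
Proof.
by apply: polyfun_sum => f; apply: polyfunX; apply: polyfunZ; exact: sketch_dev_poly.
Qed.

Let Q2_term0 f w : 0 <= (16 / fro2 (zf f) * sketch_dev (V *m zf f) w) ^+ (2 * s2.+1).
Proof. by rewrite exprM exprn_ge0 ?sqr_ge0. Qed.

Let Q2_term f : E (fun w => (16 / fro2 (zf f) * sketch_dev (V *m zf f) w) ^+ (2 * s2.+1))
  <= expR (- 1) ^+ s2.+1.
Proof.
have e10 : 0 < expR 1 :> R by exact: expR_gt0.
rewrite [E _](_ : _ = E (fun w => (16 / fro2 (zf f)) ^+ (2 * s2.+1) *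
   sketch_dev (V *m zf f) w ^+ (2 * s2.+1))); last by apply: eq_expect => w; rewrite exprMn.
rewrite (expectationZ gY); last by apply: polyfunX; exact: sketch_dev_poly.
have c0 : 0 <= (16 / fro2 (zf f)) ^+ (2 * s2.+1) by rewrite exprM exprn_ge0 ?sqr_ge0.
apply: (le_trans (ler_wpM2l c0 (sketch_dev_moment _ s2b))).
rewrite fro2_V exprM -exprMn lerXn2r ?nnegrE ?expR_ge0//.
  rewrite mulr_ge0 ?sqr_ge0// mulr_ge0// mulr_ge0 ?sqr_ge0// divr_ge0 ?mulr_ge0 ?expR_ge0//.
have [->|f0] := eqVneq (fro2 (zf f)) 0.
  by rewrite invr0 mulr0 expr0n mul0r expR_ge0.
have -> : (16 / fro2 (zf f)) ^+ 2 * (d.+1%:R * (8 * s2.+1%:R * expR 1 / (p%:R * b%:R) * fro2 (zf f) ^+ 2)) =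
    (16 * 16 * 8 * (expR 1 * expR 1) * d.+1%:R * s2.+1%:R) / (p%:R * b%:R * expR 1).
  by field; rewrite f0 !gt_eqF.
rewrite -expRD -[1 + 1]/(2 : R) expRN ler_pdivrMr ?mulr_gt0//.
rewrite [_^-1 * _]mulrC mulfK ?gt_eqF//; apply: le_trans b2 _.
by rewrite -[X in X <= _]mul1r ler_wpM2r// ler1n.
Qed.

Let expN_S s : ln (2 / delta) <= s%:R -> expR (- 1) ^+ s <= delta / 2.
Proof.
move=> h; have /andP[d0 _] := delta01.
rewrite -expRM_natl mulrN mulr1.
have -> : delta / 2 = expR (- ln (2 / delta)).
  by rewrite expRN lnK ?invf_div// posrE divr_gt0.
by rewrite ler_expR lerN2.
Qed.

(** From [2 <= e] and [3 <= e^2]; the exponent is the surplus that [s2_ge] demands over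
    [ln (2 / delta)]. *)
Let count_le : (2 : R) ^+ (2 * M) * 3 ^+ (2 * r) <= expR (2 * M + 4 * r)%:R.
Proof.
have e2 : 2 <= expR 1 :> R by have := expR_ge1Dx (1 : R).
have -> : expR (2 * M + 4 * r)%:R = expR 1 ^+ (2 * M) * (expR 1 ^+ 2) ^+ (2 * r) :> R.
  by rewrite -exprM mulnA -exprD -expRM_natl mulr1.
apply: ler_pM; rewrite ?exprn_ge0// lerXn2r ?nnegrE ?exprn_ge0 ?expR_ge0//.
by rewrite expr2; nra.
Qed.

Let Q2_moment : E Q2 <= delta / 2.
Proof.
have /andP[d0 _] := delta01.
rewrite /Q2.
rewrite (expectation_sum_pred gY); last first.
  by move=> f; apply: polyfunX; apply: polyfunZ; exact: sketch_dev_poly.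
apply: (@le_trans _ _ (\sum_(f | net f) expR (- 1) ^+ s2.+1)).
  by apply: ler_sum => f _; exact: Q2_term.
rewrite sumr_const -[X in X <= _]mulr_natl.
have e0 : 0 <= expR (- 1) ^+ s2.+1 :> R by rewrite exprn_ge0 ?expR_ge0.
apply: (le_trans (ler_wpM2r e0 (le_trans (net_card R r M) count_le))).
have -> : delta / 2 = expR (- ln (2 / delta)).
  by rewrite expRN lnK ?invf_div// posrE divr_gt0.
rewrite -expRM_natl -expRD ler_expR mulrN1; move: s2_ge; lra.
Qed.

(** A single Markov inequality for [U], the sum of two nonnegative parts of mean at most [delta / 2]
    each: [U <= 1] forces every nonnegative term of both parts below [1]. *)
Lemma good_event : exists Gd : set T, [/\ measurable Gd, ((1 - delta)%:E <= Pr Gd)%E &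
  forall w, Gd w ->
    (forall v : 'cV[C]_r, 2^-1 * fro2 v <= fro2 (Om w *m V *m v)) /\
    fro2 (B *m adj (Om w) *m (Om w *m V)) <= 8 / p%:R * fro2 B].
Proof.
pose U w := (lam^-1 * Q1 w) ^+ s1.+1 + Q2 w.
have pQ : polyfun Y (fun w => (lam^-1 * Q1 w) ^+ s1.+1) by apply: polyfunX; exact: polyfunZ.
have pU : polyfun Y U by exact: polyfunD.
have l0 w : 0 <= lam^-1 * Q1 w by rewrite mulr_ge0// invr_ge0.
have Q20 w : 0 <= Q2 w by apply: sumr_ge0 => f _; exact: Q2_term0.
have [|mG PG] := markov_le1 gY pU.
  by move=> w; rewrite addr_ge0// exprn_ge0.
exists [set w | U w <= 1]; split => //.
  apply: le_trans PG; rewrite lee_fin lerD2l lerN2 (expectationD gY)//.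
  have := le_trans Q1_scaled_moment (expN_S s1_ge); have := Q2_moment.
  lra.
move=> w /= Uw; split; last first.
  apply: le_trans (cross_le w) _; rewrite -/lam.
  have [f0|f0] := eqVneq (fro2 B) 0.
    rewrite /Q1 big1// => m _; suff -> : wt m = 0 by rewrite mul0r.
    by rewrite /wt /vB (fro2_eq0 f0) /row' fro2_adj (_ : row m.1.1 0 = 0) ?row0// /fro2 big1// => ? _; rewrite big1// => ? _; rewrite mxE nsq0.
  have lp : 0 < lam by rewrite mulr_gt0 ?divr_gt0// lt_def f0 fro2_ge0.
  rewrite -[X in _ <= X]mulr1 -ler_pdivrMl//.
  rewrite -(@expr_le1 _ s1.+1)//; apply: le_trans Uw; rewrite /U lerDl; exact: Q20.
(* The net needs [r > 0], while here [r] can be zero, for instance when the low-rank approximation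
   vanishes. *)
have [r0|r0] := posnP r.
  move=> v; rewrite (_ : fro2 v = 0) ?mulr0 ?fro2_ge0//.
  by rewrite /fro2; apply: big1 => i _; have := ltn_ord i; rewrite {2}r0.
apply: (net_lower r0 rM) => f nf.
rewrite -mulmxA -[X in _ - X]fro2_V -/(sketch_dev (V *m zf f) w).
have [z0|z0] := eqVneq (fro2 (zf f)) 0.
  by rewrite /sketch_dev fro2_V -/(zf f) z0 (fro2_eq0 z0) !mulmx0 /fro2 big1 ?subrr ?normr0 ?mulr0// => ? _; rewrite big1// => ? _; rewrite mxE nsq0.
have zp : 0 < fro2 (zf f) by rewrite lt_def z0 fro2_ge0.
have : (16 / fro2 (zf f) * sketch_dev (V *m zf f) w) ^+ (2 * s2.+1) <= 1.
  apply: le_trans Uw; rewrite /U.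
  apply: (@le_trans _ _ (Q2 w)); last by rewrite lerDr exprn_ge0.
  by rewrite /Q2 (bigD1 f)//= lerDl; apply: sumr_ge0 => ? _; exact: Q2_term0.
rewrite exprM expr_le1 ?sqr_ge0// -real_normK ?num_real// expr_le1// normrM ger0_norm ?divr_ge0 ?fro2_ge0// => h.
have : fro2 (zf f) * 16^-1 * (16 / fro2 (zf f) * `|sketch_dev (V *m zf f) w|) <= fro2 (zf f) * 16^-1 * 1.
  by rewrite ler_wpM2l// divr_ge0 ?fro2_ge0.
by rewrite mulrA (_ : _ * (16 / _) = 1) ?mul1r ?mulr1 1?mulrC//; field.
Qed.

End GoodEvent.

(** * Measurability of the residual *)

Section ResidualMeasurable.
Variable R : realType.
Local Notation C := R[i].

Definition rat_mx m n (W : 'M[rat]_(m, n) * 'M[rat]_(m, n)) : 'M[C]_(m, n) :=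
  \matrix_(i, j) (ratr (W.1 i j) +i* ratr (W.2 i j))%C.

Lemma rat_mx_dense m n (Z : 'M[C]_(m, n)) (e : R) : 0 < e ->
  exists W, fro2 (rat_mx W - Z) < e.
Proof.
move=> e0.
pose h := Num.min 1 (e / (2 * (m * n)%:R + 1)).
have K0 : 0 < 2 * (m * n)%:R + 1 :> R by rewrite ltr_wpDl// mulr_ge0.
have h0 : 0 < h by rewrite lt_min ltr01 divr_gt0.
have h1 : h <= 1 by rewrite ge_min lexx.
have hK : h * (2 * (m * n)%:R + 1) <= e.
  by rewrite -ler_pdivlMr// ge_min lexx orbT.
have approx (x : R) : exists q : rat, (ratr q - x) ^+ 2 <= h ^+ 2.
  have [|q] := @rat_in_itvoo R (x - h) (x + h); first by lra.
  rewrite in_itv/= => /andP[q1 q2]; exists q; nra.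
have [f fP] := choice approx.
exists (\matrix_(i, j) f (complex.Re (Z i j)), \matrix_(i, j) f (complex.Im (Z i j))).
apply: (@le_lt_trans _ _ (\sum_(i < m) \sum_(j < n) 2 * h ^+ 2)).
  apply: ler_sum => i _; apply: ler_sum => j _; rewrite !mxE.
  have := fP (complex.Re (Z i j)); have := fP (complex.Im (Z i j)).
  by case: (Z i j) => a c; rewrite /nsq/=; lra.
rewrite !sumr_const !card_ord -mulrnA -[_ *+ _]mulr_natr [(n * m)%N]mulnC.
apply: lt_le_trans hK.
have : 0 <= (m * n)%:R :> R by [].
have h2 : h ^+ 2 <= h by nra.
move: (_%:R) => x x0; have := ler_wpM2r x0 h2; lra.
Qed.

Variables (disp : measure_display) (T : measurableType disp).

(* [Q] need not be a measurable function of [w], but the residual depends only on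
   the column space of [M w]: it is the infimum of [fro2 (A - M w *m W)] over all
   [W], hence over rational ones. *)
Lemma projection_residual_measurable k n q (A : 'M[C]_(k, n))
    (M : T -> 'M[C]_(k, q)) (m : T -> nat) (Q : forall w, 'M[C]_(k, m w))
    (t : R) :
  (forall W, measurable_fun setT (fun w => fro2 (A - M w *m W))) ->
  (forall w, adj (Q w) *m Q w = 1%:M) ->
  (forall w, exists X, M w = Q w *m X) -> (forall w, exists Z, Q w = M w *m Z) ->
  measurable [set w | fro2 (A - Q w *m (adj (Q w) *m A)) <= t].
Proof.
move=> mM QQ MQ QM.
have -> : [set w | fro2 (A - Q w *m (adj (Q w) *m A)) <= t] =
  \bigcap_i \bigcup_j
    [set w | if unpickle j is Some W then
       fro2 (A - M w *m rat_mx W) < t + i.+1%:R^-1 else false].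
  apply/seteqP; split=> w /= wt; last first.
    apply/ler_addgt0Pr => e e0.
    have [i ei] : exists i : nat, i.+1%:R^-1 < e.
      exists (Num.truncn e^-1); rewrite invf_plt ?posrE//; exact: truncnS_gt.
    have [j _] := wt i I; case: (unpickle j) => [W /= h|//].
    have [X MX] := MQ w.
    apply: le_trans (projection_error A (rat_mx W) (QQ w) MX) _.
    by apply/ltW; apply: (lt_trans h); rewrite ltrD2l.
  move=> i _; have [Z QZ] := QM w.
  set a := t + _; have ta : t < a by rewrite ltrDl invr_gt0.
  set x := fro2 _ in wt.
  have x0 : 0 <= x by exact: fro2_ge0.
  have xa : x < a by apply: le_lt_trans wt ta.
  (* This [W0] attains the residual; it remains to replace it by a nearby rational matrix. *)
  pose W0 := Z *m (adj (Q w) *m A).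
  have xE : x = fro2 (A - M w *m W0) by rewrite /x /W0 (mulmxA (M w)) -QZ.
  (* Young's parameter: enlarging [x] by the factor [1 + e] uses at most half of the gap [a - x],
     and the other half, divided by [c], bounds the distance from [W0] to the rational matrix. *)
  pose e := (a - x) / (2 * (x + 1)).
  have e0 : 0 < e by rewrite divr_gt0 ?subr_gt0// mulr_gt0// ltr_wpDl.
  have ex : e * x <= (a - x) / 2.
    have -> : (a - x) / 2 = e * (x + 1) by rewrite /e; field; rewrite gt_eqF// ltr_wpDl.
    by rewrite mulrDr mulr1 lerDl ltW.
  pose c := (1 + e^-1) * (fro2 (M w) + 1).
  have c0 : 0 < c.
    by apply: mulr_gt0; [rewrite addr_gt0// invr_gt0|rewrite ltr_wpDl ?fro2_ge0].
  have h0 : 0 < (a - x) / 2 / c by rewrite !divr_gt0// subr_gt0.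
  have [W WW] := rat_mx_dense W0 h0.
  exists (pickle W) => //=; rewrite pickleK.
  have -> : A - M w *m rat_mx W = (A - M w *m W0) + (- (M w *m (rat_mx W - W0))).
    by rewrite mulmxBr opprB addrA subrK.
  apply: le_lt_trans (fro2_young _ _ e0) _.
  rewrite -xE fro2N.
  have := fro2_mul (M w) (rat_mx W - W0).
  move: WW; rewrite ltr_pdivlMr// /c.
  have := fro2_ge0 (rat_mx W - W0); have := fro2_ge0 (M w).
  have ei0 : 0 < e^-1 by rewrite invr_gt0.
  move: (fro2 (M w)) (fro2 (rat_mx W - W0)) (fro2 (M w *m _)) => u y z u0 y0 yc zuy.
  have : (1 + e^-1) * z <= (1 + e^-1) * (u * y).
    by rewrite ler_wpM2l// addr_ge0// ltW.
  have : 0 <= y * (1 + e^-1) by rewrite mulr_ge0// addr_ge0// ltW.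
  nra.
apply: bigcapT_measurable => i; apply: bigcupT_measurable => j.
case: (unpickle j) => [W|]; last by rewrite (_ : [set _ | _] = set0)//; apply/seteqP; split.
rewrite (_ : [set w | _] = setT `&` (fun w => fro2 (A - M w *m rat_mx W)) @^-1` `]-oo, (t + i.+1%:R^-1)[%classic).
  exact: mM.
by rewrite setTI; apply/seteqP; split=> w /=; rewrite in_itv.
Qed.

End ResidualMeasurable.

Section SketchMeasurable.
Variables (R : realType) (d : nat) (n : 'I_d.+1 -> nat) (p b : nat).
Variables (disp : measure_display) (T : measurableType disp).
Variable (Pr : probability T R).
Local Notation C := R[i].
Local Notation entry := (core_entry n p b).
Local Notation N := (\prod_l n l)%N.
Variables (O : finType) (om : O -> C) (Y : entry * O -> T -> R) (v : R).
Hypothesis gY : gaussian_family Pr Y v.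
Variable i0 : multi_index n.
Local Notation Om w := (sketch_mx (gauss_entry om Y w)).

(** After taking adjoints, [Om] acts on the columns of [adj A], so the entries are contractions
    already known to be polynomial in [Y]. *)
Lemma residual_measurable k (A : 'M[C]_(k, N)) (W : 'M[C]_(p * b, N)) :
  measurable_fun setT (fun w => fro2 (A - A *m adj (Om w) *m W)).
Proof.
apply: (measurable_poly gY).
have E w : fro2 (A - A *m adj (Om w) *m W) = \sum_i \sum_j
   nsq (adj A i j + - 1 * \sum_s adj W i s *
     ((Num.sqrt p%:R)^-1%:C%C * tail_vec (gauss_entry om Y w)
       (tensor_of (col j (adj A))) 0 (row_index s).1 i0 (row_index s).2 0)).
  rewrite -fro2_adj adjB !adj_mul adjK.
  apply: eq_bigr => i _; apply: eq_bigr => j _; congr nsq.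
  rewrite [LHS]mxE [X in _ + X]mxE mulN1r; congr (_ - _); rewrite mxE.
  apply: eq_bigr => s _; congr (_ * _).
  rewrite -(sketch_mul_entry i0) [col j _]colE mulmxA -colE.
  by rewrite [RHS]mxE.
have -> : (fun w => fro2 (A - A *m adj (Om w) *m W)) = fun w => \sum_i \sum_j
   nsq (adj A i j + - 1 * \sum_s adj W i s *
     ((Num.sqrt p%:R)^-1%:C%C * tail_vec (gauss_entry om Y w)
       (tensor_of (col j (adj A))) 0 (row_index s).1 i0 (row_index s).2 0)).
  exact/funext.
apply: polyfun_sum => i; apply: polyfun_sum => j; apply: polyfun_nsq.
apply: pfreeD; first exact: pfree_cst.
apply: pfreeM; first exact: pfree_cst.
apply: pfree_sum => s; apply: pfreeM; first exact: pfree_cst.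
apply: pfreeM; first exact: pfree_cst.
exact: tail_vec_free.
Qed.

End SketchMeasurable.

(** * Real and complex scalars *)

Section Embedding.
Variables (R : realType) (F : scalar_field).
Local Notation C := R[i].
Local Notation K := (Scalar R F).

Definition to_complex : {rmorphism K -> C} :=
  match F return {rmorphism Scalar R F -> C} with
  | RealScalars => real_complex R
  | ComplexScalars => idfun
  end.

Local Notation "A ^C" := (map_mx to_complex A).

Lemma nsq_to_complex (z : K) : nsq (to_complex z) = scalar_abs z ^+ 2.
Proof.
rewrite /to_complex; case: F z => [x|[a c]] /=.
  by rewrite nsq_real real_normK ?num_real.
by rewrite /nsq/= sqr_sqrtr// addr_ge0 ?sqr_ge0.
Qed.

Lemma to_complex_conj (z : K) : to_complex (scalar_conj z) = (to_complex z)^*%C.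
Proof. by rewrite /to_complex; case: F z => [x|z] //=; rewrite oppr0. Qed.

Lemma to_complex_real (x : R) : to_complex (of_real F x) = x%:C%C.
Proof. by rewrite /to_complex; case: F. Qed.

Lemma frobenius_sqr m n (A : 'M[K]_(m, n)) : frobenius A ^+ 2 = fro2 A^C.
Proof.
rewrite sqr_sqrtr; last by do 2 (apply: sumr_ge0 => ? _); exact: sqr_ge0.
by apply: eq_bigr => i _; apply: eq_bigr => j _; rewrite mxE nsq_to_complex.
Qed.

Lemma frobenius_ge0 m n (A : 'M[K]_(m, n)) : 0 <= frobenius A.
Proof. exact: sqrtr_ge0. Qed.

Lemma map_adjmx m n (A : 'M[K]_(m, n)) : (adjmx A)^C = adj A^C.
Proof. by apply/matrixP => i j; rewrite !mxE to_complex_conj. Qed.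

Variables (d : nat) (n : 'I_d.+1 -> nat) (p b : nat) (T : Type).
Variables (G : T -> inner_cores R F n p b) (H : T -> last_cores R F n p b).

Lemma map_ttstack w :
  (ttstack (G w) (H w))^C = sketch_mx (fun e => to_complex (core_entries G H e w)).
Proof.
apply/matrixP => s t; rewrite !mxE rmorphM/= to_complex_real; congr (_ * _).
rewrite rmorph_sum/=; apply: eq_bigr => c _; rewrite rmorphM/=; congr (_ * _); last first.
  by rewrite mxE.
have big_map (A : 'I_d -> 'M[K]_b) :
    (\big[mulmx/1%:M]_l A l)^C = \big[mulmx/1%:M]_l (A l)^C.
  by apply: big_morph => [x y|]; rewrite ?map_mxM ?map_mx1.
have mapE (A : 'M[K]_b) i j : to_complex (A i j) = A^C i j by rewrite mxE.
rewrite mapE big_map.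
congr (fun_of_matrix _ _ _); apply: eq_bigr => l _.
by apply/matrixP => i j; rewrite !mxE.
Qed.

End Embedding.

Section GaussianCoordinates.
Variables (R : realType) (F : scalar_field) (v : R).
Variables (disp : measure_display) (T : measurableType disp).
Variables (Pr : probability T R) (I : finType) (X : I -> T -> Scalar R F).
Local Notation C := R[i].
Hypothesis v_gt0 : 0 < v.
Hypothesis gX : iid_gaussian Pr v X.

(** A real scalar is its own coordinate. A complex one has coordinates [Num.sqrt 2] times its real
    and imaginary parts, each of variance [v], with coefficients [1 / sqrt 2] and [i / sqrt 2]. *)
Lemma gaussian_coordinates : exists (O : finType) (om : O -> C)
    (Y : I * O -> T -> R),
  [/\ gaussian_family Pr Y v, \sum_o nsq (om o) = 1 &
    forall w e, \sum_o om o * (Y (e, o) w)%:C%C = to_complex R F (X e w)].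
Proof.
case: F X gX => X' [ind law].
- exists unit, (fun _ => 1), (fun eo => X' eo.1); split.
  + split=> // [[e o] _ B mB|B mB].
      by rewrite setTI; have [] := law e B mB.
    have := ind [set: I]%SET (fun e => B (e, tt)) (fun e => mB (e, tt)).
    rewrite (_ : [set w | _] = [set w | forall i, B i (X' i.1 w)]); last first.
      by apply/seteqP; split=> w /= h i; [case: i => i []; exact: (h i (finset.in_setT _))|move=> _; exact: (h (i, tt))].
    move=> ->; rewrite (eq_bigr (fun i => normal_prob 0 (Num.sqrt v) (B (i.1, i.2)))); last by case.
    rewrite -(pair_bigA _ (fun i j => normal_prob 0 (Num.sqrt v) (B (i, j))))/=.
    rewrite (eq_bigl predT)/=; last by (move=> i; rewrite finset.in_setT).
    apply: eq_bigr => i _.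
    rewrite (big_pred1 tt); last by case.
    by have [] := law i (B (i, tt)) (mB _).
  + rewrite (big_pred1 tt); last by case.
    by rewrite /nsq/= expr1n expr0n addr0.
  + by move=> w e; rewrite (big_pred1 tt) ?mul1r//; case.
have s2 : 0 < Num.sqrt 2 :> R by rewrite sqrtr_gt0.
have s2n : Num.sqrt 2 != 0 :> R by rewrite gt_eqF.
have s22 : Num.sqrt 2 ^+ 2 = 2 :> R by rewrite sqr_sqrtr.
pose cm (h : bool) (z : R) : C := if h then (z +i* 0)%C else (0 +i* z)%C.
exists bool, (fun h => cm h (Num.sqrt 2)^-1),
  (fun eo w => Num.sqrt 2 * cpart eo.2 (X' eo.1 w)).
(* Rectangles suffice: in the law of [(Z1 + i Z2) / sqrt 2] the two factors [sqrt 2] cancel and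
   leave the product of the real laws. *)
have law_rect i (B : bool -> set R) : (forall h, measurable (B h)) ->
    let B' := [set z : C | B true (Num.sqrt 2 * complex.Re z) /\ B false (Num.sqrt 2 * complex.Im z)] in
    [/\ @borel R ComplexScalars B', measurable (X' i @^-1` B') & Pr (X' i @^-1` B') =
     (\prod_h normal_prob 0 (Num.sqrt v) (B h))%E].
  move=> mB B'.
  have bB : @borel R ComplexScalars B'.
    rewrite /borel/= /B' /=.
    have mm (A : set R) : measurable A -> measurable [set x | A (Num.sqrt 2 * x)].
      move=> mA; rewrite -[X in measurable X]setTI.
      have mf : measurable_fun setT (fun x : R => Num.sqrt 2 * x) by exact: mulrl_measurable.
      exact: mf.
    exact: (measurableX (mm _ (mB true)) (mm _ (mB false))).
  have [mX PX] := law i B' bB; split=> //.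
  rewrite PX /gaussian_law /= (_ : [set z : R * R | _] = B true `*` B false).
    by rewrite product_measure1E; [rewrite [RHS]big_bool|exact: mB|exact: mB].
  have e2 (x : R) : Num.sqrt 2 * (x / Num.sqrt 2) = x.
    by rewrite mulrCA mulfV ?mulr1.
  have ez (z : R * R) : ((z.1%:C + 'i * z.2%:C) / (Num.sqrt 2)%:C)%C =
      ((z.1 / Num.sqrt 2) +i* (z.2 / Num.sqrt 2))%C.
    rewrite -fmorphV/=; case: z => x y; apply/eqP; rewrite eq_complex/=.
    by apply/andP; split; apply/eqP; ring.
  by apply/seteqP; split=> z /=; rewrite ez /B'/= !e2.
split.
- split=> //.
  + move=> [e h] _ B mB; rewrite setTI.
    pose BB (h' : bool) : set R := if h' == h then B else setT.
    have mBB h' : measurable (BB h') by rewrite /BB; case: ifP => _.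
    have [_ m _] := law_rect e BB mBB.
    rewrite (_ : _ @^-1` B = X' e @^-1`
      [set z : C | BB true (Num.sqrt 2 * complex.Re z) /\ BB false (Num.sqrt 2 * complex.Im z)])//.
    by apply/seteqP; rewrite /BB; case: h {BB mBB m} => /=; split=> w //= [].
  move=> B mB.
  pose B' e : set C := [set z : C | B (e, true) (Num.sqrt 2 * complex.Re z) /\
     B (e, false) (Num.sqrt 2 * complex.Im z)].
  have hB e := law_rect e (fun h => B (e, h)) (fun h => mB (e, h)).
  have := ind [set: I]%SET B' (fun e => let: And3 h _ _ := hB e in h).
  rewrite (_ : [set w | _] = [set w | forall i, B i (Num.sqrt 2 * cpart i.2 (X' i.1 w))]); last first.
    apply/seteqP; split=> w /= h i; last by move=> _; split; [exact: (h (i, true))|exact: (h (i, false))].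
    by case: i => i []; have [] := h i (finset.in_setT _).
  move=> ->; rewrite (eq_bigr (fun i => normal_prob 0 (Num.sqrt v) (B (i.1, i.2)))); last by case.
  rewrite -(pair_bigA _ (fun i j => normal_prob 0 (Num.sqrt v) (B (i, j))))/=.
  rewrite (eq_bigl predT)/=; last by (move=> i; rewrite finset.in_setT).
    apply: eq_bigr => i _.
  by have [_ _ ->] := hB i.
- rewrite big_bool /nsq/= expr0n addr0 add0r exprVn s22; lra.
- move=> w e; rewrite big_bool/=; case: (X' e w) => a c.
  by apply/eqP; rewrite eq_complex/= !mulrA mulVf//; apply/andP; split; apply/eqP; ring.
Qed.

End GaussianCoordinates.

(** With [L = ln (2 / delta)], [1 - L <= exp (- L) = delta / 2 < 1/2]. This lets additive constants
    be absorbed into multiples of [L]. *)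
Lemma ln2_half (R : realType) (delta : R) : 0 < delta < 1 -> 1 <= 2 * ln (2 / delta).
Proof.
move=> /andP[d0 d1].
have := expR_ge1Dx (- ln (2 / delta)).
rewrite expRN lnK ?invf_div ?posrE ?divr_gt0//; lra.
Qed.

(** * Choice of the constants and conclusion *)

Theorem corollary3p8 (R : realType) :
  exists c : R, 0 < c /\
  forall (F : scalar_field) (d : nat) (n : 'I_d.+1 -> nat),
    (forall l, (0 < n l)%N) ->
  forall (k : nat) (A : 'M[Scalar R F]_(k, \prod_l n l)) (r : nat),
    (1 <= r <= k)%N ->
  forall Ar : 'M[Scalar R F]_(k, \prod_l n l), best_rank_approx r A Ar ->
  forall eps delta : R, 0 < eps < 1 -> 0 < delta < 1 ->
  forall p b : nat, (0 < p)%N -> (0 < b)%N ->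
    c * r%:R * d.+1%:R * ln (2 / delta) <= b%:R ->
    16 * expR 1 ^+ 4 * Num.max 4 (1 / eps) <= p%:R ->
  forall (disp : measure_display) (T : measurableType disp)
    (Pr : probability T R)
    (G : T -> inner_cores R F n p b) (H : T -> last_cores R F n p b),
    gaussian_cores Pr G H ->
  forall (m : T -> nat) (Q : forall w : T, 'M[Scalar R F]_(k, m w)),
    (forall w, orthonormal_col_basis (Q w) (A *m adjmx (ttstack (G w) (H w)))) ->
  ((1 - delta)%:E <=
   Pr [set w | (frobenius (A - Q w *m (adjmx (Q w) *m A)) <=
                (1 + eps) * frobenius (A - Ar))%R])%E.
Proof.
have [N0 N0E] : exists N0, (2 * 28 * 9)%N = N0 by exists (2 * 28 * 9)%N.
(* With [1 <= 2 L] and [r >= 1], the larger moment order is at most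
   [L + (2 N0 + 4) r + 1 <= K r L]. *)
pose K : R := 2 * (2 * N0%:R + 4) + 3.
pose E2 : R := expR 2.
have E21 : 1 <= E2 by rewrite -expR0 ler_expR.
have K3 : 3 <= K by rewrite lerDr mulr_ge0// addr_ge0// mulr_ge0.
exists (16 * 16 * 8 * E2 * K); split.
  by rewrite !mulr_gt0// (lt_le_trans ltr01)// (le_trans _ K3)// ler1n.
move=> F d n n_gt0 k A r /andP[r1 rk] Ar [rAr _] eps delta eps01 delta01 p b p_gt0 b_gt0
  hb hp disp T Pr G H gGH m Q QP.
pose i0 : multi_index n := [ffun l => Ordinal (n_gt0 l)].
have v_gt0 : 0 < b%:R^-1 :> R by rewrite invr_gt0 ltr0n.
have [Oc [om [Y [gY om1 YE]]]] := gaussian_coordinates v_gt0 gGH.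
pose L : R := ln (2 / delta).
have L1 : 1 <= 2 * L by exact: ln2_half.
have L0 : 0 <= L by lra.
pose tc := to_complex R F.
pose AC := map_mx tc A; pose ArC := map_mx tc Ar.
have [V [V_on ArV]] := row_space_basis ArC.
have r'r : (\rank ArC <= r)%N by rewrite mxrank_map.
pose B : 'M[R[i]]_(k, _) := AC - AC *m V *m adj V.
have BV : B *m V = 0 by rewrite /B mulmxBl -[_ *m adj V *m V]mulmxA V_on mulmx1 subrr.
pose M := (N0 * r)%N.
have rM : (2 * 28 * 9 * \rank ArC <= M)%N by rewrite N0E leq_mul2l r'r orbT.
(* [s1.+1] and [s2.+1] exceed the required orders by at most [1]. *)
pose s1 := Num.trunc L; pose s2 := Num.trunc (L + (2 * M + 4 * r)%:R).
have s1_ge : L <= s1.+1%:R by exact/ltW/truncnS_gt.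
have s2_ge0 : L + (2 * M + 4 * r)%:R <= s2.+1%:R by exact/ltW/truncnS_gt.
have s2_ge : L + (2 * M + 4 * \rank ArC)%:R <= s2.+1%:R.
  by apply: le_trans s2_ge0; rewrite lerD2l ler_nat leq_add2l leq_mul2l r'r.
have s1_le : s1.+1%:R <= L + 1.
  by rewrite -addn1 natrD lerD2r truncn_le.
have s2_le : s2.+1%:R <= L + (2 * M + 4 * r)%:R + 1.
  by rewrite -addn1 natrD lerD2r truncn_le addr_ge0.
have r1R : 1 <= r%:R :> R by rewrite ler1n.
have S1 : s1.+1%:R <= K * (r%:R * L).
  apply: (le_trans s1_le); apply: (@le_trans _ _ (3 * L)); first by lra.
  by apply: ler_pM => //; rewrite ler_peMl.
have S2 : s2.+1%:R <= K * (r%:R * L).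
  apply: (le_trans s2_le).
  rewrite natrD /M !natrM /K; move: (N0%:R : R) (ler0n R N0) => N1 N10.
  have h1 : (2 * N1 + 4) * r%:R <= (2 * N1 + 4) * (r%:R * (2 * L)).
    by apply: ler_wpM2l; [rewrite addr_ge0// mulr_ge0|rewrite ler_peMr].
  have h2 : L <= r%:R * L by rewrite ler_peMl.
  by lra.
pose X : R := K * (r%:R * L) * d.+1%:R.
have X0 : 0 <= X by rewrite !mulr_ge0// (le_trans _ K3).
have hbX : 16 * 16 * 8 * E2 * X <= b%:R.
  apply: le_trans hb; rewrite le_eqVlt; apply/orP; left; apply/eqP.
  by rewrite /X -/L; ring.
have S1X : d.+1%:R * s1.+1%:R <= X by rewrite mulrC ler_wpM2r.
have S2X : d.+1%:R * s2.+1%:R <= X by rewrite mulrC ler_wpM2r.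
have sb (s : nat) : d.+1%:R * s.+1%:R <= X -> (8 * s.+1 * d.+1 <= b)%N.
  move=> sX; rewrite -(ler_nat R); apply: le_trans hbX.
  rewrite !natrM -mulrA [s.+1%:R * _]mulrC.
  have : X <= E2 * X by rewrite ler_peMl.
  by move: sX X0; lra.
have b1 : 2 * E2 * (\rank ArC)%:R * d.+1%:R * s1.+1%:R <= b%:R.
  apply: le_trans hbX.
  have h : (\rank ArC)%:R * s1.+1%:R <= K * (r%:R * L).
    apply: (@le_trans _ _ (r%:R * (3 * L))).
      by apply: ler_pM; rewrite ?ler_nat//; apply: (le_trans s1_le); lra.
    by rewrite mulrCA ler_wpM2r// mulr_ge0.
  have hX : (\rank ArC)%:R * s1.+1%:R * d.+1%:R <= X by exact: ler_wpM2r.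
  have : E2 * ((\rank ArC)%:R * s1.+1%:R * d.+1%:R) <= E2 * X.
    by rewrite ler_wpM2l// (le_trans ler01).
  have : 0 <= E2 * X by rewrite mulr_ge0// (le_trans ler01).
  rewrite -[16 * 16 * 8 * E2 * X]mulrA; move: (E2 * X) => Z.
  move: ((\rank ArC)%:R : R) (d.+1%:R : R) (s1.+1%:R : R) => a1 a2 a3; lra.
have b2 : 16 * 16 * 8 * E2 * d.+1%:R * s2.+1%:R <= b%:R.
  apply: le_trans hbX; rewrite -mulrA; apply: ler_wpM2l => //.
  by rewrite !mulr_ge0// (le_trans ler01).
have [Gd [mGd PGd Gd_good]] := good_event gY om1 p_gt0 b_gt0 i0 V_on BV delta01 rM
  (sb _ S1X) (sb _ S2X) s1_ge s2_ge b1 b2.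
pose Om w := sketch_mx (gauss_entry om Y w).
have OmE w : map_mx tc (ttstack (G w) (H w)) = Om w.
  by rewrite map_ttstack; congr sketch_mx; apply/funext => e; rewrite /gauss_entry YE.
pose QC w := map_mx tc (Q w).
have ME w : map_mx tc (A *m adjmx (ttstack (G w) (H w))) = AC *m adj (Om w).
  by rewrite map_mxM map_adjmx OmE.
have QC_on w : adj (QC w) *m QC w = 1%:M.
  by have [QQ _] := QP w; rewrite /QC -map_adjmx -map_mxM QQ map_mx1.
have MQ w : exists Z, AC *m adj (Om w) = QC w *m Z.
  have [_ /andP[_ /submxP[D DE]]] := QP w; exists (map_mx tc D^T).
  by rewrite -ME -map_mxM; congr map_mx; apply: trmx_inj; rewrite DE [RHS]trmx_mul trmxK.
have QM w : exists Z, QC w = AC *m adj (Om w) *m Z.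
  have [_ /andP[/submxP[D DE] _]] := QP w; exists (map_mx tc D^T).
  by rewrite -ME -map_mxM; congr map_mx; apply: trmx_inj; rewrite DE [RHS]trmx_mul trmxK.
have err w : fro2 (AC - QC w *m (adj (QC w) *m AC)) =
    frobenius (A - Q w *m (adjmx (Q w) *m A)) ^+ 2.
  by rewrite frobenius_sqr map_mxB !map_mxM map_adjmx.
have eps0 : 0 < eps by case/andP: eps01.
have tgt : [set w | frobenius (A - Q w *m (adjmx (Q w) *m A)) <=
                (1 + eps) * frobenius (A - Ar)] =
  [set w | fro2 (AC - QC w *m (adj (QC w) *m AC)) <= ((1 + eps) * frobenius (A - Ar)) ^+ 2].
  apply/seteqP; split=> w /=; rewrite err ler_sqr ?nnegrE ?frobenius_ge0//;
  by rewrite mulr_ge0 ?frobenius_ge0// addr_ge0// ltW.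
(* Monotonicity of the measure needs the target event to be measurable, although [Q] is an arbitrary
   choice of bases. *)
rewrite tgt; apply: (le_trans PGd); apply: le_measure; rewrite ?inE//.
  apply: projection_residual_measurable QC_on MQ QM => W.
  exact: (@residual_measurable _ _ _ _ _ _ _ _ _ om Y _ gY i0).
move=> w /Gd_good[low crossB] /=.
have [Z MZ] := MQ w.
apply: le_trans (sketch_error V_on low (QC_on w) MZ) _.
rewrite -/B.
have Bf : fro2 B <= frobenius (A - Ar) ^+ 2.
  by rewrite frobenius_sqr map_mxB; exact: tail_le_approx.
have p0 : 0 < p%:R :> R by rewrite ltr0n.
(* The cross term then adds at most [4 * eps / 2] times [fro2 B], and [1 + 2 eps <= (1 + eps)^2]. *)
have hp' : 8 / p%:R <= eps / 2.
  rewrite ler_pdivrMr//.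
  have : 16 * (1 / eps) <= p%:R :> R.
    apply: le_trans hp.
    apply: ler_pM => //; first by rewrite divr_ge0// ltW.
      by rewrite ler_peMr// exprn_ege1// -expR0 ler_expR.
    by rewrite le_max lexx orbT.
  rewrite mul1r ler_pdivrMr//; lra.
have B0 := fro2_ge0 B.
have := ler_wpM2r B0 hp'.
rewrite exprMn; move: crossB Bf B0; move: (fro2 B) (fro2 _) (8 / _) (frobenius _ ^+ 2) => y z u f h1 h2 h3 h4.
have : eps * y <= eps * f by rewrite ler_pM2l.
have : 0 <= eps ^+ 2 * f by rewrite mulr_ge0 ?sqr_ge0// (le_trans h3).
lra.
Qed.
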